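(* Let $\mathcal E$ be a local Dirichlet form on $L_2(X)$ with $1\in D(\mathcal E)_{\rm loc}$ and such that $D(\mathcal E)\cap L_{\infty,c}(X)$ is a core for $\mathcal E$. Let $d(\cdot\,;\cdot)=d^{(\mathcal E)}(\cdot\,;\cdot)$ denote the corresponding set-theoretic distance. Let $H$ be the positive self-adjoint operator on $L_2(X)$ associated with $\mathcal E$ and $S_t=e^{-tH}$ the semigroup generated by $H$. If $A$ and $B$ are measurable subsets of $X$ then $$|(\varphi_A,S_t\varphi_B)|\le e^{-d(A;B)^2(4t)^{-1}}\|\varphi_A\|_2\,\|\varphi_B\|_2$$ for all $\varphi_A\in L_2(A)$, $\varphi_B\in L_2(B)$ and $t>0$, with the convention $e^{-\infty}=0$.
   Context: $X$ is a topological Hausdorff space equipped with a $\sigma$-finite Borel measure $\mu$; $L_p(X)=L_p(X,\mu)$ consists of complex-valued functions, $L_\infty(X\!:\!\mathbf R)$ denotes the real-valued bounded measurable functions; $1$ is the constant function one; $L_2(A)$ is the subspace of $L_2(X)$ of functions vanishing a.e. outside $A$. Write $\mathcal E(\varphi)=\mathcal E(\varphi,\varphi)$. A Dirichlet form $\mathcal E$ is local if $\mathcal E(\psi,\varphi)=0$ for all $\varphi,\psi\in D(\mathcal E)$ and $a\in\mathbf R$ such that $(\varphi+a1)\psi=0$. A core for $\mathcal E$ is a subspace dense in $D(\mathcal E)$ for the norm $\varphi\mapsto(\mathcal E(\varphi)+\|\varphi\|_2^2)^{1/2}$. $(\operatorname{supp}\varphi)^{\rm c}$ is the union of all open $U\subseteq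 X$ with $\varphi|_U=0$ a.e.; $L_{\infty,c}(X)$ (resp. $L_{\infty,c}(X\!:\!\mathbf R)$) is the set of $\varphi\in L_\infty(X)$ (resp. $L_\infty(X\!:\!\mathbf R)$) with compact support. $D(\mathcal E)_{\rm loc}$ is the vector space of (classes of) measurable $\psi\colon X\to\mathbf C$ such that for every compact $K\subseteq X$ there is a $\hat\psi\in D(\mathcal E)$ with $\psi|_K=\hat\psi|_K$. For $\psi,\varphi\in D(\mathcal E)\cap L_\infty(X\!:\!\mathbf R)$ set $\mathcal I_\psi(\varphi)=\mathcal E(\psi\varphi,\psi)-2^{-1}\mathcal E(\psi^2,\varphi)$. For $\psi\in D(\mathcal E)_{\rm loc}\cap L_\infty(X\!:\!\mathbf R)$ and $\varphi\in D(\mathcal E)\cap L_{\infty,c}(X\!:\!\mathbf R)$ set $\widehat{\mathcal I}_\psi(\varphi)=\mathcal I_{\hat\psi}(\varphi)$, where $\hat\psi\in D(\mathcal E)\cap L_\infty(X\!:\!\mathbf R)$ satisfies $\psi|_{\operatorname{supp}\varphi}=\hat\psi|_{\operatorname{supp}\varphi}$ (well defined by locality). Set $$|||\widehat{\mathcal I}_\psi|||=\sup\{|\widehat{\mathcal I}_\psi(\varphi)|:\varphi\in D(\mathcal E)\cap L_{\infty,c}(X\!:\!\mathbf R),\ \|\varphi\|_1\le1\}\in[0,\infty].$$ For $\psi\in L_\infty(X\!:\!\mathbf R)$ and measurable $A,B\subseteq X$ set $$d_\psi(A\,;B)=\operatorname{ess\,inf}_{x\in A}\psi(x)-\operatorname{ess\,sup}_{y\in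 B}\psi(y)\in(-\infty,\infty],$$ where $\operatorname{ess\,sup}_{y\in B}\psi(y)=\inf\{m\in\mathbf R:\mu(\{y\in B:\psi(y)>m\})=0\}$ and $\operatorname{ess\,inf}_{x\in A}\psi(x)=-\operatorname{ess\,sup}_{x\in A}(-\psi(x))$. Finally $$d^{(\mathcal E)}(A\,;B)=\sup\{d_\psi(A\,;B):\psi\in D_0(\mathcal E)\},\qquad D_0(\mathcal E)=\{\psi\in D(\mathcal E)_{\rm loc}\cap L_\infty(X\!:\!\mathbf R):|||\widehat{\mathcal I}_\psi|||\le1\}.$$
   Formalization: ''Compact support'' here also requires that φ vanish a.e. outside supp φ (automatic for second countable X or Radon measures); without this the form Î_ψ need not be well defined, e.g. on ω₁×R with Dieudonné × Lebesgue measure. *)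

(* Defs.v *)
From HB Require Import structures.
From mathcomp Require Import all_boot all_order all_algebra.
From mathcomp Require Import all_classical all_reals all_analysis.
From mathcomp Require Import complex.
Set Implicit Arguments.
Unset Strict Implicit.
Unset Printing Implicit Defensive.
Import Order.TTheory GRing.Theory Num.Theory.
Import numFieldNormedType.Exports.
Local Open Scope classical_set_scope.
Local Open Scope ring_scope.
Local Open Scope complex_scope.

(* Elements of L_p are represented by functions.  Domains and operators are
   required to be invariant under a.e. equality, so that they descend to
   classes, and all identities between L_p elements are a.e. identities. *)

Section ComplexFunctions.
Context d (T : measurableType d) (R : realType).
Variable mu : {measure set T -> \bar R}.
Implicit Types (f g h : T -> R[i]) (u : T -> R).

Definition Rpart f : T -> R := fun x => complex.Re (f x).
Definition Ipart f : T -> R := fun x => complex.Im (f x).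
Definition cplx u : T -> R[i] := fun x => (u x)%:C.
Definition absf f : T -> R := fun x => Normc.normc (f x).
Definition conjf f : T -> R[i] := fun x => ((f x)^*)%C.

Definition ae_eqc f g := {ae mu, forall x, f x = g x}.
Definition ae_eq_on (K : set T) f g := {ae mu, forall x, K x -> f x = g x}.

Definition cmeasurable f :=
  measurable_fun setT (Rpart f) /\ measurable_fun setT (Ipart f).

Definition L2 : set (T -> R[i]) :=
  [set f | Rpart f \in Lfun mu 2%:E /\ Ipart f \in Lfun mu 2%:E].
Definition Linf : set (T -> R[i]) :=
  [set f | Rpart f \in Lfun mu +oo%E /\ Ipart f \in Lfun mu +oo%E].
Definition LinfR : set (T -> R) := [set u | u \in Lfun mu +oo%E].

Definition L2_on (A : set T) : set (T -> R[i]) :=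
  [set f | L2 f /\ {ae mu, forall x, ~ A x -> f x = 0}].

Definition L2norm f : R := fine ('N[mu]_2[EFin \o absf f])%E.

(* linear in the first argument, antilinear in the second *)
Definition inner f g : R[i] :=
  (\int[mu]_x complex.Re (f x * (g x)^*)%C) +i* (\int[mu]_x complex.Im (f x * (g x)^*)%C).

(* Values outside fdom are junk. *)
Record l2form := L2Form {
  fdom : set (T -> R[i]);
  form_val :> (T -> R[i]) -> (T -> R[i]) -> R[i] }.

Implicit Types E : l2form.

(* E(f) = E(f, f), which is real for the forms below *)
Definition energy E f : R := complex.Re (E f f).

(* Dirichlet form on the complex space L_2: a densely defined, closed,
   nonnegative hermitian form which is real (i.e. the complexification of its
   restriction to real functions) and on which the unit contraction
   u |-> min (max u 0) 1 operates. *)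
Record dirichlet_form E : Prop := {
  df_L2 : fdom E `<=` L2;
  df_ae_dom : forall f g, fdom E f -> L2 g -> ae_eqc f g -> fdom E g;
  df_ae_val : forall f g h, fdom E f -> fdom E g -> fdom E h -> ae_eqc f g ->
    E f h = E g h;
  df_dom0 : fdom E (cst 0);
  df_domP : forall (c : R[i]) f g, fdom E f -> fdom E g ->
    fdom E (fun x => c * f x + g x);
  df_linear : forall (c : R[i]) f g h, fdom E f -> fdom E g -> fdom E h ->
    E (fun x => c * f x + g x) h = c * E f h + E g h;
  df_hermitian : forall f g, fdom E f -> fdom E g -> E g f = ((E f g)^*)%C;
  df_ge0 : forall f, fdom E f -> 0 <= E f f;
  df_dense : forall f (e : R), L2 f -> 0 < e ->
    exists2 g, fdom E g & L2norm (f \- g) < e;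
  df_closed : forall (u : nat -> T -> R[i]) f,
    (forall n, fdom E (u n)) -> L2 f ->
    (fun n => L2norm (u n \- f)) @ \oo --> (0 : R) ->
    (forall e : R, 0 < e -> exists N : nat, forall m n : nat,
      (N <= m)%N -> (N <= n)%N -> energy E (u m \- u n) < e) ->
    fdom E f /\ (fun n => energy E (u n \- f)) @ \oo --> (0 : R);
  df_conj_dom : forall f, fdom E f -> fdom E (conjf f);
  df_conj : forall f g, fdom E f -> fdom E g ->
    E (conjf f) (conjf g) = ((E f g)^*)%C;
  df_markov : forall u, fdom E (cplx u) ->
    fdom E (cplx (fun x => Num.min (Num.max (u x) 0) 1)) /\
    energy E (cplx (fun x => Num.min (Num.max (u x) 0) 1)) <= energy E (cplx u)
}.

Definition local_form E := forall f g (a : R), fdom E f -> fdom E g ->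
  {ae mu, forall x, (f x + a%:C) * g x = 0} -> E g f = 0.

Definition is_core E (C : set (T -> R[i])) :=
  [/\ C `<=` fdom E, C (cst 0),
    forall (c : R[i]) f g, C f -> C g -> C (fun x => c * f x + g x) &
  forall f (e : R), fdom E f -> 0 < e -> exists2 g, C g &
    Num.sqrt (energy E (f \- g) + L2norm (f \- g) ^+ 2) < e].

(* Graph of the self-adjoint operator H associated with E:  H f = g  iff
   f is in D(E) and  E(f, h) = (g, h)  for all h in D(E). *)
Definition form_operator E f g :=
  [/\ fdom E f, L2 g & forall h, fdom E h -> E f h = inner g h].

Record C0_semigroup (S : R -> (T -> R[i]) -> (T -> R[i])) : Prop := {
  sg_L2 : forall t f, 0 <= t -> L2 f -> L2 (S t f);
  sg_ae : forall t f g, 0 <= t -> L2 f -> L2 g -> ae_eqc f g ->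
    ae_eqc (S t f) (S t g);
  sg_linear : forall t (c : R[i]) f g, 0 <= t -> L2 f -> L2 g ->
    ae_eqc (S t (fun x => c * f x + g x)) (fun x => c * S t f x + S t g x);
  sg_bounded : forall t, 0 <= t ->
    exists M : R, forall f, L2 f -> L2norm (S t f) <= M * L2norm f;
  sg_0 : forall f, L2 f -> ae_eqc (S 0 f) f;
  sg_D : forall s t f, 0 <= s -> 0 <= t -> L2 f ->
    ae_eqc (S (s + t) f) (S s (S t f));
  sg_cont : forall f, L2 f -> L2norm (S t f \- f) @[t --> 0^'+] --> (0 : R)
}.

(* S_t = e^{-tH}: the C_0-semigroup S has H (given by its graph) as generator,
   with the sign convention  H f = lim_{t -> 0+} t^{-1} (f - S_t f)  in L_2. *)
Definition semigroup_generated_by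
    (H : (T -> R[i]) -> (T -> R[i]) -> Prop)
    (S : R -> (T -> R[i]) -> (T -> R[i])) :=
  C0_semigroup S /\
  forall f g, H f g <->
    [/\ L2 f, L2 g &
      L2norm (fun x => (t^-1)%:C * (f x - S t f x) - g x) @[t --> 0^'+]
        --> (0 : R)].

(* for real psi and phi; the value is real *)
Definition cdc E (psi phi : T -> R) : R[i] :=
  E (cplx (psi \* phi)) (cplx psi) - 2^-1 * E (cplx (psi \* psi)) (cplx phi).

Definition ess_sup_on (B : set T) u : \bar R :=
  ereal_inf [set m%:E | m in [set m : R | mu (B `&` [set y | m < u y]) = 0%E]].
Definition ess_inf_on (A : set T) u : \bar R :=
  (- ess_sup_on A (fun x => - u x)%R)%E.

(* d_psi(A ; B); no oo - oo occurs when u is essentially bounded *)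
Definition dist_fun u (A B : set T) : \bar R :=
  (ess_inf_on A u - ess_sup_on B u)%E.

End ComplexFunctions.

Notation borel X := (g_sigma_algebraType (@open X)).

Section Topological.
Context (X : ptopologicalType) (R : realType).
Variable mu : {measure set (borel X) -> \bar R}.
Implicit Types (E : l2form (borel X) R) (f : borel X -> R[i]) (u : borel X -> R).

Definition esupp f : set X :=
  ~` \bigcup_(U in [set U : set X | open U /\ ae_eq_on mu U f (cst 0)]) U.

(* f is carried by a compact support.  The second conjunct is automatic when X
   is second countable (ae_eq0_suppC below); it only matters for
   pathological measures on non-separable spaces (for instance the Dieudonne
   measure on omega_1, for which every f has empty support), where it is what
   makes hatI below independent of the extension. *)
Definition compact_supp f :=
  compact (esupp f) /\ ae_eq_on mu (~` esupp f) f (cst 0).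

Definition Linfc : set (borel X -> R[i]) :=
  [set f | Linf mu f /\ compact_supp f].
Definition LinfcR : set (borel X -> R) :=
  [set u | LinfR mu u /\ compact_supp (cplx u)].

Definition dom_loc E : set (borel X -> R[i]) :=
  [set f | cmeasurable f /\ forall K : set X, compact K ->
    exists2 g, fdom E g & ae_eq_on mu K f g].

(* v is the value of \hat I_psi(phi); by locality it does not depend on the
   extension psih *)
Definition hatI E (psi phi : borel X -> R) (v : R[i]) :=
  exists psih : borel X -> R,
    [/\ fdom E (cplx psih), LinfR mu psih,
        ae_eq_on mu (esupp (cplx phi)) (cplx psi) (cplx psih) &
        v = cdc E psih phi].

Definition hatI_norm E (psi : borel X -> R) : \bar R :=
  ereal_sup [set r | exists phi v,
    [/\ fdom E (cplx phi) /\ LinfcR phi, ('N[mu]_1[EFin \o phi] <= 1)%E,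
        hatI E psi phi v & r = (Normc.normc v)%:E]].

Definition D0 E : set (borel X -> R) :=
  [set psi | [/\ dom_loc E (cplx psi), LinfR mu psi &
              (hatI_norm E psi <= 1)%E]].

Definition dE E (A B : set (borel X)) : \bar R :=
  ereal_sup [set dist_fun mu psi A B | psi in D0 E].

Lemma ae_eq0_suppC f : @second_countable X ->
  ae_eq_on mu (~` esupp f) f (cst 0).
Proof.
move=> [B cB [Bo Bn]].
set F := B `&` [set U : set X | ae_eq_on mu U f (cst 0)].
have /countable_injP[h hI] : countable F.
  by apply: sub_countable cB; apply: subset_card_le => U [].
have Fae U : F U -> mu.-negligible [set x | U x /\ f x <> 0].
  move=> [_ /negligibleS]; apply=> x /= [Ux fx0]; exact/not_implyP.
pose G n := [set x : borel X | exists U, [/\ F U, h U = n, U x & f x <> 0]].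
have Gn n : mu.-negligible (G n).
  have [[U [FU hU]]|nU] := pselect (exists U, F U /\ h U = n).
    apply: (negligibleS _ (Fae _ FU)) => x [V [FV hV Vx fx0]]; split=> //.
    by rewrite (hI U V) ?inE// hU hV.
  apply: (negligibleS _ (negligible_set0 _)) => x [V [FV hV _ _]].
  by apply: nU; exists V.
apply: (negligibleS _ (negligible_bigcup Gn)) => x /not_implyP[].
rewrite /esupp setCK => -[U [oU Uae] Ux] fx0.
have [V [BV Vx] VU] := Bn x U (open_nbhs_nbhs (conj oU Ux)).
exists (h V) => //; exists V; split=> //; split=> //.
by apply: filterS Uae => y Uy /VU.
Qed.

End Topological.

(* Main.v *)
(* For psi in D_0(E) and w = exp (r psi), the bound follows from
   |w S_t f|_2 <= exp (r^2 t) |w f|_2, optimized over r >= 0.  By a Gronwall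
   argument this reduces to E(u, w^2 u) >= - r^2 |w u|_2^2 for u in D(E).  No chain
   rule is used: the resolvent is submarkovian, so that an expression
   sum_i E(a_i, b_i) in bounded functions is nonnegative as soon as
   sum_i (a_i(x) - a_i(y)) (b_i(x) - b_i(y)) and sum_i a_i(x) b_i(x) are.  Since
   2 cosh s - 2 <= (1 + eps) s^2 + C s^4, this gives
   E(u, w^2 u) + (1 + eps) r^2 I_psi (w^2 u^2) + C' Q(psi) >= 0, where
   Q(psi) = 4 E(psi^3, psi) - 3 E(psi^2, psi^2) is the fourth moment of the jumps
   of psi.  Locality yields Q(psi) <= 0: the range of psi can be cut into slices of
   length eps whose energies add up.  A similar positivity argument bounds
   E(w^2 u) by E(u) + |u|_2^2, which allows one to pass from the core to D(E). *)
Require Import Defs.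
From mathcomp Require Import all_boot all_order all_algebra.
From mathcomp Require Import all_classical all_reals all_analysis.
From mathcomp Require Import measurable_realfun ess_sup_inf.
From mathcomp Require Import complex ring lra.
Set Implicit Arguments.
Unset Strict Implicit.
Unset Printing Implicit Defensive.
Import Order.TTheory GRing.Theory Num.Theory.
Import numFieldNormedType.Exports.
Local Open Scope classical_set_scope.
Local Open Scope ring_scope.

(** * Semi-inner products *)

(** The space is only Hausdorff and the form is not assumed regular, so no jump kernel and no energy
    measure are at hand, and [S] is known only as a C_0-semigroup with a given generator. Two
    substitutes shape the proof. First, in the bounded form k (u - k (k + H)^-1 u, v) the operator k
    (k + H)^-1 behaves like a symmetric kernel of mass at most one; positivity is proved there, and
    k tends to infinity. In this picture, with V = w u and s = r (psi(x) - psi(y)), the integrand of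
    E(u, w^2 u) is (V(x) - V(y))^2 - V(x) V(y) (2 cosh s - 2), while that of I_psi(f) is (f(x) +
    f(y)) (psi(x) - psi(y))^2 / 2; the two meet through V(x) V(y) <= (V(x)^2 + V(y)^2) / 2.
    Secondly, psi is only locally in the domain. It is replaced by a bounded element of D(E) that
    agrees with it on the support of one core function, so the constants must not depend on that
    function, and the limit is taken by closedness. The exponent is the minimum of r^2 t - r d,
    reached at r = d / (2 t). *)

(* [b] is unconstrained outside the subspace [D]. *)
Record sip (R : realType) (V : lmodType R) (D : set V) (b : V -> V -> R) :
  Prop := Sip {
  sip_dom0 : D 0;
  sip_domP : forall c u v, D u -> D v -> D (c *: u + v);
  sip_linl : forall c u v w, D u -> D v -> D w ->
    b (c *: u + v) w = c * b u w + b v w;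
  sip_sym : forall u v, D u -> D v -> b u v = b v u;
  sip_ge0 : forall u, D u -> 0 <= b u u }.

Definition nrm (R : realType) (V : lmodType R) (b : V -> V -> R) (u : V) : R :=
  Num.sqrt (b u u).

(** Written with epsilons rather than as a filter limit: several semi-norms live on the same [V],
    and limits are unique only up to vectors of norm zero. *)
Definition ncvg (R : realType) (V : lmodType R) (b : V -> V -> R)
    (u : nat -> V) (x : V) :=
  forall e : R, 0 < e -> exists N, forall n, (N <= n)%N -> nrm b (u n - x) < e.

Definition ncauchy (R : realType) (V : lmodType R) (b : V -> V -> R)
    (u : nat -> V) :=
  forall e : R, 0 < e -> exists N, forall m n, (N <= m)%N -> (N <= n)%N ->
    nrm b (u m - u n) < e.

Definition ncomplete (R : realType) (V : lmodType R) (L : set V)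
    (b : V -> V -> R) :=
  forall u : nat -> V, (forall n, L (u n)) -> ncauchy b u ->
    exists2 x, L x & ncvg b u x.

(** Discriminant criterion, including the degenerate case [a = 0] because the forms are only
    semi-definite. Besides Cauchy-Schwarz, it gives the Euler-Lagrange equation of an approximate
    minimizer in [resolvent_ex]. *)
Lemma sqr_le_of_quadratic (R : realType) (a b c : R) : 0 <= a ->
  (forall t, 0 <= t ^+ 2 * a + 2 * t * b + c) -> b ^+ 2 <= a * c.
Proof.
move=> a0 quad; have [a_le0|a_gt0] := leP a 0.
  have a_eq0 : a = 0 by lra.
  rewrite a_eq0 mul0r.
  have [->|nz] := eqVneq b 0; first by rewrite expr0n.
  (* At this point the polynomial takes the value -1. *)
  have := quad (- (c + 1) / (2 * b)); rewrite a_eq0 mulr0 add0r.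
  have -> : 2 * (- (c + 1) / (2 * b)) * b = - (c + 1) by field.
  by lra.
have := quad (- b / a).
have -> : (- b / a) ^+ 2 * a + 2 * (- b / a) * b + c = (a * c - b ^+ 2) / a.
  by field; rewrite gt_eqF.
by rewrite pmulr_lge0 ?invr_gt0// subr_ge0.
Qed.

Lemma invS_small (R : realType) (e : R) : 0 < e ->
  exists N, forall n, (N <= n)%N -> n.+1%:R^-1 < e.
Proof.
move=> e0; have [N _ hN] := near_infty_natSinv_lt (PosNum e0).
by exists N => n /hN.
Qed.

Section Sip.
Context (R : realType) (V : lmodType R) (D : set V) (b : V -> V -> R).
Hypothesis H : sip D b.
Implicit Types (u v w : V) (c : R).

Let D0 : D 0 := sip_dom0 H.

Lemma sip_domZ c u : D u -> D (c *: u).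
Proof. by move=> Du; rewrite -[_ *: _]addr0; exact: (sip_domP H). Qed.

Lemma sip_domD u v : D u -> D v -> D (u + v).
Proof. by move=> Du Dv; rewrite -[u]scale1r; exact: (sip_domP H). Qed.

Lemma sip_domN u : D u -> D (- u).
Proof. by move=> Du; rewrite -scaleN1r; exact: sip_domZ. Qed.

Lemma sip_domB u v : D u -> D v -> D (u - v).
Proof. by move=> Du Dv; apply: sip_domD => //; exact: sip_domN. Qed.

Lemma sip0l u : D u -> b 0 u = 0.
Proof.
move=> Du; have := sip_linl H 1 D0 D0 Du; rewrite scale1r addr0 mul1r.
by lra.
Qed.

Lemma sipZl c u v : D u -> D v -> b (c *: u) v = c * b u v.
Proof.
by move=> Du Dv; rewrite -[_ *: _]addr0 (sip_linl H)// sip0l// addr0.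
Qed.

Lemma sipDl u v w : D u -> D v -> D w -> b (u + v) w = b u w + b v w.
Proof.
by move=> Du Dv Dw; rewrite -[u in LHS]scale1r (sip_linl H)// mul1r.
Qed.

Lemma sipNl u v : D u -> D v -> b (- u) v = - b u v.
Proof. by move=> Du Dv; rewrite -scaleN1r sipZl// mulN1r. Qed.

Lemma sipBl u v w : D u -> D v -> D w -> b (u - v) w = b u w - b v w.
Proof.
by move=> Du Dv Dw; rewrite sipDl ?sipNl//; exact: sip_domN.
Qed.

Lemma sip0r u : D u -> b u 0 = 0.
Proof. by move=> Du; rewrite (sip_sym H)// sip0l. Qed.

Lemma sipZr c u v : D u -> D v -> b u (c *: v) = c * b u v.
Proof.
move=> Du Dv; rewrite (sip_sym H) ?sipZl//; last exact: sip_domZ.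
by rewrite (sip_sym H).
Qed.

Lemma sipDr u v w : D u -> D v -> D w -> b u (v + w) = b u v + b u w.
Proof.
move=> Du Dv Dw; rewrite (sip_sym H)//; last exact: sip_domD.
by rewrite sipDl// (sip_sym H Du Dv)// (sip_sym H Du Dw).
Qed.

Lemma sipNr u v : D u -> D v -> b u (- v) = - b u v.
Proof. by move=> Du Dv; rewrite -scaleN1r sipZr// mulN1r. Qed.

Lemma sipBr u v w : D u -> D v -> D w -> b u (v - w) = b u v - b u w.
Proof.
by move=> Du Dv Dw; rewrite sipDr ?sipNr//; exact: sip_domN.
Qed.

Lemma sip_dom_sum I (r : seq I) (P : pred I) (F : I -> V) :
  (forall i, D (F i)) -> D (\sum_(i <- r | P i) F i).
Proof.
move=> DF; apply: (big_ind D) => //.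
by move=> x y; exact: sip_domD.
Qed.

Lemma sip_suml I (r : seq I) (F : I -> V) u : (forall i, D (F i)) -> D u ->
  b (\sum_(i <- r) F i) u = \sum_(i <- r) b (F i) u.
Proof.
move=> DF Du; elim: r => [|i r IH]; first by rewrite !big_nil sip0l.
by rewrite !big_cons sipDl ?IH//; exact: sip_dom_sum.
Qed.

Lemma sip_sqD u v : D u -> D v ->
  b (u + v) (u + v) = b u u + 2 * b u v + b v v.
Proof.
move=> Du Dv; have Duv := sip_domD Du Dv.
by rewrite sipDl// !sipDr// (sip_sym H Dv Du)//; ring.
Qed.

Lemma sip_sqB u v : D u -> D v ->
  b (u - v) (u - v) = b u u - 2 * b u v + b v v.
Proof.
move=> Du Dv; have Duv := sip_domB Du Dv.
by rewrite sipBl// !sipBr// (sip_sym H Dv Du)//; ring.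
Qed.

Lemma nrm_ge0 u : 0 <= nrm b u. Proof. exact: sqrtr_ge0. Qed.

Lemma nrm_sq u : D u -> nrm b u ^+ 2 = b u u.
Proof. by move=> Du; rewrite sqr_sqrtr// (sip_ge0 H). Qed.

Lemma sip_CS2 u v : D u -> D v -> (b u v) ^+ 2 <= b u u * b v v.
Proof.
move=> Du Dv.
have quad t : 0 <= t ^+ 2 * b u u + 2 * t * b u v + b v v.
  have Dt := sip_domZ t Du.
  have := sip_ge0 H (sip_domD Dt Dv).
  by rewrite sip_sqD// !sipZl// sipZr//; lra.
by apply: sqr_le_of_quadratic quad; exact: (sip_ge0 H).
Qed.

Lemma sip_CS u v : D u -> D v -> `|b u v| <= nrm b u * nrm b v.
Proof.
move=> Du Dv; rewrite -ler_sqr ?nnegrE ?normr_ge0 ?mulr_ge0 ?nrm_ge0//.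
by rewrite real_normK ?num_real// exprMn !nrm_sq// sip_CS2.
Qed.

Lemma nrmD u v : D u -> D v -> nrm b (u + v) <= nrm b u + nrm b v.
Proof.
move=> Du Dv; rewrite -ler_sqr ?nnegrE ?addr_ge0 ?nrm_ge0//.
rewrite nrm_sq ?sip_sqD//; last exact: sip_domD.
rewrite sqrrD !nrm_sq//; have := sip_CS Du Dv.
by have := ler_norm (b u v); lra.
Qed.

Lemma nrmZ c u : D u -> nrm b (c *: u) = `|c| * nrm b u.
Proof.
move=> Du; have Dcu := sip_domZ c Du; rewrite /nrm sipZl// sipZr// mulrA -expr2.
by rewrite sqrtrM ?sqr_ge0// sqrtr_sqr.
Qed.

Lemma nrmN u : D u -> nrm b (- u) = nrm b u.
Proof. by move=> Du; rewrite -scaleN1r nrmZ// normrN1 mul1r. Qed.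

Lemma nrm0 : nrm b 0 = 0. Proof. by rewrite /nrm sip0l// sqrtr0. Qed.

Lemma nrmBC u v : D u -> D v -> nrm b (u - v) = nrm b (v - u).
Proof. by move=> Du Dv; rewrite -nrmN ?opprB//; exact: sip_domB. Qed.

Lemma nrmB u v : D u -> D v -> nrm b (u - v) <= nrm b u + nrm b v.
Proof. by move=> Du Dv; rewrite -(nrmN Dv) nrmD//; exact: sip_domN. Qed.

Lemma nrm_tri w u v : D u -> D v -> D w ->
  nrm b (u - v) <= nrm b (u - w) + nrm b (w - v).
Proof.
move=> Du Dv Dw; have -> : u - v = (u - w) + (w - v) by rewrite addrA subrK.
by apply: nrmD; exact: sip_domB.
Qed.

Lemma nrm_dist u v : D u -> D v -> `|nrm b u - nrm b v| <= nrm b (u - v).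
Proof.
move=> Du Dv; have Duv := sip_domB Du Dv; have Dvu := sip_domB Dv Du.
have h1 := nrmD Duv Dv; have h2 := nrmD Dvu Du.
move: h1 h2; rewrite !subrK (nrmBC Dv Du) => h1 h2.
by rewrite ler_norml; lra.
Qed.

Lemma ncvg_cauchy (x : nat -> V) y : (forall n, D (x n)) -> D y ->
  ncvg b x y -> ncauchy b x.
Proof.
move=> Dx Dy h e e0; have /h[N hN] : 0 < e / 2 by lra.
exists N => m n /hN hm /hN hn; apply: le_lt_trans (nrm_tri (Dx m) (Dx n) Dy) _.
by rewrite (nrmBC Dy (Dx n)); lra.
Qed.

Lemma ncvg_sipr (x : nat -> V) y u (l : R) :
  (forall n, D (x n)) -> D y -> D u ->
  ncvg b x y -> (forall e, 0 < e -> exists N, forall n, (N <= n)%N ->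
     `|b (x n) u - l| < e) -> b y u = l.
Proof.
move=> Dx Dy Du xy xl; apply/eqP; rewrite -subr_eq0 -normr_le0.
apply/ler_addgt0Pr => e e0; rewrite add0r.
have e4 : 0 < e / 2 / (nrm b u + 1).
  by rewrite divr_gt0//; [lra|have := nrm_ge0 u; lra].
have e2 : 0 < e / 2 by lra.
have [N1 h1] := xy _ e4; have [N2 h2] := xl _ e2.
pose n := maxn N1 N2.
have {}h1 := h1 n (leq_maxl _ _); have {}h2 := h2 n (leq_maxr _ _).
have -> : b y u - l = (b (x n) u - l) - b (x n - y) u by rewrite sipBl//; ring.
apply: le_trans (ler_normB _ _) _.
have := sip_CS (sip_domB (Dx n) Dy) Du.
have : nrm b (x n - y) * nrm b u <= e / 2.
  have nu := nrm_ge0 u.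
  apply: (@le_trans _ _ (e / 2 / (nrm b u + 1) * (nrm b u + 1))).
    by apply: ler_pM; rewrite ?nrm_ge0 ?ltW//; lra.
  by rewrite divfK//; lra.
by lra.
Qed.

End Sip.

Lemma sip_sub (R : realType) (V : lmodType R) (D D' : set V) b :
  sip D b -> D' `<=` D -> D' 0 ->
  (forall c u v, D' u -> D' v -> D' (c *: u + v)) -> sip D' b.
Proof.
move=> H s h0 h1; split=> //.
- by move=> *; apply: (sip_linl H); exact: s.
- by move=> *; apply: (sip_sym H); exact: s.
- by move=> *; apply: (sip_ge0 H); exact: s.
Qed.

Lemma sip_add (R : realType) (V : lmodType R) (D : set V) b1 b2 (k : R) :
  sip D b1 -> sip D b2 -> 0 <= k -> sip D (fun u v => b1 u v + k * b2 u v).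
Proof.
move=> H1 H2 k0; split.
- exact: (sip_dom0 H1).
- exact: (sip_domP H1).
- by move=> c u v w Du Dv Dw; rewrite (sip_linl H1)// (sip_linl H2)//; ring.
- by move=> u v Du Dv; rewrite (sip_sym H1)// (sip_sym H2).
- by move=> u Du; rewrite addr_ge0 ?mulr_ge0// ?(sip_ge0 H1) ?(sip_ge0 H2).
Qed.

(** * The resolvent by minimization, and Yosida approximation of a form *)

Section Resolvent.
Context (R : realType) (V : lmodType R) (L D : set V) (ip e : V -> V -> R).
Hypotheses (HL : sip L ip) (HD : sip D e) (DL : D `<=` L).
Hypothesis Lc : ncomplete L ip.
Hypothesis Dc : forall (u : nat -> V) x, (forall n, D (u n)) -> L x ->
  ncvg ip u x -> ncauchy e u -> D x /\ ncvg e u x.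

Lemma resolvent_ex (k : R) f : 0 < k -> L f -> exists v, D v /\
  forall w, D w -> e v w = k * ip (f - v) w.
Proof.
move=> k0 Lf.
have HDip : sip D ip.
  by apply: (sip_sub HL) => //; [exact: (sip_dom0 HD)|exact: (sip_domP HD)].
pose q u v := e u v + k * ip u v.
have Hq : sip D q by exact: (sip_add HD HDip (ltW k0)).
pose J v := q v v - 2 * k * ip f v.
pose A := [set J v | v in D].
(* Completing the square: [J v] is [e v v + k ip (f - v) (f - v)] minus this constant. *)
have lbA : lbound A (- (k * ip f f)).
  move=> _ [v Dv <-]; have Lv := DL Dv; rewrite /J /q.
  have := sip_ge0 HL (sip_domB HL Lf Lv); rewrite (sip_sqB HL)//.
  have := sip_ge0 HD Dv => ev h.
  have : 0 <= k * (ip f f - 2 * ip f v + ip v v) by rewrite mulr_ge0// ltW.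
  by lra.
have iA : has_inf A.
  by split; [exists (J 0), 0 => //; exact: (sip_dom0 HD)|exists (- (k * ip f f))].
pose m := inf A.
have near_ex n : exists v, D v /\ J v < m + n.+1%:R^-1.
  have /inf_adherent/(_ iA)[_ [v Dv <-] h] : 0 < n.+1%:R^-1 :> R by rewrite invr_gt0.
  by exists v.
have [x hx] := choice near_ex.
have Dx n : D (x n) by case: (hx n).
have m_le v : D v -> m <= J v by move=> Dv; apply: ge_inf; [case: iA|exists v].
(* Parallelogram law, with [J] at least [m] at the midpoint of [u] and [v]. *)
have mid u v : D u -> D v -> q (u - v) (u - v) <= 2 * (J u + J v - 2 * m).
  move=> Du Dv; have := m_le _ (sip_domZ Hq 2^-1 (sip_domD Hq Du Dv)).
  have Duv := sip_domD Hq Du Dv.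
  rewrite /J (sip_sqB Hq)// (sipZl Hq)//; last exact: (sip_domZ Hq).
  rewrite (sipZr Hq)// (sip_sqD Hq)// (sipZr HL)//; try exact: DL.
  rewrite (sipDr HL)//; try exact: DL.
  by lra.
have qc : ncauchy q x.
  move=> e0 e0_gt0.
  have /invS_small[N hN] : 0 < e0 ^+ 2 / 4 by rewrite divr_gt0// exprn_gt0.
  exists N => i j /hN hi /hN hj; have Dij := sip_domB Hq (Dx i) (Dx j).
  rewrite -ltr_sqr ?nnegrE ?nrm_ge0 ?ltW//.
  rewrite (nrm_sq Hq)//; apply: le_lt_trans (mid _ _ (Dx i) (Dx j)) _.
  have [_ Ji] := hx i; have [_ Jj] := hx j.
  move: hi hj Ji Jj; move: (i.+1%:R^-1) (j.+1%:R^-1) => a c; lra.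
have eq_le u : D u -> nrm e u <= nrm q u.
  move=> Du; rewrite /nrm ler_sqrt; last exact: (sip_ge0 Hq).
  by rewrite /q lerDl mulr_ge0 ?(ltW k0)// (sip_ge0 HL)//; exact: DL.
have ipq_le u : D u -> nrm ip u <= nrm q u / Num.sqrt k.
  move=> Du; rewrite ler_pdivlMr ?sqrtr_gt0// /nrm -sqrtrM; last first.
    by rewrite (sip_ge0 HL)//; exact: DL.
  rewrite ler_sqrt; last exact: (sip_ge0 Hq).
  by rewrite mulrC /q lerDr (sip_ge0 HD).
have [y Ly xy] : exists2 y, L y & ncvg ip x y.
  apply: Lc => [n|e0 e0_gt0]; first exact: DL.
  have /qc[N hN] : 0 < e0 * Num.sqrt k by rewrite mulr_gt0// sqrtr_gt0.
  exists N => i j Ni Nj; apply: le_lt_trans (ipq_le _ (sip_domB Hq (Dx i) (Dx j))) _.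
  by rewrite ltr_pdivrMr ?sqrtr_gt0// hN.
have [Dy exy] : D y /\ ncvg e x y.
  apply: Dc => // e0 e0_gt0; have [N hN] := qc _ e0_gt0.
  exists N => i j Ni Nj.
  by apply: le_lt_trans (eq_le _ (sip_domB Hq (Dx i) (Dx j))) _; exact: hN.
have qxy : ncvg q x y.
  move=> e0 e0_gt0.
  have e2 : 0 < e0 / 2 by lra.
  have e3 : 0 < e0 / 2 / Num.sqrt k by rewrite divr_gt0// sqrtr_gt0.
  have [N1 h1] := exy _ e2; have [N2 h2] := xy _ e3.
  exists (maxn N1 N2) => n; rewrite geq_max => /andP[/h1 {}h1 /h2 {}h2].
  have Dd := sip_domB Hq (Dx n) Dy.
  have n1 := nrm_ge0 e (x n - y); have n2 := nrm_ge0 ip (x n - y).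
  rewrite ltr_pdivlMr ?sqrtr_gt0// in h2.
  rewrite -ltr_sqr ?nnegrE ?nrm_ge0 ?ltW//.
  rewrite (nrm_sq Hq)// /q -(nrm_sq HD)// -(nrm_sq HL); last exact: DL.
  rewrite -{1}(sqr_sqrtr (ltW k0)) -exprMn.
  have s0 := sqrtr_ge0 k.
  have n3 : 0 <= Num.sqrt k * nrm ip (x n - y) by rewrite mulr_ge0.
  rewrite mulrC in h2.
  move: h1 h2 n1 n3; move: (nrm e _) (Num.sqrt k * _) => a c; nra.
exists y; split => // w Dw.
rewrite (sipBl HL)//; try exact: DL.
suff : q y w = k * ip f w by rewrite /q; lra.
apply: (ncvg_sipr Hq Dx Dy Dw qxy) => e0 e0_gt0.
have qw := sip_ge0 Hq Dw.
have /invS_small[N hN] : 0 < e0 ^+ 2 / (q w w + 1).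
  by rewrite divr_gt0 ?exprn_gt0//; lra.
exists N => n /hN hn; rewrite -ltr_sqr ?nnegrE ?normr_ge0 ?ltW//.
rewrite real_normK ?num_real//.
have [_ Jn] := hx n.
(* Moving from [x n] in the direction [w] lowers [J] by at most [1 / (n + 1)], which makes a
   quadratic polynomial in the step [t] nonnegative. *)
have h2 : (q (x n) w - k * ip f w) ^+ 2 <= q w w * n.+1%:R^-1.
  apply: sqr_le_of_quadratic => // t.
  have Dtw := sip_domZ Hq t Dw.
  have := m_le _ (sip_domD Hq (Dx n) Dtw).
  rewrite /J (sip_sqD Hq)// (sipDr HL)//; try exact: DL.
  rewrite (sipZl Hq)// !(sipZr Hq)// (sipZr HL)//; last exact: DL.
  by move: Jn; rewrite /J; move: (n.+1%:R^-1) => i; lra.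
apply: le_lt_trans h2 _.
move: hn; rewrite ltr_pdivlMr; last by lra.
move: (n.+1%:R^-1) (invr_gt0 (n.+1%:R : R)) => i; rewrite ltr0n/= => i0.
by nra.
Qed.

Section Approx.
Context (u : V) (x : nat -> V).
Hypothesis Lu : L u.
Hypothesis Hx : forall n, D (x n) /\
  forall w, D w -> e (x n) w = n.+1%:R * ip (u - x n) w.

Let Dx n : D (x n). Proof. by case: (Hx n). Qed.
Let Lx n : L (x n). Proof. exact: DL. Qed.
Let ex n w : D w -> e (x n) w = n.+1%:R * ip (u - x n) w.
Proof. by case: (Hx n) => _; apply. Qed.

(* [x n] is [k (k + H)^-1 u] for [k = n + 1], and the left-hand side below is the
   Yosida approximation of [e u u]. *)
Lemma approx_energy n : n.+1%:R * ip (u - x n) u =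
  e (x n) (x n) + n.+1%:R * ip (u - x n) (u - x n).
Proof.
rewrite ex// !(sipBl HL)// ?(sipBr HL)//; last exact: (sip_domB HL).
by ring.
Qed.

(** The Yosida value equals [e (x n) u] and dominates [e (x n) (x n)], so Cauchy-Schwarz
    suffices. *)
Lemma approx_le n : D u -> n.+1%:R * ip (u - x n) u <= e u u.
Proof.
move=> Du; have h := sip_CS2 HD (Dx n) Du.
have n0 : 0 <= n.+1%:R * ip (u - x n) (u - x n).
  by rewrite mulr_ge0// (sip_ge0 HL)//; exact: (sip_domB HL).
have h2 : e (x n) (x n) <= n.+1%:R * ip (u - x n) u by rewrite approx_energy; lra.
rewrite -ex// in h2 *; rewrite leNgt; apply/negP => h3.
have h4 := sip_ge0 HD Du; have h5 := sip_ge0 HD (Dx n).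
by nra.
Qed.

Let m n := n.+1%:R * ip (u - x n) u.

(** The Yosida values increase, and their increments control the squared distance between the
    approximants: bounded values will give a sequence that is Cauchy in energy. *)
Let m_diff n k : (n <= k)%N ->
  e (x k - x n) (x k - x n) + n.+1%:R * ip (x k - x n) (x k - x n) <= m k - m n.
Proof.
move=> nk; rewrite {1}/m approx_energy /m.
rewrite (sip_sqB HD)// (sip_sym HD (Dx k) (Dx n)) (ex n (Dx k)) (ex n (Dx n)).
have Lk := sip_domB HL Lu (Lx k); have Ln := sip_domB HL Lu (Lx n).
have : n.+1%:R * ip (u - x k) (u - x k) <= k.+1%:R * ip (u - x k) (u - x k).
  by rewrite ler_wpM2r ?(sip_ge0 HL)// ler_nat.
rewrite !(sip_sqB HL)// !(sipBl HL)// (sip_sym HL (Lx k) (Lx n)).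
by rewrite (sip_sym HL (Lx n) Lu); lra.
Qed.

(** Converse of [approx_le]: bounded Yosida values characterize the form domain. This is how
    membership in [D] is obtained in [energy_contraction]. *)
Lemma approx_dom C : (forall n, n.+1%:R * ip (u - x n) u <= C) ->
  [/\ D u, ncvg e x u & ncvg ip x u].
Proof.
move=> mC.
have ixu : ncvg ip x u.
  move=> e0 e0_gt0.
  have C0 : 0 <= C.
    apply: le_trans (mC 0%N); rewrite approx_energy.
    by rewrite addr_ge0 ?mulr_ge0 ?(sip_ge0 HD) ?(sip_ge0 HL)//; exact: (sip_domB HL).
  have /invS_small[N hN] : 0 < e0 ^+ 2 / (C + 1) by rewrite divr_gt0 ?exprn_gt0//; lra.
  exists N => n /hN hn; have Ln := sip_domB HL Lu (Lx n).
  rewrite (nrmBC HL)// -ltr_sqr ?nnegrE ?nrm_ge0 ?(ltW e0_gt0)// (nrm_sq HL)//.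
  have : n.+1%:R * ip (u - x n) (u - x n) <= C.
    by apply: le_trans (mC n); rewrite approx_energy lerDr (sip_ge0 HD).
  rewrite -ler_pdivlMl// => h; apply: le_lt_trans h _.
  move: hn; rewrite ltr_pdivlMr; last by lra.
  have : 0 < (n.+1%:R^-1 : R) by rewrite invr_gt0.
  by move: (n.+1%:R^-1 : R) => i i0; nra.
suff [] : D u /\ ncvg e x u by [].
apply: Dc => // e0 e0_gt0.
(* The values [m n] approach their supremum; beyond [N] their increments are below [e0 ^+ 2], and
   [m_diff] applies. *)
pose A := range m.
have hA : has_sup A.
  by split; [exists (m 0%N), 0%N|exists C => _ [n _ <-]; exact: mC].
have e2 : 0 < e0 ^+ 2 by rewrite exprn_gt0.
have [_ [N _ <-] hN] := sup_adherent e2 hA.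
have m_sup n : m n <= sup A by apply: sup_upper_bound => //; exists n.
have mono i j : (i <= j)%N -> m i <= m j.
  move=> /m_diff; have Dd := sip_domB HD (Dx j) (Dx i).
  have := sip_ge0 HD Dd; have := sip_ge0 HL (DL Dd) => h1 h2.
  have : 0 <= i.+1%:R * ip (x j - x i) (x j - x i) by rewrite mulr_ge0.
  by lra.
have main i j : (N <= i)%N -> (i <= j)%N -> nrm e (x j - x i) < e0.
  move=> Ni ij; have Dd := sip_domB HD (Dx j) (Dx i).
  rewrite -ltr_sqr ?nnegrE ?nrm_ge0 ?(ltW e0_gt0)// (nrm_sq HD)//.
  have := m_diff ij; have := sip_ge0 HL (DL Dd) => h1 h2.
  have : 0 <= i.+1%:R * ip (x j - x i) (x j - x i) by rewrite mulr_ge0.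
  by have := mono _ _ Ni; have := m_sup j; lra.
exists N => i j Ni Nj; have [ij|/ltnW ij] := leqP i j; last exact: main.
by rewrite (nrmBC HD)//; exact: main.
Qed.

End Approx.

End Resolvent.

(** * Weighted bounds for semigroups *)

Section Gronwall.
Context (R : realType) (F : R -> R) (T c : R).
Hypotheses (T0 : 0 <= T) (c0 : 0 <= c) (F0 : forall t : R, 0 <= F t).
Hypothesis Fc : forall t : R, 0 <= t <= T -> forall e : R, 0 < e ->
  exists2 d : R, 0 < d & forall s : R, 0 <= s <= T -> `|s - t| < d -> `|F s - F t| < e.
Hypothesis Fd : forall t : R, 0 <= t < T -> forall e : R, 0 < e ->
  exists2 d : R, 0 < d & forall h : R, 0 < h < d -> F (t + h) <= F t + h * (c * F t + e).

(** Only an upper bound for right difference quotients is available, so the estimate is propagated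
    along the supremum of the times up to which it holds. *)
Lemma gronwall_eps e : 0 < e -> F T <= expR (c * T) * (F 0 + e * T).
Proof.
move=> e0.
(* The slack [e * s] grows linearly in order to absorb the error [h * e] of each step. *)
pose good s := F s <= expR (c * s) * (F 0 + e * s).
pose A := [set t | 0 <= t <= T /\ forall s : R, 0 <= s <= t -> good s].
have good0 : good 0 by rewrite /good !mulr0 expR0 mul1r addr0.
have A0 : A 0.
  split; first by rewrite lexx T0.
  by move=> s s0; have -> : s = 0 by apply/eqP; rewrite eq_le andbC.
have hA : has_sup A by split; [exists 0|exists T => t [/andP[]]].
pose t := sup A.
have t0 : 0 <= t by apply: sup_upper_bound.
have tT : t <= T by apply: ge_sup; [exists 0|move=> s [/andP[]]].
have below s : 0 <= s < t -> good s.
  move=> /andP[s0 st]; have ts : 0 < t - s by rewrite subr_gt0.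
  have [a [_ ha]] := sup_adherent ts hA; rewrite -/t opprB addrC subrK => sa.
  by apply: ha; rewrite s0 ltW.
(* Continuity from the left carries the bound to the supremum itself. *)
have goodt : good t.
  have [->//|tn0] := eqVneq t 0.
  have tp : 0 < t by rewrite lt0r tn0.
  apply/ler_addgt0Pr => e1 e1_gt0.
  have [d d0 hd] := Fc (t := t) ltac:(by rewrite t0 tT) e1_gt0.
  pose s := Num.max 0 (t - d / 2).
  have st : 0 <= s < t by rewrite /s le_max lexx/= gt_max tp/=; lra.
  have sT : 0 <= s <= T by case/andP: st => -> /= /ltW /le_trans; apply.
  have sd : `|s - t| < d.
    rewrite distrC ger0_norm; last by rewrite subr_ge0 ltW//; case/andP: st.
    have : t - d / 2 <= s by rewrite /s le_max lexx orbT.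
    lra.
  have := hd s sT sd; rewrite ltr_norml => /andP[h1 _].
  have : F s <= expR (c * t) * (F 0 + e * t).
    apply: le_trans (below s st) _; case/andP: st => s0 /ltW st.
    apply: ler_pM; rewrite ?expR_ge0 ?addr_ge0 ?mulr_ge0 ?(ltW e0)//.
    - by rewrite ler_expR ler_wpM2l.
    - by rewrite lerD2l ler_wpM2l// ltW.
  lra.
have [tT'|] := ltP t T; last first.
  by move=> Tt; have <- : t = T by apply/eqP; rewrite eq_le tT.
(* If [t < T], the difference quotient extends the bound beyond [t], against the choice of [t]. *)
have [d d0 hd] := Fd (t := t) ltac:(by rewrite t0 tT') e0.
pose h := Num.min (d / 2) (T - t).
have h0 : 0 < h by rewrite /h lt_min; apply/andP; split; lra.
have hT : t + h <= T.
  have : h <= T - t by rewrite /h ge_min lexx orbT.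
  lra.
have h_d : h < d.
  have : h <= d / 2 by rewrite /h ge_min lexx.
  lra.
have up k : 0 < k <= h -> good (t + k).
  move=> /andP[k0 kh].
  have kd : 0 < k < d by rewrite k0 (le_lt_trans kh).
  rewrite /good; apply: le_trans (hd _ kd) _.
  have -> : F t + k * (c * F t + e) = (1 + c * k) * F t + k * e by ring.
  have ck0 : 0 <= c * k by rewrite mulr_ge0// ltW.
  have e1 := expR_ge1Dx (c * k).
  have X0 : 0 <= F 0 + e * t by rewrite addr_ge0// mulr_ge0// ltW.
  have E1 : 1 <= expR (c * (t + k)).
    by rewrite -expR0 ler_expR mulr_ge0// addr_ge0// ltW.
  have : (1 + c * k) * F t <= expR (c * (t + k)) * (F 0 + e * t).
    have -> : c * (t + k) = c * k + c * t by ring.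
    rewrite expRD -mulrA.
    apply: ler_pM => //.
    lra.
  have : k * e <= expR (c * (t + k)) * (e * k).
    by rewrite [k * e]mulrC -[X in X <= _]mul1r ler_wpM2r// mulr_ge0 ?ltW.
  lra.
have Ath : A (t + h).
  split; first by rewrite hT andbT addr_ge0// ltW.
  move=> s /andP[s0 sth].
  have [st|ts|->//] := ltgtP s t; first by apply: below; rewrite s0.
  have -> : s = t + (s - t) by ring.
  by apply: up; rewrite subr_gt0 ts/=; lra.
have : t + h <= t by apply: sup_upper_bound.
lra.
Qed.

Lemma gronwall : F T <= expR (c * T) * F 0.
Proof.
apply/ler_addgt0Pr => e e0.
have T1 := T0; have d0 : 0 < expR (c * T) * (T + 1).
  by rewrite mulr_gt0 ?expR_gt0//; lra.
have := gronwall_eps (divr_gt0 e0 d0).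
set X := expR _ in d0 *; move=> h; apply: le_trans h _.
rewrite mulrDr lerD2l.
have -> : X * (e / (X * (T + 1)) * T) = e * (T / (T + 1)).
  have X0 : X != 0 by rewrite gt_eqF// expR_gt0.
  have T2 : T + 1 != 0 by rewrite gt_eqF//; lra.
  by field; rewrite X0 T2.
by rewrite ger_pMr// ler_pdivrMr; lra.
Qed.

End Gronwall.

(** * Local boundedness of a C_0-semigroup on a semi-normed space *)

Section Semigroup.
Context (R : realType) (V : lmodType R) (L : set V) (ip : V -> V -> R).
Hypotheses (HL : sip L ip) (Lc : ncomplete L ip).
Context (S : R -> V -> V).
Local Notation N := (nrm ip).

(** Stands for almost everywhere equality. The semigroup axioms hold only up to this relation, so
    [S t] need not be linear on representatives. *)
Definition nulleq (u v : V) := N (u - v) = 0.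

Hypothesis SL : forall (t : R) f, 0 <= t -> L f -> L (S t f).
Hypothesis Slin : forall (t c : R) f g, 0 <= t -> L f -> L g ->
  nulleq (S t (c *: f + g)) (c *: S t f + S t g).
Hypothesis Sbd : forall t : R, 0 <= t -> exists M : R, forall f, L f ->
  N (S t f) <= M * N f.
Hypothesis S0 : forall f, L f -> nulleq (S 0 f) f.
Hypothesis SD : forall (s t : R) f, 0 <= s -> 0 <= t -> L f ->
  nulleq (S (s + t) f) (S s (S t f)).
Hypothesis Sc : forall f, L f -> forall e : R, 0 < e -> exists2 d : R, 0 < d &
  forall t : R, 0 < t < d -> N (S t f - f) < e.

Lemma nulleq_nrm u v : L u -> L v -> nulleq u v -> N u = N v.
Proof.
move=> Lu Lv uv; apply/eqP; rewrite -subr_eq0 -normr_le0 -uv.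
exact: (nrm_dist HL).
Qed.

Lemma nulleq_sym u v : L u -> L v -> nulleq u v -> nulleq v u.
Proof. by move=> Lu Lv; rewrite /nulleq (nrmBC HL). Qed.

Lemma nulleq_trans v u w : L u -> L v -> L w ->
  nulleq u v -> nulleq v w -> nulleq u w.
Proof.
move=> Lu Lv Lw uv vw; apply/eqP; rewrite eq_le nrm_ge0 andbT.
by apply: le_trans (nrm_tri HL Lu Lw Lv) _; rewrite uv vw addr0.
Qed.

Lemma nulleqP c u v u' v' : L u -> L v -> L u' -> L v' ->
  nulleq u u' -> nulleq v v' -> nulleq (c *: u + v) (c *: u' + v').
Proof.
move=> Lu Lv Lu' Lv' uu vv; apply/eqP; rewrite eq_le nrm_ge0 andbT.
have -> : c *: u + v - (c *: u' + v') = c *: (u - u') + (v - v').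
  by rewrite scalerBr opprD addrACA.
have Lv2 := sip_domB HL Lv Lv'; have Lu2 := sip_domB HL Lu Lu'.
apply: le_trans (nrmD HL (sip_domZ HL c Lu2) Lv2) _.
by rewrite (nrmZ HL)// uu vv mulr0 addr0.
Qed.

Lemma semigroup_nrmB t f g : 0 <= t -> L f -> L g ->
  N (S t f - S t g) = N (S t (f - g)).
Proof.
move=> t0 Lf Lg.
have := Slin (-1) t0 Lg Lf.
rewrite !scaleN1r ![- _ + _]addrC => h; apply/esym/nulleq_nrm => //.
- by apply: SL => //; exact: (sip_domB HL).
- by apply: (sip_domB HL); exact: SL.
Qed.

Lemma semigroupZ t c f : 0 <= t -> L f -> nulleq (S t (c *: f)) (c *: S t f).
Proof.
move=> t0 Lf; have L0 := sip_dom0 HL.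
have S00 : N (S t 0) = 0.
  have [M hM] := Sbd t0; apply/eqP; rewrite eq_le nrm_ge0 andbT.
  by apply: le_trans (hM _ L0) _; rewrite (nrm0 HL) mulr0.
have Lcf := sip_domZ HL c (SL t0 Lf); have LS0 := SL t0 L0.
have := Slin c t0 Lf L0; rewrite addr0 => /nulleq_trans; apply => //.
- by apply: SL => //; exact: (sip_domZ HL).
- exact: (sip_domD HL).
- by rewrite /nulleq addrAC subrr add0r.
Qed.

Lemma semigroup_nrmZ t c f : 0 <= t -> L f -> N (S t (c *: f)) = `|c| * N (S t f).
Proof.
move=> t0 Lf; have LSf := SL t0 Lf.
rewrite -(nrmZ HL)//; apply: nulleq_nrm; last exact: semigroupZ.
- by apply: SL => //; exact: (sip_domZ HL).
- exact: (sip_domZ HL).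
Qed.

Lemma semigroup_cont0 f : L f -> forall e : R, 0 < e -> exists2 d : R, 0 < d &
  forall t : R, 0 <= t < d -> N (S t f - f) < e.
Proof.
move=> Lf e e0; have [d d0 hd] := Sc Lf e0; exists d => // t /andP[].
rewrite le_eqVlt => /orP[/eqP<- _|t0 td]; first by rewrite (S0 Lf).
by apply: hd; rewrite t0.
Qed.

(* Gliding hump: were the norms of [S t] unbounded near [0], the sum of a fast
   decreasing series would have an orbit unbounded near [0]. *)
Lemma semigroup_bounded0 : exists d M : R, 0 < d /\
  forall (t : R) f, 0 <= t <= d -> L f -> N (S t f) <= M * N f.
Proof.
apply: contrapT => unb.
have {}unb d M : 0 < d -> exists t f, [/\ 0 <= t <= d, L f & M * N f < N (S t f)].
  move=> d0; apply: contrapT => h; apply: unb; exists d, M; split => // t f td Lf.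
  by rewrite leNgt; apply/negP => ?; apply: h; exists t, f.
(* The input is a ball given by centre and radius, the output a smaller ball and a time. On the new
   ball [S] at this time has norm at least [n + 1]: [n + 2] at the centre, minus one for the
   perturbation. *)
pose spec n (p : V * R) (q : V * R * R) :=
  [/\ L q.1.1 /\ 0 < q.1.2, N (q.1.1 - p.1) <= p.2, 2 * q.1.2 <= p.2,
      q.1.2 <= n.+1%:R^-1 &
      [/\ 0 <= q.2 <= n.+1%:R^-1, n.+2%:R <= N (S q.2 q.1.1) &
      forall f, L f -> N f <= 2 * q.1.2 -> N (S q.2 f) <= 1]].
have step (np : nat * (V * R)) : exists q, L np.2.1 -> 0 < np.2.2 -> spec np.1 np.2 q.
  case: np => n [x r] /=.
  have [[Lx r0]|nb] := pselect (L x /\ 0 < r); last first.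
    by exists (x, r, 0) => Lx r0; exfalso; apply: nb.
  have n0 : 0 < n.+1%:R^-1 :> R by rewrite invr_gt0.
  have [t [f [/andP[t0 td] Lf hf]]] := unb _ (n.+2%:R / r) n0.
  have [M hM] := Sbd t0.
  have Nf : 0 < N f.
    rewrite lt0r nrm_ge0 andbT; apply/eqP => Nf0.
    by have := hM f Lf; move: hf; rewrite Nf0 !mulr0 ltNge => /negP.
  pose z := (r / N f) *: f.
  have Lz : L z by exact: (sip_domZ HL).
  have Nz : N z = r by rewrite /z (nrmZ HL)// gtr0_norm ?divr_gt0// divfK// gt_eqF.
  have Sz : n.+2%:R <= N (S t z).
    rewrite /z semigroup_nrmZ// gtr0_norm ?divr_gt0//.
    rewrite mulrAC ler_pdivlMr// [r * _]mulrC -ler_pdivrMr//.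
    by rewrite mulrAC ltW.
  clearbody z.
  (* The images of [x + z] and [x - z] differ by that of [2 *: z], so one of the two has norm at
     least [n + 2]. *)
  have [y [Ly yx Sy]] : exists y, [/\ L y, N (y - x) <= r & n.+2%:R <= N (S t y)].
    have Lp := sip_domD HL Lx Lz; have Lm := sip_domB HL Lx Lz.
    have h : 2 * N (S t z) <= N (S t (x + z)) + N (S t (x - z)).
      have -> : 2 * N (S t z) = N (S t (2 *: z)) by rewrite semigroup_nrmZ// ger0_norm//.
      have -> : 2 *: z = (x + z) - (x - z).
        by rewrite scaler_nat mulr2n opprB [RHS]addrC addrA subrK.
      by rewrite -(semigroup_nrmB t0 Lp Lm); apply: (nrmB HL); exact: SL.
    have [h1|h1] := leP n.+2%:R (N (S t (x + z))).
      by exists (x + z); split => //; rewrite addrAC subrr add0r Nz.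
    exists (x - z); split => //; first by rewrite addrAC subrr add0r (nrmN HL)// Nz.
    lra.
  have M1 : 0 < `|M| + 1 by have := normr_ge0 M; lra.
  (* Halving makes the later displacements summable; the last entry ensures that the bounded
     operator [S t] sends vectors of norm at most [2 * r'] to vectors of norm at most one. *)
  pose r' := Num.min (r / 2) (Num.min n.+1%:R^-1 ((`|M| + 1)^-1 / 2)).
  have r'0 : 0 < r' by rewrite !lt_min n0 !divr_gt0// invr_gt0.
  have r'1 : r' <= r / 2 by rewrite /r' ge_min lexx.
  have r'2 : r' <= n.+1%:R^-1 by rewrite /r' !ge_min lexx orbT.
  have r'3 : r' <= (`|M| + 1)^-1 / 2 by rewrite /r' !ge_min lexx !orbT.
  exists (y, r', t) => _ _; split => //=; first by lra.
  split => //; first by rewrite t0.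
  move=> g Lg Ng; apply: le_trans (hM g Lg) _.
  have : N g <= (`|M| + 1)^-1 by lra.
  rewrite -div1r ler_pdivlMr// => h; apply: le_trans h.
  rewrite mulrC ler_wpM2l ?nrm_ge0//; have := ler_norm M; lra.
have [F hF] := choice step.
pose G := fix G n := if n is n'.+1 then (F (n', (G n'))).1 else ((0 : V), (1 : R)).
pose tt n := (F (n, G n)).2.
have Gok n : L (G n).1 /\ 0 < (G n).2.
  elim: n => [|n [Ln rn]] /=; first by split => //; exact: (sip_dom0 HL).
  by have [] := hF (n, G n) Ln rn.
have Gs n : spec n (G n) (F (n, G n)) by case: (Gok n) => Ln rn; exact: (hF (n, G n)).
pose x n := (G n).1; pose r n := (G n).2.
have Lx n : L (x n) by case: (Gok n).
have r0 n : 0 < r n by case: (Gok n).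
have xr n : N (x n.+1 - x n) <= r n by case: (Gs n).
have rr n : 2 * r n.+1 <= r n by case: (Gs n).
have rn n : r n.+1 <= n.+1%:R^-1 by case: (Gs n).
have tn n : 0 <= tt n <= n.+1%:R^-1 by case: (Gs n) => _ _ _ _ [].
have xS n : n.+2%:R <= N (S (tt n) (x n.+1)) by case: (Gs n) => _ _ _ _ [].
have St n f : L f -> N f <= 2 * r n.+1 -> N (S (tt n) f) <= 1.
  by case: (Gs n) => _ _ _ _ [_ _]; apply.
(* Telescoping with halved radii: all displacements after stage [n] add up to at most [2 * r n]. *)
have xd n k : N (x (n + k)%N - x n) <= 2 * r n - 2 * r (n + k)%N.
  elim: k => [|k IH]; first by rewrite addn0 !subrr (nrm0 HL).
  rewrite addnS; apply: le_trans (nrm_tri HL (Lx _) (Lx n) (Lx (n + k)%N)) _.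
  have := xr (n + k)%N; have := rr (n + k)%N; lra.
have xd2 n k : (n <= k)%N -> N (x k - x n) <= 2 * r n.
  by move=> nk; have := xd n (k - n)%N; rewrite subnKC//; have := r0 k; lra.
have [y Ly xy] : exists2 y, L y & ncvg ip x y.
  apply: Lc => // e e0; have e4 : 0 < e / 4 by lra.
  have [n0 hn0] := invS_small e4; exists n0.+1 => i j ni nj.
  have := xd2 _ _ ni; have := xd2 _ _ nj; have := rn n0; have := hn0 _ (leqnn n0).
  have := nrm_tri HL (Lx i) (Lx j) (Lx n0.+1); rewrite (nrmBC HL (Lx n0.+1) (Lx j)).
  move: (n0.+1%:R^-1 : R) => a; lra.
have yx n : N (x n - y) <= 2 * r n.
  apply/ler_addgt0Pr => e e0; have [n0 hn0] := xy _ e0.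
  have := hn0 _ (leq_maxl n0 n); have := xd2 _ _ (leq_maxr n0 n).
  have := nrm_tri HL (Lx n) Ly (Lx (maxn n0 n)); rewrite (nrmBC HL (Lx n) (Lx (maxn n0 n))); lra.
(* The orbit of the single vector [y] is large at times tending to zero, whereas it converges to [y]
   there. *)
have big n : n.+1%:R <= N (S (tt n) y).
  have /andP[t0 _] := tn n; have := xS n.
  have := St n _ (sip_domB HL (Lx n.+1) Ly) (yx _); rewrite -semigroup_nrmB//.
  have := nrm_dist HL (SL t0 (Lx n.+1)) (SL t0 Ly).
  have := ler_norm (N (S (tt n) (x n.+1)) - N (S (tt n) y)).
  by rewrite -[n.+2]addn1 natrD; lra.
have [d d0 hd] := semigroup_cont0 Ly ltr01.
have [n1 hn1] := invS_small d0.
have [n2 hn2] : exists n2 : nat, N y + 1 < n2%:R.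
  by exists (Num.bound (N y + 1)); apply: archi_boundP; rewrite addr_ge0 ?nrm_ge0.
pose n := maxn n1 n2.
have /andP[t0 tn1] := tn n.
have := hd (tt n); rewrite t0/= (le_lt_trans tn1) ?hn1 ?leq_maxl// => /(_ isT) h.
have h1 := nrm_dist HL (SL t0 Ly) Ly; have h2 := ler_norm (N (S (tt n) y) - N y).
have h3 := big n.
have h4 : n2%:R <= n.+1%:R :> R by rewrite ler_nat leqW// leq_maxr.
lra.
Qed.

Lemma semigroup_bounded T : exists2 K, 0 < K & forall (t : R) f, 0 <= t <= T -> L f ->
  N (S t f) <= K * N f.
Proof.
have [d [M [d0 hd]]] := semigroup_bounded0.
(* A constant at least one, whose powers increase; the bound on [[0, d]] is iterated through the
   semigroup law. *)
pose M1 := `|M| + 1.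
have M1_ge1 : 1 <= M1 by rewrite /M1; have := normr_ge0 M; lra.
have MM1 : M <= M1 by rewrite /M1; have := ler_norm M; lra.
have hd1 t f : 0 <= t <= d -> L f -> N (S t f) <= M1 * N f.
  move=> td Lf; apply: le_trans (hd _ _ td Lf) _.
  by rewrite ler_wpM2r ?nrm_ge0.
have main n : forall (t : R) f, 0 <= t <= n.+1%:R * d -> L f ->
    N (S t f) <= M1 ^+ n.+1 * N f.
  elim: n => [|n IH] t f; first by rewrite mul1r expr1; exact: hd1.
  move=> /andP[t0 tn] Lf; have [td|dt] := leP t d.
    apply: le_trans (hd1 _ _ _ Lf) _; first by rewrite t0.
    rewrite ler_wpM2r ?nrm_ge0// exprS ler_peMr//; first by lra.
    exact: exprn_ege1.
  have td0 : 0 <= t - d by lra.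
  have -> : t = d + (t - d) by ring.
  rewrite (nulleq_nrm _ _ (SD (ltW d0) td0 Lf)); last 2 first.
  - by apply: SL => //; lra.
  - by apply: SL; [exact: ltW|exact: SL].
  apply: le_trans (hd1 _ _ _ (SL td0 Lf)) _; first by rewrite lexx ltW.
  rewrite exprS -mulrA ler_wpM2l//; first by lra.
  apply: IH => //; rewrite td0/=.
  by move: tn; rewrite -[n.+2]addn1 natrD; lra.
have [n hn] : exists n : nat, T <= n.+1%:R * d.
  exists (Num.bound (`|T| / d)); rewrite -ler_pdivrMr//.
  have h : `|T| / d < (Num.bound (`|T| / d))%:R.
    by apply: archi_boundP; rewrite divr_ge0// ltW.
  have h2 : T / d <= `|T| / d by rewrite ler_pM2r ?invr_gt0// ler_norm.
  apply: le_trans h2 _; apply: le_trans (ltW h) _.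
  by rewrite ler_nat.
exists (M1 ^+ n.+1) => [|t f /andP[t0 tT] Lf]; first by rewrite exprn_gt0//; lra.
by apply: main => //; rewrite t0 (le_trans tT).
Qed.

Definition generator f g := [/\ L f, L g & forall e : R, 0 < e -> exists2 d : R, 0 < d &
  forall h : R, 0 < h < d -> N (h^-1 *: (f - S h f) - g) < e].

(** [S t] commutes with [S h] up to null vectors, so the bounded operator [S t] maps the difference
    quotient at [f] to the one at [S t f]. Orbits thus remain differentiable, as [gronwall]
    requires. *)
Lemma gen_semigroup t f g : 0 <= t -> generator f g -> generator (S t f) (S t g).
Proof.
move=> t0 [Lf Lg fg]; split; [exact: SL|exact: SL|move=> e e0].
have [M hM] := Sbd t0.
have M1 : 0 < `|M| + 1 by have := normr_ge0 M; lra.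
have [d d0 hd] := fg _ (divr_gt0 e0 M1).
exists d => // h /andP[h0 h_d]; have h0' := ltW h0.
have LSf := SL t0 Lf; have LSg := SL t0 Lg; have LSh := SL h0' Lf.
have LthF : L (S (h + t) f) by apply: SL => //; exact: addr_ge0.
have LtS : L (S t (S h f)) by exact: SL.
have LhS : L (S h (S t f)) by exact: SL.
have comm : nulleq (S t (S h f)) (S h (S t f)).
  apply: (nulleq_trans _ LthF) => //; last by apply: SD.
  by rewrite addrC; apply: nulleq_sym; [rewrite addrC| |exact: SD].
pose a := -1 *: S h f + f.
have La : L a by exact: (sip_domP HL).
have Lha := sip_domZ HL h^-1 La.
pose a' := -1 *: S h (S t f) + S t f.
have La' : L a' by exact: (sip_domP HL).
have Lha' := sip_domZ HL h^-1 La'.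
have LSa := SL t0 La.
have LhSa := sip_domZ HL h^-1 LSa.
have LSha := SL t0 Lha.
pose z := -1 *: g + h^-1 *: a.
have Lz : L z by exact: (sip_domP HL).
have LSz := SL t0 Lz.
have nn u : nulleq u u by rewrite /nulleq subrr (nrm0 HL).
have Saa : nulleq (S t a) a'.
  apply: (nulleq_trans _ _ _ (Slin (-1) t0 LSh Lf)) => //.
  - exact: (sip_domP HL).
  - exact: nulleqP.
have SzE : nulleq (S t z) (-1 *: S t g + h^-1 *: a').
  apply: (nulleq_trans _ _ _ (Slin (-1) t0 Lg Lha)) => //; try exact: (sip_domP HL).
  apply: nulleqP => //.
  apply: (nulleq_trans _ _ _ (semigroupZ h^-1 t0 La)) => //.
  by have := nulleqP h^-1 LSa (sip_dom0 HL) La' (sip_dom0 HL) Saa (nn 0); rewrite !addr0.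
have -> : h^-1 *: (S t f - S h (S t f)) - S t g = -1 *: S t g + h^-1 *: a'.
  by rewrite /a' !scaleN1r addrC; congr (_ + _ *: _); rewrite addrC.
rewrite -(nulleq_nrm _ _ SzE)//; last exact: (sip_domP HL).
apply: le_lt_trans (hM _ Lz) _.
have zE : z = h^-1 *: (f - S h f) - g.
  by rewrite /z /a !scaleN1r addrC; congr (_ *: _ + _); rewrite addrC.
have := hd h; rewrite h0 h_d -zE => /(_ isT); rewrite ltr_pdivlMr// => hz.
apply: le_lt_trans hz; rewrite mulrC ler_wpM2l ?nrm_ge0//.
by have := ler_norm M; lra.
Qed.

(** * Growth of a weighted norm along the semigroup *)

Section Weight.
Context (W : V -> V) (K c : R).
Hypotheses (WL : forall f, L f -> L (W f))
  (Wlin : forall a f g, W (a *: f + g) = a *: W f + W g)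
  (Wbd : forall f, L f -> N (W f) <= K * N f) (c0 : 0 <= c).
Hypothesis Wgen : forall f g, generator f g -> - ip (W g) (W f) <= c * N (W f) ^+ 2.
Hypothesis gen_dense : forall f (e : R), L f -> 0 < e ->
  exists f' g, generator f' g /\ N (f - f') < e.

Let WD f g : W (f + g) = W f + W g.
Proof. by rewrite -[f]scale1r Wlin !scale1r. Qed.

Let W0 : W 0 = 0.
Proof. by apply: (@addIr _ (W 0)); rewrite -WD !add0r. Qed.

Let WZ a f : W (a *: f) = a *: W f.
Proof. by rewrite -[a *: f]addr0 Wlin W0 addr0. Qed.

Let WB f g : W (f - g) = W f - W g.
Proof. by rewrite WD -scaleN1r WZ scaleN1r. Qed.

Let Wnull f g : L f -> L g -> nulleq f g -> N (W f) = N (W g).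
Proof.
move=> Lf Lg fg; apply: nulleq_nrm; [exact: WL|exact: WL|].
apply/eqP; rewrite /nulleq -WB eq_le nrm_ge0 andbT.
by apply: le_trans (Wbd (sip_domB HL Lf Lg)) _; rewrite fg mulr0.
Qed.

Let K0 : 0 <= `|K| + 1. Proof. by have := normr_ge0 K; lra. Qed.
Let Kp : 0 < `|K| + 1. Proof. by have := normr_ge0 K; lra. Qed.

Let Wbd' f : L f -> N (W f) <= (`|K| + 1) * N f.
Proof.
move=> Lf; apply: le_trans (Wbd Lf) _; rewrite ler_wpM2r ?nrm_ge0//.
by have := ler_norm K; lra.
Qed.

(** Since [S r f - S s f] is the image under [S s] of [S (r - s) f - f], two-sided continuity
    follows from continuity at zero and a bound uniform in time. *)
Let cont T f : L f -> forall t : R, 0 <= t <= T -> forall e : R, 0 < e ->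
  exists2 d : R, 0 < d & forall s : R, 0 <= s <= T -> `|s - t| < d ->
  N (S s f - S t f) < e.
Proof.
move=> Lf t tT e e0; have [M M0 hM] := semigroup_bounded T.
have [d d0 hd] := semigroup_cont0 Lf (divr_gt0 e0 M0); exists d => //.
have main s r : 0 <= s -> s <= r -> r <= T -> r - s < d -> N (S r f - S s f) < e.
  move=> s0 sr rT rsd; have rs0 : 0 <= r - s by rewrite subr_ge0.
  have r0 : 0 <= r by exact: le_trans sr.
  have Lrs := SL rs0 Lf.
  have Er : nulleq (S r f) (S s (S (r - s) f)).
    by have := SD s0 rs0 Lf; rewrite addrC subrK.
  have LSr := SL r0 Lf; have LSs := SL s0 Lf; have LSsr := SL s0 Lrs.
  apply: le_lt_trans (nrm_tri HL LSr LSs LSsr) _; rewrite Er add0r.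
  rewrite semigroup_nrmB//; apply: le_lt_trans (hM _ _ _ _) _.
  - by rewrite s0 (le_trans sr).
  - exact: (sip_domB HL).
  have := hd (r - s); rewrite rs0 rsd => /(_ isT).
  by rewrite ltr_pdivlMr// mulrC.
move: tT => /andP[t0 tT] s /andP[s0 sT]; rewrite ltr_norml => /andP[h1 h2].
have [ts|/ltW st] := leP t s; first by apply: main.
by rewrite (nrmBC HL); [apply: main => //; lra|exact: SL|exact: SL].
Qed.

(** Gronwall for the squared norm: its derivative along the orbit is -2 times
    [ip (W (S t g)) (W (S t f))], whence the constant [2 * c]. *)
Let weight_gen T f g : 0 <= T -> generator f g ->
  N (W (S T f)) ^+ 2 <= expR (2 * c * T) * N (W f) ^+ 2.
Proof.
move=> T0 fg; have [Lf Lg _] := fg.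
have <- : N (W (S 0 f)) = N (W f) by apply: Wnull => //; [exact: SL|exact: S0].
pose F t := N (W (S t f)) ^+ 2.
rewrite -[X in X <= _]/(F T) -[X in _ * X]/(F 0).
apply: gronwall => //; first by rewrite mulr_ge0.
- by move=> t; exact: sqr_ge0.
- move=> t tT e e0; have /andP[t0 _] := tT.
  pose a := N (W (S t f)).
  have a0 : 0 <= a by exact: nrm_ge0.
  pose q := Num.min 1 (e / (2 * a + 1)).
  have q0 : 0 < q by rewrite lt_min ltr01 divr_gt0//; lra.
  have q1 : q <= 1 by rewrite ge_min lexx.
  have q2 : q * (2 * a + 1) <= e.
    by rewrite -ler_pdivlMr ?ge_min ?lexx ?orbT//; lra.
  have [d d0 hd] := cont Lf tT (divr_gt0 q0 Kp); exists d => // s sT st.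
  have /andP[s0 _] := sT.
  have := hd s sT st; rewrite ltr_pdivlMr// mulrC => h.
  have LS := SL s0 Lf; have LT := SL t0 Lf.
  have := nrm_dist HL (WL LS) (WL LT); rewrite -WB => h1.
  have h2 := Wbd' (sip_domB HL LS LT).
  rewrite /F -/a; set b := N (W (S s f)) in h1 *.
  have b0 : 0 <= b by exact: nrm_ge0.
  have {h h1 h2}h : `|b - a| < q by exact: le_lt_trans (le_trans h1 h2) h.
  rewrite subr_sqr normrM; apply: lt_le_trans q2.
  have : `|b + a| <= 2 * a + 1.
    move: h; rewrite ltr_norml => /andP[h1 h2]; rewrite ger0_norm; lra.
  have := normr_ge0 (b - a); have := normr_ge0 (b + a); nra.
- move=> t /andP[t0 tT] e e0.
  have [Lv Lgv vgv] := gen_semigroup t0 fg.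
  set v := S t f in Lv vgv *; set gv := S t g in Lgv vgv.
  have Fv : F t = N (W v) ^+ 2 by [].
  pose a := N (W v); pose m := N (W gv).
  have a0 : 0 <= a by exact: nrm_ge0.
  have m0 : 0 <= m by exact: nrm_ge0.
  (* [q] bounds the weighted remainder of the difference quotient. Its contribution [2 * (a * q)]
     and the term quadratic in [h] each use half of [e]. *)
  pose q := Num.min 1 (e / (4 * a + 1)).
  have q0 : 0 < q by rewrite lt_min ltr01 divr_gt0//; lra.
  have q1 : q <= 1 by rewrite ge_min lexx.
  have q2 : q * (4 * a + 1) <= e.
    by rewrite -ler_pdivlMr ?ge_min ?lexx ?orbT//; lra.
  have [d d0 hd] := vgv _ (divr_gt0 q0 Kp).
  pose d' := Num.min d (e / (2 * (m + 1) ^+ 2)).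
  have mm : 0 < 2 * (m + 1) ^+ 2 by rewrite mulr_gt0// exprn_gt0//; lra.
  exists d' => [|h]; first by rewrite lt_min d0 divr_gt0.
  rewrite /d' lt_min => /andP[h0 /andP[h_d]]; rewrite ltr_pdivlMr// => hm.
  have h0' := ltW h0.
  pose r := h^-1 *: (v - S h v) - gv.
  have LSv := SL h0' Lv.
  have Lr : L r by apply: (sip_domB HL) => //; apply: (sip_domZ HL); exact: (sip_domB HL).
  have Nr : N (W r) < q.
    have := hd h; rewrite h0 h_d => /(_ isT); rewrite -/r ltr_pdivlMr// mulrC.
    by move=> hr; apply: le_lt_trans hr; exact: Wbd'.
  have SvE : S h v = v - h *: (gv + r).
    by rewrite /r [gv + _]addrC subrK scalerA divff ?gt_eqF// scale1r opprB addrC subrK.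
  have -> : F (t + h) = N (W (S h v)) ^+ 2.
    rewrite /F; congr (_ ^+ 2); apply: Wnull => //.
    - by apply: SL => //; exact: addr_ge0.
    - by rewrite addrC; exact: SD.
  have LWv := WL Lv; have LWg := WL Lgv; have LWr := WL Lr.
  have LWs := sip_domD HL LWg LWr.
  rewrite SvE WB WZ WD (nrm_sq HL); last by apply: (sip_domB HL) => //; exact: (sip_domZ HL).
  rewrite (sip_sqB HL) ?(sipZr HL) ?(sipZl HL) ?(sipZr HL)//; try exact: (sip_domZ HL).
  rewrite (sipDr HL)// -!(nrm_sq HL)// Fv -/a.
  have g1 : - ip (W v) (W gv) <= c * a ^+ 2.
    by rewrite (sip_sym HL)//; apply: Wgen.
  have g2 : `|ip (W v) (W r)| <= a * q.
    by apply: le_trans (sip_CS HL LWv LWr) _; rewrite ler_wpM2l// ltW.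
  have g3 : N (W gv + W r) <= m + 1.
    by apply: le_trans (nrmD HL LWg LWr) _; rewrite -/m; lra.
  have g4 : N (W gv + W r) ^+ 2 <= (m + 1) ^+ 2.
    by rewrite ler_sqr ?nnegrE ?nrm_ge0//; lra.
  have g5 := ler_normr (ip (W v) (W r)) 0; have := ler_norm (- ip (W v) (W r)).
  rewrite normrN => g6.
  have g7 : h * N (W gv + W r) ^+ 2 <= e / 2.
    have := nrm_ge0 ip (W gv + W r); nra.
  have g8 : 2 * (a * q) <= e / 2 by lra.
  have g9 : - 2 * ip (W v) (W gv) - 2 * ip (W v) (W r) + h * N (W gv + W r) ^+ 2
    <= 2 * c * a ^+ 2 + e by lra.
  have : h * (- 2 * ip (W v) (W gv) - 2 * ip (W v) (W r) + h * N (W gv + W r) ^+ 2)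
    <= h * (2 * c * a ^+ 2 + e) by rewrite ler_wpM2l.
  by move: (N (W gv + W r)) => y; lra.
Qed.

Theorem weighted_semigroup_bound T f : 0 <= T -> L f ->
  N (W (S T f)) <= expR (c * T) * N (W f).
Proof.
move=> T0 Lf; apply/ler_addgt0Pr => e e0.
have [M hM] := Sbd T0.
(* Sum of the Lipschitz constants in [f] of both sides, plus one for positivity. *)
pose C := (`|K| + 1) * (`|M| + expR (c * T)) + 1.
have X0 := expR_ge0 (c * T).
have C0 : 0 < C.
  have := normr_ge0 M => ?; rewrite /C ltr_wpDl// mulr_ge0// addr_ge0//.
have [f' [g [fg hf]]] := gen_dense Lf (divr_gt0 e0 C0).
have [Lf' _ _] := fg.
have h1 : N (W (S T f')) <= expR (c * T) * N (W f').
  rewrite -ler_sqr ?nnegrE ?mulr_ge0 ?nrm_ge0//.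
  apply: le_trans (weight_gen T0 fg) _; rewrite exprMn -expRM_natl.
  by rewrite -mulr_natl mulrA.
have LS := SL T0 Lf; have LS' := SL T0 Lf'.
have h2 := nrm_dist HL (WL LS) (WL LS'); rewrite -WB in h2.
have h3 := nrm_dist HL (WL Lf) (WL Lf'); rewrite -WB in h3.
have h4 := Wbd' (sip_domB HL LS LS').
have h5 := Wbd' (sip_domB HL Lf Lf').
rewrite semigroup_nrmB// in h4.
have h6 := hM _ (sip_domB HL Lf Lf').
have h7 := ler_norm (N (W (S T f)) - N (W (S T f'))).
have h8 := ler_normr (N (W f) - N (W f')) 0.
have h9 : N (W f') - N (W f) <= (`|K| + 1) * N (f - f').
  by have := ler_norm (N (W f') - N (W f)); rewrite distrC; lra.
move: hf; rewrite ltr_pdivlMr// => hf.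
have d0 := nrm_ge0 ip (f - f').
have h10 : N (S T (f - f')) <= `|M| * N (f - f').
  by apply: le_trans h6 _; rewrite ler_wpM2r// ler_norm.
have h11 : (`|K| + 1) * N (S T (f - f')) <= (`|K| + 1) * (`|M| * N (f - f')).
  by rewrite ler_wpM2l.
have h12 : expR (c * T) * N (W f') <= expR (c * T) * (N (W f) + (`|K| + 1) * N (f - f')).
  by rewrite ler_wpM2l//; lra.
by move: hf; rewrite /C; lra.
Qed.

End Weight.

End Semigroup.

(** * The space L_2 *)

Lemma cvgn_geometric_increments (R : realType) (a : R^nat) (C : R) :
  (forall k, `|a k.+1 - a k| <= C * 2^-1 ^+ k) -> cvgn a.
Proof.
move=> aC; have -> : a = cst (a 0%N) + series (telescope a).
  by apply/funext => n; rewrite {1}(eq_sum_telescope a n).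
apply: is_cvgD; first exact: is_cvg_cst.
apply: normed_cvg.
have C0 : 0 <= C by have := aC 0%N; rewrite expr0 mulr1; exact: le_trans.
apply: (@series_le_cvg _ _ (geometric C 2^-1)) => [n|n|n|].
- exact: normr_ge0.
- by rewrite /geometric/= mulr_ge0// exprn_ge0.
- exact: aC.
- by apply: is_cvg_geometric_series; rewrite ger0_norm// invf_lt1// ltr1n.
Qed.

Lemma limn_einf_le (R : realType) (u : (\bar R)^nat) (c : \bar R) N :
  (forall n, (N <= n)%N -> (u n <= c)%E) -> (limn_einf u <= c)%E.
Proof.
move=> uc; rewrite limn_einf_lim; apply: lime_le; first exact: is_cvg_einfs.
apply: nearW => n; apply: le_trans (uc (maxn n N) (leq_maxr _ _)).
by apply: ereal_inf_lbound; exists (maxn n N) => //=; exact: leq_maxl.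
Qed.

Section L2.
Context d (T : measurableType d) (R : realType).
Variable mu : {measure set T -> \bar R}.
Implicit Types (u v w : T -> R).

Definition l2 : set (T -> R) := [set u | u \in Lfun mu 2%:E].
Definition ip u v : R := \int[mu]_x (u x * v x).

Lemma l2_measurable u : l2 u -> measurable_fun setT u.
Proof. by rewrite /l2/= inE => /andP[/[!inE]]. Qed.

Lemma l2P u : l2 u <-> measurable_fun setT u /\
  mu.-integrable setT (EFin \o (fun x => u x ^+ 2)).
Proof.
split=> [l2u|[mu_ iu]].
  by split; [exact: l2_measurable|exact: Lfun2_integrable_sqr].
rewrite /l2/= inE; apply/andP; split; first by rewrite inE.
rewrite inE /finite_norm.
have h : ('N[mu]_2%:E[EFin \o u] `^ 2 < +oo)%E.
  rewrite powR_Lnorm//; move/integrableP : iu => [_]; apply: le_lt_trans.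
  rewrite le_eqVlt; apply/orP; left; apply/eqP; apply: eq_integral => x _ /=.
  by rewrite powR_mulrn// real_normK ?num_real// ger0_norm ?sqr_ge0.
exact: lty_poweRy h.
Qed.

Lemma l2_integrable u v : l2 u -> l2 v ->
  mu.-integrable setT (EFin \o (fun x => u x * v x)).
Proof. by move=> lu lv; apply/Lfun1_integrable; exact: Lfun2_mul_Lfun1. Qed.

Lemma l2_le u v : measurable_fun setT u -> (forall x, `|u x| <= `|v x|) ->
  l2 v -> l2 u.
Proof.
move=> mu_ uv /l2P[mv iv]; apply/l2P; split=> //.
apply: le_integrable iv => //.
  by apply/measurable_EFinP; exact: measurable_funX.
move=> x _ /=; rewrite lee_fin !ger0_norm ?sqr_ge0//.
by rewrite -(real_normK (num_real (u x))) -(real_normK (num_real (v x))) ler_sqr ?nnegrE.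
Qed.

Lemma l2_linear (c : R) u v : l2 u -> l2 v -> l2 (c *: u + v).
Proof.
have p1 : (1 <= 2%:E :> \bar R)%E by rewrite lee_fin ler1n.
by have [_ h] := Lfun_submod_closed mu p1; exact: h.
Qed.

Lemma l2_0 : l2 0.
Proof.
have p1 : (1 <= 2%:E :> \bar R)%E by rewrite lee_fin ler1n.
by have [h _] := Lfun_submod_closed mu p1; exact: h.
Qed.

Lemma sip_l2 : sip l2 ip.
Proof.
split.
- exact: l2_0.
- exact: l2_linear.
- move=> c u v w lu lv lw; rewrite /ip.
  under eq_Rintegral => x _ do rewrite /GRing.scale/= mulrDl -mulrA.
  rewrite RintegralD ?RintegralZl//; try exact: l2_integrable.
  have := integrableZl measurableT c (l2_integrable lu lw).
  by apply: eq_integrable => // x _ /=; rewrite EFinM.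
- by move=> u v _ _; apply: eq_Rintegral => x _; rewrite mulrC.
- by move=> u _; apply: Rintegral_ge0 => x _; rewrite -expr2 sqr_ge0.
Qed.

Lemma l2_bounded_mul (a u : T -> R) (M : R) : measurable_fun setT a ->
  (forall x, `|a x| <= M) -> l2 u -> l2 (a * u).
Proof.
move=> ma aM lu; apply: (@l2_le _ (M *: u)); last exact: (sip_domZ sip_l2).
  by apply: measurable_funM => //; exact: l2_measurable.
move=> x /=; rewrite /GRing.scale/= [`|_ * _|]normrM [leRHS]normrM ler_wpM2r//.
by apply: le_trans (aM x) _; rewrite ler_norm.
Qed.

Lemma ip_mulA (a u v : T -> R) : ip (a * u) v = ip u (a * v).
Proof.
by apply: eq_Rintegral => x _ /=; rewrite mulrCA mulrA.
Qed.

Lemma ae_l2 u v : {ae mu, forall x, u x = v x} -> measurable_fun setT v ->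
  l2 u -> l2 v.
Proof.
move=> uv mv /l2P[mu_ iu]; apply/l2P; split=> //.
have mv2 : measurable_fun setT (EFin \o (fun x => v x ^+ 2)).
  by apply/measurable_EFinP; exact: measurable_funX.
apply/integrableP; split=> //; move/integrableP : iu => [mu2].
apply: le_lt_trans; apply: ae_ge0_le_integral => //.
- exact: measurableT_comp.
- exact: measurableT_comp.
- by apply: filterS uv => x /= ->.
Qed.

Lemma ae_ip u u' v : l2 u -> l2 u' -> l2 v -> {ae mu, forall x, u x = u' x} ->
  ip u v = ip u' v.
Proof.
move=> lu lu' lv uu'; rewrite /ip /Rintegral; congr fine.
apply: ae_eq_integral => //.
- by case/integrableP : (l2_integrable lu lv).
- by case/integrableP : (l2_integrable lu' lv).
- by apply: filterS uu' => x -> _.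
Qed.

Lemma ip_eq0_ae u : l2 u -> ip u u = 0 -> {ae mu, forall x, u x = 0}.
Proof.
move=> lu u0; have iu := l2_integrable lu lu.
have mu2 : measurable_fun setT (EFin \o (fun x => u x * u x)) by case/integrableP : iu.
have h : (\int[mu]_x `|(u x * u x)%:E| = 0)%E.
  have -> : (\int[mu]_x `|(u x * u x)%:E| = \int[mu]_x (u x * u x)%:E)%E.
    by apply: eq_integral => x _; rewrite gee0_abs// lee_fin -expr2 sqr_ge0.
  by rewrite -[LHS]fineK ?integrable_fin_num// -[fine _]/(ip u u) u0.
move/(ae_eq_integral_abs mu measurableT mu2) : h.
by apply: filterS => x /(_ Logic.I)/=[] /eqP; rewrite mulf_eq0 orbb => /eqP.
Qed.

Lemma nrm_eq0_ae u v : l2 u -> l2 v -> nrm ip (u - v) = 0 ->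
  {ae mu, forall x, u x = v x}.
Proof.
move=> lu lv /eqP; have luv := sip_domB sip_l2 lu lv.
rewrite sqrtr_eq0 => h; have : ip (u - v) (u - v) = 0.
  by apply/eqP; rewrite eq_le h (sip_ge0 sip_l2).
move/(ip_eq0_ae luv); apply: filterS => x /eqP.
by rewrite [(u - v) x]/(u x - v x) subr_eq0 => /eqP.
Qed.

Lemma ae_nrm0 u v : l2 u -> l2 v -> {ae mu, forall x, u x = v x} ->
  nrm ip (u - v) = 0.
Proof.
move=> lu lv uv; have luv := sip_domB sip_l2 lu lv.
rewrite /nrm (@ae_ip _ 0)// ?(sip0l sip_l2)// ?sqrtr0//; first exact: l2_0.
by apply: filterS uv => x h; change (u x - v x = 0); rewrite h subrr.
Qed.

(** Riesz-Fischer for functions rather than classes: an actual measurable limit is built from a fast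
    subsequence, and the whole sequence follows by the triangle inequality. *)
Lemma l2_complete : ncomplete l2 ip.
Proof.
move=> u lu cu.
have HL := sip_l2.
have [Nf hN] : exists Nf : nat -> nat, forall k m n, (Nf k <= m)%N -> (Nf k <= n)%N ->
    nrm ip (u m - u n) < 4^-1 ^+ k.
  have : forall k, exists N, forall m n, (N <= m)%N -> (N <= n)%N ->
    nrm ip (u m - u n) < 4^-1 ^+ k by move=> k; apply: cu; rewrite exprn_gt0.
  by move/choice => [f hf]; exists f.
(* The running maximum of the thresholds makes the subsequence indices monotone. *)
pose M k := (\max_(i < k.+1) Nf i)%N.
have NM k : (Nf k <= M k)%N by have := @leq_bigmax 'I_k.+1 (fun i => Nf i) ord_max.
have Mmono k j : (k <= j)%N -> (M k <= M j)%N.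
  move=> kj; apply/bigmax_leqP => i _.
  by have := @leq_bigmax 'I_j.+1 (fun i => Nf i) (widen_ord (kj : (k.+1 <= j.+1)%N) i).
have NM1 k : (Nf k <= M k.+1)%N by apply: leq_trans (NM k) (Mmono _ _ _).
pose v k := u (M k).
have lv k : l2 (v k) by exact: lu.
(* The weight is balanced: the integrals stay below [2^-k], and finiteness of the sum at [x] still
   forces increments of order [2^-k] there. *)
pose f k (x : T) : \bar R := (4 ^+ k * (v k.+1 x - v k x) ^+ 2)%:E.
have ldv k : l2 (v k.+1 - v k) by exact: (sip_domB HL).
have mf k : measurable_fun setT (f k).
  apply/measurable_EFinP; apply: measurable_funM => //.
  by apply: measurable_funX; exact: (l2_measurable (ldv k)).
have f0 k x : (0 <= f k x)%E by rewrite lee_fin mulr_ge0 ?sqr_ge0// exprn_ge0.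
have intf k : (\int[mu]_x f k x <= (2 / (2 ^ k.+1)%:R)%:E)%E.
  have -> : (\int[mu]_x f k x = (4 ^+ k * ip (v k.+1 - v k) (v k.+1 - v k))%:E)%E.
    rewrite /f; under eq_integral do rewrite EFinM.
    have iv := l2_integrable (ldv k) (ldv k).
    have [_ iv2] := (l2P _).1 (ldv k).
    rewrite (integralZl _ iv2)//.
    by rewrite EFinM; congr (_ * _)%E; rewrite /ip /Rintegral fineK ?(integrable_fin_num measurableT iv).
  have -> : 2 / (2 ^ k.+1)%:R = 2^-1 ^+ k :> R.
    by rewrite natrX exprS invfM mulrA divff// mul1r exprVn.
  rewrite lee_fin -(nrm_sq HL)//.
  have /ltW h := hN k _ _ (NM1 k) (NM k).
  have : nrm ip (v k.+1 - v k) ^+ 2 <= (4^-1 ^+ k) ^+ 2.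
    by rewrite ler_sqr ?nnegrE ?nrm_ge0// exprn_ge0.
  have p2 : 0 < 4 ^+ k :> R by rewrite exprn_gt0.
  move=> h2; rewrite -ler_pdivlMl//; apply: le_trans h2 _.
  rewrite -exprVn -exprMn -exprM mulnC exprM lerXn2r ?nnegrE//; lra.
have sumf : (\int[mu]_x (\sum_(k <oo) f k x) < +oo)%E.
  rewrite integral_nneseries//.
  apply: (@le_lt_trans _ _ (\sum_(k <oo) (2 / (2 ^ k.+1)%:R)%:E)%E).
    by apply: lee_nneseries => [k _ _|k _]; [exact: integral_ge0|exact: intf].
  by apply: le_lt_trans (epsilon_trick0 _ _) (ltry 2).
have sumi : mu.-integrable setT (fun x => \sum_(k <oo) f k x)%E.
  have mS : measurable_fun setT (fun x => \sum_(k <oo) f k x)%E.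
    by apply: (@ge0_emeasurable_sum _ _ _ setT f xpredT) => [k x _ _|k _]; [exact: f0|exact: mf].
  apply/integrableP; split=> //; apply: le_lt_trans sumf.
  rewrite le_eqVlt; apply/orP; left; apply/eqP; apply: eq_integral => x _.
  by rewrite gee0_abs// nneseries_ge0.
have cv : {ae mu, forall x, cvgn (fun k => v k x)}.
  apply: filterS (integrable_ae measurableT sumi) => x /(_ Logic.I) sx.
  pose s := fine (\sum_(k <oo) f k x)%E.
  have sE : (\sum_(k <oo) f k x = s%:E)%E by rewrite fineK.
  have fs k : 4 ^+ k * (v k.+1 x - v k x) ^+ 2 <= s.
    rewrite -lee_fin -sE; apply: le_trans (nneseries_lim_ge k.+1 _) => //.
    by rewrite big_nat_recr//= leeDr// sume_ge0.
  apply: (@cvgn_geometric_increments _ _ (Num.sqrt s)) => k.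
  rewrite -ler_sqr ?nnegrE ?mulr_ge0 ?sqrtr_ge0 ?exprn_ge0//.
  have s0 : 0 <= s by apply: le_trans (fs 0%N); rewrite mulr_ge0 ?sqr_ge0.
  rewrite real_normK ?num_real// exprMn sqr_sqrtr//.
  rewrite -exprM mulnC exprM.
  have -> : (2^-1 ^+ 2) ^+ k = (4 ^+ k)^-1 :> R.
    by rewrite -exprVn; congr (_ ^+ k); field.
  by rewrite ler_pdivlMr ?exprn_gt0// mulrC.
(* An upper limit is measurable without choosing limits; its values where the subsequence diverges
   do not matter. *)
pose ul x := fine (limn_esup (fun k => (v k x)%:E)).
have ulP x : cvgn (fun k => v k x) -> (fun k => v k x) @ \oo --> ul x.
  move=> /cvg_ex[l hl]; suff -> : ul x = l by [].
  have /cvg_limn_einf_sup[_ h] : (fun k => (v k x)%:E) @ \oo --> l%:E.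
    exact: (cvg_comp _ _ hl).
  by rewrite /ul h.
have mul : measurable_fun setT ul.
  apply: (measurableT_comp (fine_measurable _)) => //.
  apply: measurable_fun_limn_esup => k; apply/measurable_EFinP.
  exact: l2_measurable.
(* Fatou's lemma gives square integrability and the norm bound at once. *)
have main k (c : R) : (forall j, (k <= j)%N -> nrm ip (v j - v k) <= c) ->
    l2 (ul - v k) /\ nrm ip (ul - v k) <= c.
  move=> hc.
  have c0 : 0 <= c by apply: le_trans (hc k (leqnn k)); exact: nrm_ge0.
  have md : measurable_fun setT (ul - v k).
    by apply: measurable_funB => //; exact: l2_measurable.
  have int_le : (\int[mu]_x ((ul x - v k x) ^+ 2)%:E <= (c ^+ 2)%:E)%E.
    pose g j (x : T) := ((v j x - v k x) ^+ 2)%:E.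
    have mg j : measurable_fun setT (g j).
      apply/measurable_EFinP; apply: measurable_funX.
      by apply: measurable_funB; exact: l2_measurable.
    have g0 j x : (0 <= g j x)%E by rewrite lee_fin sqr_ge0.
    apply: (@le_trans _ _ (\int[mu]_x (limn_einf (g ^~ x)))%E).
      apply: ae_ge0_le_integral => //.
      - by move=> x _; rewrite lee_fin sqr_ge0.
      - by apply/measurable_EFinP; apply: measurable_funX.
      - move=> x _; rewrite limn_einf_lim; apply: lime_ge; first exact: is_cvg_einfs.
        by apply: nearW => n; apply: le_ereal_inf_tmp => _ [j _ <-].
      - have -> : (fun x => limn_einf (g ^~ x)) =
            (fun x => - limn_esup (fun j => - g j x))%E.
          apply/funext => x; rewrite -limn_einfN; congr limn_einf.
          by apply/funext => j; exact/esym/oppeK.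
        apply: measurableT_comp => //; apply: measurable_fun_limn_esup => j.
        exact: measurableT_comp.
      - apply: filterS cv => x /ulP hx _.
        suff -> : limn_einf (g ^~ x) = ((ul x - v k x) ^+ 2)%:E by [].
        have h : g ^~ x @ \oo --> ((ul x - v k x) ^+ 2)%:E.
          apply: cvg_EFin; first exact: nearW.
          rewrite /g /= /comp /=.
          apply: (@cvg_comp _ _ _ (fun j => v j x) (fun y => (y - v k x) ^+ 2) _ _ _ hx).
          apply: cvgM; apply: cvgB => //; exact: cvg_cst.
        by have [-> _] := cvg_limn_einf_sup h.
    apply: le_trans (fatou mu measurableT mg (fun n x _ => g0 n x)) _.
    apply: (@limn_einf_le _ _ _ k) => j kj.
    have := hc j kj; rewrite -ler_sqr ?nnegrE ?nrm_ge0//.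
    have ljk : l2 (v j - v k) by exact: (sip_domB HL).
    rewrite (nrm_sq HL)// -lee_fin; apply: le_trans.
    have ii := l2_integrable ljk ljk.
    by rewrite /ip /Rintegral fineK ?integrable_fin_num.
  have ld : l2 (ul - v k).
    apply/l2P; split => //; apply/integrableP; split.
      by apply/measurable_EFinP; apply: measurable_funX.
    apply: le_lt_trans (ltry (c ^+ 2)); apply: le_trans int_le.
    rewrite le_eqVlt; apply/orP; left; apply/eqP; apply: eq_integral => x _ /=.
    by rewrite ger0_norm ?sqr_ge0.
  split=> //; rewrite -ler_sqr ?nnegrE ?nrm_ge0// (nrm_sq HL)// -lee_fin.
  apply: le_trans int_le; rewrite /ip /Rintegral fineK//.
  exact: integrable_fin_num (l2_integrable ld ld).
have bnd j k : (k <= j)%N -> nrm ip (v j - v k) <= 4^-1 ^+ k.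
  by move=> kj; apply: ltW; apply: hN (NM k); exact: leq_trans (NM k) (Mmono _ _ kj).
have lul : l2 ul.
  have [h _] := main 0%N _ (fun j => @bnd j 0%N).
  by rewrite -[ul](subrK (v 0%N)); exact: (sip_domD HL).
exists ul => // e e0.
have e2 : 0 < e / 2 by lra.
have [k hk] : exists k, 4^-1 ^+ k < e / 2 :> R.
  have [k _ hk] : \forall k \near \oo, 4^-1 ^+ k < e / 2.
    have q1 : `|4^-1 : R| < 1 by rewrite ger0_norm// invf_lt1// ltr1n.
    have /cvgr0_norm_lt/(_ _ e2) := cvg_expr q1.
    by apply: filterS => k; apply: le_lt_trans; exact: ler_norm.
  by exists k; apply: hk => /=.
exists (Nf k) => n hn.
have [_ h1] := main k _ (fun j => @bnd j k).
apply: le_lt_trans (nrm_tri HL (lu n) lul (lv k)) _.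
rewrite (nrmBC HL (lv k) lul).
have := hN k _ _ hn (NM k); rewrite -/(v k); lra.
Qed.
End L2.

(** * The resolvent of a Dirichlet form *)

Lemma sum_funE (T : Type) (R : realType) n (F : 'I_n -> T -> R) x :
  (\sum_i F i) x = \sum_i F i x.
Proof. by apply: (big_morph (fun f : T -> R => f x)). Qed.

(** The restriction of a Dirichlet form to real functions ([real_dirichlet_form]). Elements of [D]
    are genuine functions, and the two [rd_ae] fields make [D] and [e] descend to classes. *)
Record real_dirichlet d (T : measurableType d) (R : realType)
    (mu : {measure set T -> \bar R}) (D : set (T -> R))
    (e : (T -> R) -> (T -> R) -> R) : Prop := {
  rd_sip : sip D e;
  rd_l2 : D `<=` l2 mu;
  rd_ae_dom : forall u v, D u -> l2 mu v -> {ae mu, forall x, u x = v x} -> D v;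
  rd_ae_val : forall u v w, D u -> D v -> D w -> {ae mu, forall x, u x = v x} ->
    e u w = e v w;
  rd_closed : forall (u : nat -> T -> R) v, (forall n, D (u n)) -> l2 mu v ->
    ncvg (ip mu) u v -> ncauchy e u -> D v /\ ncvg e u v;
  rd_markov : forall u, D u ->
    D (fun x => Num.min (Num.max (u x) 0) 1) /\
    e (fun x => Num.min (Num.max (u x) 0) 1)
      (fun x => Num.min (Num.max (u x) 0) 1) <= e u u
}.

Section RealDirichlet.
Context d (T : measurableType d) (R : realType).
Variable mu : {measure set T -> \bar R}.
Context (D : set (T -> R)) (e : (T -> R) -> (T -> R) -> R).
Hypothesis HE : real_dirichlet mu D e.
Local Notation ip := (ip mu).
Local Notation l2 := (l2 mu).
Implicit Types (u v w f g : T -> R).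

Let HD : sip D e := rd_sip HE.
Let HL : sip l2 ip := sip_l2 mu.
Let DL : D `<=` l2 := rd_l2 HE.

(* [v = k (k + H)^-1 f] *)
Definition is_resolvent (k : R) f v := D v /\ forall w, D w -> e v w = k * ip (f - v) w.

Lemma res_ex k f : 0 < k -> l2 f -> exists v, is_resolvent k f v.
Proof.
by move=> k0 lf; apply: (resolvent_ex HL HD DL (@l2_complete _ _ _ mu)
  (rd_closed HE)).
Qed.

Lemma res_linear k (c : R) f g v w : l2 f -> l2 g -> is_resolvent k f v -> is_resolvent k g w ->
  is_resolvent k (c *: f + g) (c *: v + w).
Proof.
move=> lf lg [Dv hv] [Dw hw]; split; first exact: (sip_domP HD).
move=> z Dz; rewrite (sip_linl HD)// hv// hw//.
have -> : c *: f + g - (c *: v + w) = c *: (f - v) + (g - w).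
  by rewrite scalerBr opprD addrACA.
rewrite (sip_linl HL) ?[_ + k * _]addrC//; [|exact: (sip_domB HL lf (DL Dv))|
  exact: (sip_domB HL lg (DL Dw))|exact: DL].
by ring.
Qed.

Lemma res_0 k : is_resolvent k 0 0.
Proof.
split=> [|w Dw]; first exact: (sip_dom0 HD).
by rewrite subrr (sip0l HD)// (sip0l HL) ?mulr0//; exact: DL.
Qed.

Lemma res_sum k n (f v : 'I_n -> T -> R) (c : 'I_n -> R) :
  (forall i, l2 (f i)) -> (forall i, is_resolvent k (f i) (v i)) ->
  is_resolvent k (\sum_i c i *: f i) (\sum_i c i *: v i).
Proof.
elim: n f v c => [|n IH] f v c lf rfv; first by rewrite !big_ord0; exact: res_0.
rewrite !big_ord_recl; apply: res_linear => //; last first.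
  by apply: (IH (fun i => f (lift ord0 i))).
by apply: (sip_dom_sum HL) => i; exact: (sip_domZ HL).
Qed.

(** The energy of the difference is [- k] times its squared norm, and both quantities are
    nonnegative. *)
Lemma res_uniq k f v w : 0 < k -> l2 f -> is_resolvent k f v -> is_resolvent k f w ->
  {ae mu, forall x, v x = w x}.
Proof.
move=> k0 lf [Dv hv] [Dw hw]; have Dvw := sip_domB HD Dv Dw.
apply: nrm_eq0_ae; [exact: DL|exact: DL|].
have h : e (v - w) (v - w) = - k * ip (v - w) (v - w).
  rewrite {1}(sipBl HD)// hv// hw//.
  have l1 := sip_domB HL lf (DL Dv); have l2' := sip_domB HL lf (DL Dw).
  have -> : ip (f - v) (v - w) = ip (f - w) (v - w) - ip (v - w) (v - w).
    rewrite -(sipBl HL)//; try exact: DL.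
    by congr (ip _ _); rewrite opprB addrA subrK.
  by ring.
have h1 := sip_ge0 HD Dvw; have h2 := sip_ge0 HL (DL Dvw).
have h3 : ip (v - w) (v - w) = 0 by nra.
by rewrite /nrm h3 sqrtr0.
Qed.

Lemma res_sym k f g v w : 0 < k -> l2 f -> l2 g -> is_resolvent k f v -> is_resolvent k g w ->
  ip f w = ip v g.
Proof.
move=> k0 lf lg [Dv hv] [Dw hw].
have := hv _ Dw; have := hw _ Dv; rewrite (sip_sym HD)// => -> .
have lv := DL Dv; have lw := DL Dw.
rewrite !(sipBl HL)// (sip_sym HL lw lv) (sip_sym HL lg lv) => /(mulfI (lt0r_neq0 k0)).
lra.
Qed.

Lemma clamp_dist (a b : R) : 0 <= b <= 1 ->
  (Num.min (Num.max a 0) 1 - b) ^+ 2 <= (a - b) ^+ 2.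
Proof.
move=> /andP[b0 b1]; rewrite /Num.min /Num.max.
case: (ltP a 0) => a0; first by rewrite ltr01; nra.
by case: (ltP a 1) => a1 //; nra.
Qed.

(** [v] is the unique minimizer of energy plus [k] times the squared distance to [f]. Clamping to
    [[0, 1]] increases neither term, so it leaves [v] unchanged almost everywhere. *)
Lemma res_01 k f v : 0 < k -> l2 f -> (forall x, 0 <= f x <= 1) -> is_resolvent k f v ->
  {ae mu, forall x, 0 <= v x <= 1}.
Proof.
move=> k0 lf f01 [Dv hv].
pose w x := Num.min (Num.max (v x) 0) 1.
have [Dw ew] := rd_markov HE Dv; rewrite -/w in Dw ew.
have lv := DL Dv; have lw := DL Dw; have lfv := sip_domB HL lf lv.
have lfw := sip_domB HL lf lw.
have ip_le : ip (w - f) (w - f) <= ip (v - f) (v - f).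
  apply: le_Rintegral => //.
  - by apply: l2_integrable; exact: (sip_domB HL).
  - by apply: l2_integrable; exact: (sip_domB HL).
  - by move=> x _; rewrite -!expr2; exact: clamp_dist.
have h1 := hv _ Dv; have h2 := hv _ Dw.
have Dwv := sip_domB HD Dw Dv.
have h3 := sip_ge0 HD Dwv; have h4 := sip_ge0 HL (DL Dwv).
have h0 : ip (w - v) (w - v) = 0.
  move: h1 h2 h3 h4 ip_le; rewrite !(sip_sqB HL)// (sip_sqB HD)// !(sipBl HL)//.
  rewrite (sip_sym HD Dw Dv) (sip_sym HL lw lv) (sip_sym HL lv lf) (sip_sym HL lw lf).
  move=> h1 h2 h3 h4 h5.
  have : k * (ip w w - 2 * ip f w) <= k * (ip v v - 2 * ip f v).
    by rewrite ler_wpM2l ?(ltW k0)//; lra.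
  have : 0 <= k * (ip w w - 2 * ip v w + ip v v) by rewrite mulr_ge0// ltW.
  move=> h6 h7; have h8 : k * (ip w w - 2 * ip v w + ip v v) = 0 by lra.
  by move/eqP: h8; rewrite mulf_eq0 (gt_eqF k0) => /eqP.
have : nrm ip (w - v) = 0 by rewrite /nrm h0 sqrtr0.
move/(nrm_eq0_ae lw lv); apply: filterS => x <-; rewrite /w.
by rewrite le_min ler01 le_max lexx orbT/= ge_min lexx orbT.
Qed.

(** Write [f = c fp - M1 fn] with [fp] and [fn] valued in [[0, 1]] and apply [res_01] to each: the
    second term only lowers the result. Here [M] serves to scale the negative part. *)
Lemma res_le k f v (c M : R) : 0 < k -> 0 < c -> l2 f ->
  (forall x, `|f x| <= M) -> (forall x, f x <= c) -> is_resolvent k f v ->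
  {ae mu, forall x, v x <= c}.
Proof.
move=> k0 c0 lf fM fc rv; have mf := l2_measurable lf.
pose M1 := `|M| + 1; have M1_gt0 : 0 < M1 by rewrite /M1; have := normr_ge0 M; lra.
pose fp x := c^-1 * Num.max (f x) 0; pose fn x := M1^-1 * Num.max (- f x) 0.
have mfp : measurable_fun setT fp.
  by apply: measurable_funM => //; exact: measurable_maxr.
have mfn : measurable_fun setT fn.
  by apply: measurable_funM => //; apply: measurable_maxr => //; exact: measurableT_comp.
have lfp : l2 fp.
  apply: (l2_le mfp) (sip_domZ HL c^-1 lf) => x.
  rewrite [`|(_ *: _) _|]normrM normrM ler_wpM2l//.
  by rewrite /Num.max; case: ltP => h2; rewrite ?normr0.
have lfn : l2 fn.
  apply: (l2_le mfn) (sip_domZ HL M1^-1 lf) => x.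
  rewrite [`|(_ *: _) _|]normrM normrM ler_wpM2l//.
  by rewrite /Num.max; case: ltP => // h2; rewrite ?normr0 ?normrN.
have fp01 x : 0 <= fp x <= 1.
  rewrite /fp mulr_ge0 ?invr_ge0 ?(ltW c0) ?le_max ?lexx ?orbT//=.
  by rewrite mulrC ler_pdivrMr// mul1r ge_max fc ltW.
have fn01 x : 0 <= fn x <= 1.
  rewrite /fn mulr_ge0 ?invr_ge0 ?(ltW M1_gt0) ?le_max ?lexx ?orbT//=.
  rewrite mulrC ler_pdivrMr// mul1r ge_max; apply/andP; split; last exact: ltW.
  by have := fM x; have := ler_norm M; have := ler_norm (- f x); rewrite normrN /M1; lra.
have [vp rp] := res_ex k0 lfp; have [vn rn] := res_ex k0 lfn.
have fE : f = c *: fp + (- M1 *: fn + 0).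
  apply/funext => x; rewrite addr0.
  have -> : (c *: fp + - M1 *: fn) x = c * fp x + - M1 * fn x by [].
  rewrite /fp /fn mulrA divff ?gt_eqF// mulNr !mulrA divff ?gt_eqF// !mul1r.
  by rewrite /Num.max; case: (ltP (f x) 0); case: (ltP (- f x) 0); lra.
have l0 := sip_dom0 HL.
have r1 := res_linear (- M1) lfn l0 rn (res_0 k).
have l1 : l2 (- M1 *: fn + 0) by exact: (sip_domP HL).
have := res_linear c lfp l1 rp r1; rewrite -fE => r2.
have h1 := res_uniq k0 lf rv r2.
apply: filterS3 h1 (res_01 k0 lfp fp01 rp) (res_01 k0 lfn fn01 rn).
move=> x ->; rewrite addr0.
have -> : (c *: vp + - M1 *: vn) x = c * vp x + - M1 * vn x by [].
by move=> /andP[h2 h3] /andP[h4 h5]; nra.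
Qed.

Lemma ncvg_cvg (V : lmodType R) (D' : set V) b (x : nat -> V) y (z : V) : sip D' b ->
  (forall n, D' (x n)) -> D' y -> D' z -> ncvg b x y ->
  (fun n => b (x n) z) @ \oo --> b y z.
Proof.
move=> Hb Dx Dy Dz xy; apply/cvgrPdist_lt => a a0.
have K0 : 0 < nrm b z + 1 by have := nrm_ge0 b z; lra.
have [N hN] := xy _ (divr_gt0 a0 K0).
exists N => // n /= /hN; rewrite ltr_pdivlMr// => h.
rewrite distrC -(sipBl Hb)//; apply: le_lt_trans (sip_CS Hb _ Dz) _.
  exact: (sip_domB Hb).
by apply: le_lt_trans h; rewrite ler_wpM2l ?nrm_ge0//; lra.
Qed.


Hypothesis sfin : sigma_finite setT mu.

(** The constant one need not be square integrable, so integrals of resolvents are tested on sets of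
    finite measure exhausting the space; dominated convergence concludes. *)
Lemma Rintegral_le_of_cutoff (g : T -> R) (c : R) (F : nat -> set T) :
  mu.-integrable setT (EFin \o g) -> (forall n, measurable (F n)) ->
  nondecreasing_seq F -> \bigcup_n F n = setT ->
  (forall n, \int[mu]_x (\1_(F n) x * g x) <= c) -> \int[mu]_x g x <= c.
Proof.
move=> ig mF ndF FT gc.
pose h n (x : T) := (\1_(F n) x * g x)%:E.
have mg : measurable_fun setT g by apply/measurable_EFinP; case/integrableP : ig.
have mh n : measurable_fun setT (h n).
  by apply/measurable_EFinP; apply: measurable_funM => //; exact: measurable_indic.
have habs n x : (`|h n x| <= `|(g x)%:E|)%E.
  rewrite /h lee_fin normrM ler_piMl// indicE.
  by case: (_ \in _); rewrite ?normr1 ?normr0.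
have ih n : mu.-integrable setT (h n) by apply: le_integrable ig.
have hg : {ae mu, forall x, setT x -> h ^~ x @ \oo --> (g x)%:E}.
  apply: aeW => x _.
  have [N _ FNx] : (\bigcup_n F n) x by rewrite FT.
  apply: cvg_near_cst; exists N => // n /= Nn.
  have /subsetPset FNn := ndF _ _ Nn.
  by rewrite /h indicE mem_set ?mul1r//; exact: FNn.
have iag : mu.-integrable setT (fun x => `|(g x)%:E|%E) by exact: integrable_abse.
have dom : {ae mu, forall x n, setT x -> (`|h n x| <= `|(g x)%:E|)%E}.
  by apply: aeW => x n _.
have [_ _ hc] := dominated_convergence measurableT mh (measurable_int mu ig) hg iag dom.
rewrite -lee_fin /Rintegral fineK; last exact: integrable_fin_num ig.
apply: (@cvge_le _ _ _ _ _ _ _ _ hc); apply: nearW => n.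
have := gc n; rewrite -lee_fin /Rintegral fineK//.
exact: integrable_fin_num (ih n).
Qed.

(* For a fixed [y], submarkovianity turns the pointwise inequality in [x] into
   an a.e. inequality; choosing one [y] in each cell of a countable partition
   on which the data oscillate by less than [1 / j], the exceptional set does
   not depend on [y], and one may take [y = x]. *)
Lemma res_kernel_ae (k : R) n (a b : 'I_n -> T -> R) (pa pb : 'I_n -> T -> R)
    (s ps : T -> R) (M : R) : 0 < k -> 0 <= M ->
  (forall i, l2 (a i)) -> (forall i, l2 (b i)) ->
  (forall i x, `|a i x| <= M) -> (forall i x, `|b i x| <= M) ->
  (forall i, is_resolvent k (a i) (pa i)) -> (forall i, is_resolvent k (b i) (pb i)) ->
  s = \sum_i a i * b i -> l2 s -> is_resolvent k s ps -> (forall x, 0 <= s x) ->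
  (forall x y, 0 <= \sum_i (a i x - a i y) * (b i x - b i y)) ->
  {ae mu, forall x, \sum_i (b i x * pa i x + a i x * pb i x) <= ps x + s x}.
Proof.
move=> k0 M0 la lb aM bM rpa rpb sE ls rps s0 pos.
have sx x : s x = \sum_i a i x * b i x by rewrite sE sum_funE.
have sM x : `|s x| <= n%:R * (M * M).
  rewrite sx; apply: le_trans (ler_norm_sum _ _ _) _.
  rewrite mulr_natl -[n in leRHS]card_ord -sumr_const; apply: ler_sum => i _.
  by rewrite normrM ler_pM.
(* Expanding the products, the hypothesis says [h x <= s y] for a function [h] in which [y] enters
   only through coefficients. The strict margin provides the positive bound needed by [res_le]. *)
have fixed y c : s y < c -> {ae mu, forall x,
    \sum_i (b i y * pa i x + a i y * pb i x) <= ps x + c}.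
  move=> syc; have c0 : 0 < c by exact: le_lt_trans (s0 y) syc.
  pose h := -1 *: s + (\sum_i b i y *: a i + \sum_i a i y *: b i).
  pose ph := -1 *: ps + (\sum_i b i y *: pa i + \sum_i a i y *: pb i).
  have l1 : l2 (\sum_i b i y *: a i).
    by apply: (sip_dom_sum HL) => i; exact: (sip_domZ HL).
  have l3 : l2 (\sum_i a i y *: b i).
    by apply: (sip_dom_sum HL) => i; exact: (sip_domZ HL).
  have r1 := res_sum (fun i => b i y) la rpa.
  have r2 := res_sum (fun i => a i y) lb rpb.
  have r3 : is_resolvent k (\sum_i b i y *: a i + \sum_i a i y *: b i)
                  (\sum_i b i y *: pa i + \sum_i a i y *: pb i).
    by have := res_linear 1 l1 l3 r1 r2; rewrite !scale1r.
  have lh : l2 h by apply: (sip_domP HL) => //; exact: (sip_domD HL).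
  have rh : is_resolvent k h ph by apply: res_linear => //; exact: (sip_domD HL).
  have hx x : h x = - s x + (\sum_i b i y * a i x + \sum_i a i y * b i x).
    have -> : h x = -1 * s x +
      ((\sum_i b i y *: a i) x + (\sum_i a i y *: b i) x) by [].
    by rewrite mulN1r !sum_funE.
  have phx x : ph x = - ps x + \sum_i (b i y * pa i x + a i y * pb i x).
    have -> : ph x = -1 * ps x +
      ((\sum_i b i y *: pa i) x + (\sum_i a i y *: pb i) x) by [].
    by rewrite mulN1r !sum_funE big_split.
  have hc x : h x <= c.
    apply: le_trans (ltW syc); rewrite hx.
    have := pos x y.
    have -> : \sum_i (a i x - a i y) * (b i x - b i y) =
      s x - (\sum_i b i y * a i x + \sum_i a i y * b i x) + s y.
      rewrite !sx -big_split/= -sumrB -big_split/=; apply: eq_bigr => i _; ring.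
    by lra.
  have hM x : `|h x| <= n%:R * (M * M) + (n%:R * (M * M) + n%:R * (M * M)).
    rewrite hx; apply: le_trans (ler_normD _ _) _; rewrite normrN lerD//.
    apply: le_trans (ler_normD _ _) _; apply: lerD;
      apply: le_trans (ler_norm_sum _ _ _) _;
      rewrite mulr_natl -[n in leRHS]card_ord -sumr_const; apply: ler_sum => i _;
      by rewrite normrM ler_pM.
  apply: filterS (res_le k0 c0 lh hM hc rh) => x; rewrite phx; lra.
(* Rounding all the data at mesh [1 / (j + 1)] takes countably many values, hence produces countably
   many exceptional sets. *)
pose code (j : nat) (y : T) : {ffun 'I_n -> int * int} :=
  [ffun i => (Num.floor (j.+1%:R * a i y), Num.floor (j.+1%:R * b i y))].
(* [unpickle] enumerates the cells and [xget] picks a point in each nonempty one, with [point] as a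
   harmless default. *)
pose P (j m : nat) (x : T) := forall q, unpickle m = Some q ->
  forall y, y = xget point [set y | code j y = q] ->
  \sum_i (b i y * pa i x + a i y * pb i x) <= ps x + (s y + j.+1%:R^-1).
have aeP : {ae mu, forall x, forall j m, P j m x}.
  apply: ae_foralln => j; apply: ae_foralln => m.
  case E : (@unpickle {ffun 'I_n -> int * int} m) => [q|]; last first.
    by apply: aeW => x q; rewrite E.
  have h : s (xget point [set y | code j y = q]) <
           s (xget point [set y | code j y = q]) + j.+1%:R^-1.
    by rewrite ltrDl invr_gt0.
  by apply: filterS (fixed _ _ h) => x hx q'; rewrite E => -[<-] y ->.
apply: filterS aeP => x Px.
(* Collects the errors made when the chosen point of the cell is replaced by [x]; it depends on [x]
   but not on [j]. *)
pose C : R := \sum_i (`|pa i x| + `|pb i x| + 2 * M) + 1.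
have floor_close j (u v : R) : Num.floor (j.+1%:R * u) = Num.floor (j.+1%:R * v) ->
    `|u - v| <= j.+1%:R^-1 :> R.
  move=> uv; have := floor_itv (j.+1%:R * u); have := floor_itv (j.+1%:R * v).
  rewrite uv intrD => /andP[h1 h2] /andP[h3 h4].
  have j0 : 0 < j.+1%:R :> R by [].
  rewrite -[_^-1]mul1r ler_pdivlMr// -(gtr0_norm j0) -normrM mulrBl.
  by rewrite ![_ * j.+1%:R]mulrC ler_norml; lra.
have main j : \sum_i (b i x * pa i x + a i x * pb i x) - (ps x + s x) <= C * j.+1%:R^-1.
  pose y := xget point [set y | code j y = code j x].
  have cy : code j y = code j x.
    by apply: (@xgetPex _ point [set y | code j y = code j x]); exists x.
  have := Px j (pickle (code j x)) (code j x) (pickleK _) y erefl.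
  have ay i : `|a i x - a i y| <= j.+1%:R^-1.
    apply: floor_close; have := congr1 (fun f : {ffun _} => (f i).1) cy.
    by rewrite !ffunE.
  have by_ i : `|b i x - b i y| <= j.+1%:R^-1.
    apply: floor_close; have := congr1 (fun f : {ffun _} => (f i).2) cy.
    by rewrite !ffunE.
  set r := j.+1%:R^-1 in ay by_ *; have r0 : 0 < r by rewrite invr_gt0.
  have d1 : \sum_i (b i x * pa i x + a i x * pb i x) -
            \sum_i (b i y * pa i x + a i y * pb i x) <=
            \sum_i (`|pa i x| + `|pb i x|) * r.
    rewrite -sumrB; apply: ler_sum => i _.
    have -> : b i x * pa i x + a i x * pb i x - (b i y * pa i x + a i y * pb i x) =
       (b i x - b i y) * pa i x + (a i x - a i y) * pb i x by ring.
    apply: le_trans (ler_norm _) _; apply: le_trans (ler_normD _ _) _.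
    rewrite [leRHS]mulrDl; apply: lerD; rewrite normrM mulrC ler_wpM2l//.
  have d2 : s y - s x <= \sum_(i < n) (2 * M) * r.
    rewrite !sx -sumrB; apply: ler_sum => i _.
    have -> : a i y * b i y - a i x * b i x =
      - ((a i x - a i y) * b i y) + - (a i x * (b i x - b i y)) by ring.
    apply: le_trans (ler_norm _) _; apply: le_trans (ler_normD _ _) _.
    rewrite !normrN !normrM.
    have h1 : `|a i x - a i y| * `|b i y| <= r * M by rewrite ler_pM.
    have h2 : `|a i x| * `|b i x - b i y| <= M * r by rewrite ler_pM.
    by lra.
  have -> : C * r = \sum_i (`|pa i x| + `|pb i x|) * r + \sum_(i < n) (2 * M) * r + r.
    rewrite /C mulrDl mul1r; congr (_ + _); rewrite mulr_suml -big_split.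
    by apply: eq_bigr => i _; rewrite mulrDl.
  lra.
have C0 : 0 < C.
  rewrite /C ltr_wpDl// sumr_ge0// => i _.
  by have := normr_ge0 (pa i x); have := normr_ge0 (pb i x); lra.
rewrite -subr_le0; apply/ler_addgt0Pr => ep ep0; rewrite add0r.
have [N hN] := invS_small (divr_gt0 ep0 C0).
have := hN N (leqnn N); rewrite ltr_pdivlMr// => h.
apply: le_trans (main N) _; rewrite mulrC; exact: ltW.
Qed.

End RealDirichlet.

(** * Beurling-Deny positivity *)

Lemma cvg_sum_ord (R : realType) n (u : 'I_n -> nat -> R) (l : 'I_n -> R) :
  (forall i, u i @ \oo --> l i) ->
  (fun m => \sum_i u i m) @ \oo --> \sum_i l i.
Proof.
elim: n u l => [|n IH] u l ul.
  by rewrite big_ord0; under eq_cvg do rewrite big_ord0; exact: cvg_cst.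
rewrite big_ord_recl; under eq_cvg do rewrite big_ord_recl.
by apply: cvgD => //; apply: (IH (fun i => u (lift ord0 i))).
Qed.

Section Kernel.
Context d (T : measurableType d) (R : realType).
Variable mu : {measure set T -> \bar R}.
Implicit Types f g : T -> R.
Local Notation L1 f := (mu.-integrable setT (EFin \o f)).

Lemma ae_le_Rintegral f g : L1 f -> L1 g ->
  {ae mu, forall x, f x <= g x} -> \int[mu]_x f x <= \int[mu]_x g x.
Proof.
move=> i_f i_g fg.
have mf : measurable_fun setT f by apply/measurable_EFinP; case/integrableP : i_f.
have mg : measurable_fun setT g by apply/measurable_EFinP; case/integrableP : i_g.
pose h x := Num.min (f x) (g x).
have mh : measurable_fun setT (EFin \o h).
  by apply/measurable_EFinP; exact: measurable_minr.
have fh : ae_eq mu setT (EFin \o f) (EFin \o h).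
  by apply: filterS fg => x fgx _; rewrite /h /= min_l.
have ih : L1 h.
  have [mf' fi] := integrableP _ _ _ i_f; apply/integrableP; split=> //.
  rewrite (ae_eq_integral (fun x => `|(f x)%:E|)%E)//.
  - exact: measurableT_comp.
  - exact: measurableT_comp.
  - by apply: filterS fh => x h1 Tx; have := h1 Tx; move=> <-.
have -> : \int[mu]_x f x = \int[mu]_x h x.
  by rewrite /Rintegral; congr fine; apply: ae_eq_integral => //; case/integrableP : i_f.
by apply: le_Rintegral => // x _; rewrite /h ge_min lexx orbT.
Qed.

Lemma EFin_integrableD f g : L1 f -> L1 g -> L1 (f + g).
Proof.
move=> i_f i_g; have := integrableD measurableT i_f i_g.
by apply: eq_integrable.
Qed.

Lemma EFin_integrableB f g : L1 f -> L1 g -> L1 (f - g).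
Proof.
move=> i_f i_g; have := integrableB measurableT i_f i_g.
by apply: eq_integrable.
Qed.

Lemma Rintegral_sum n (F : 'I_n -> T -> R) : (forall i, L1 (F i)) ->
  L1 (\sum_i F i) /\ \int[mu]_x (\sum_i F i) x = \sum_i \int[mu]_x F i x.
Proof.
elim: n F => [|n IH] F iF.
  rewrite !big_ord0; split; first exact: integrable0.
  by rewrite /Rintegral integral0.
have [h1 h2] := IH (fun i => F (lift ord0 i)) (fun i => iF _).
rewrite !big_ord_recl -h2; split; last exact: RintegralD.
exact: EFin_integrableD.
Qed.

Context (D : set (T -> R)) (e : (T -> R) -> (T -> R) -> R).
Hypothesis HE : real_dirichlet mu D e.
Hypothesis sfin : sigma_finite setT mu.
Local Notation ip := (ip mu).
Local Notation l2 := (l2 mu).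
Local Notation is_resolvent := (is_resolvent mu D e).

Let HD : sip D e := rd_sip HE.
Let HL : sip l2 ip := sip_l2 mu.
Let DL : D `<=` l2 := rd_l2 HE.

(** Integrate [res_kernel_ae]. By symmetry of the resolvent both sums on the left integrate to the
    sum of the [ip (pa i) (b i)], and by submarkovianity the integral of [ps] is at most that of
    [s]. *)
Lemma res_kernel (k : R) n (a b : 'I_n -> T -> R) (pa pb : 'I_n -> T -> R)
    (M : R) : 0 < k -> 0 <= M ->
  (forall i, l2 (a i)) -> (forall i, l2 (b i)) ->
  (forall i x, `|a i x| <= M) -> (forall i x, `|b i x| <= M) ->
  (forall i, is_resolvent k (a i) (pa i)) -> (forall i, is_resolvent k (b i) (pb i)) ->
  (forall x y, 0 <= \sum_i (a i x - a i y) * (b i x - b i y)) ->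
  (forall x, 0 <= \sum_i a i x * b i x) ->
  0 <= \sum_i ip (a i - pa i) (b i).
Proof.
move=> k0 M0 la lb aM bM rpa rpb pos s0.
have ma i := l2_measurable (la i); have mb i := l2_measurable (lb i).
have lpa i : l2 (pa i) by apply: DL; case: (rpa i).
have lpb i : l2 (pb i) by apply: DL; case: (rpb i).
pose s := \sum_i a i * b i.
have sx x : s x = \sum_i a i x * b i x by rewrite /s sum_funE.
have ls : l2 s by apply: (sip_dom_sum HL) => i; exact: l2_bounded_mul (ma i) (aM i) (lb i).
have {}s0 x : 0 <= s x by rewrite sx.
have [ps rps] := res_ex HE k0 ls.
have lps : l2 ps by apply: DL; case: rps.
have AE := res_kernel_ae HE k0 M0 la lb aM bM rpa rpb erefl ls rps s0 pos.
have [is_ sI] := Rintegral_sum (fun i => l2_integrable (la i) (lb i)).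
have [ia aI] := Rintegral_sum (fun i => l2_integrable (la i) (lpb i)).
have [ib bI] := Rintegral_sum (fun i => l2_integrable (lb i) (lpa i)).
set A := \sum_i _ in ia aI; set B := \sum_i _ in ib bI.
rewrite -/s in is_ sI.
have lA : l2 A by apply: (sip_dom_sum HL) => i; exact: l2_bounded_mul (ma i) (aM i) (lpb i).
have lB : l2 B by apply: (sip_dom_sum HL) => i; exact: l2_bounded_mul (mb i) (bM i) (lpa i).
pose g := A + B - s.
have lg : l2 g by apply: (sip_domB HL) => //; exact: (sip_domD HL).
have ig : L1 g.
  have iAB : L1 (A + B) by exact: EFin_integrableD.
  exact: EFin_integrableB.
have gI : \int[mu]_x g x = \int[mu]_x A x + \int[mu]_x B x - \int[mu]_x s x.
  by rewrite -RintegralD// -RintegralB//; exact: EFin_integrableD.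
have g_ps : {ae mu, forall x, g x <= ps x}.
  apply: filterS AE => x; rewrite big_split/=.
  have -> : g x = A x + B x - s x by [].
  have -> : A x = \sum_i a i x * pb i x by rewrite /A sum_funE.
  have -> : B x = \sum_i b i x * pa i x by rewrite /B sum_funE.
  by rewrite -/s; lra.
have [F [FT ndF mF]] := (sigma_finiteP _ _).1 sfin.
(* By symmetry the resolvent is moved from [s] to the indicator [chi], where it is at most one. *)
have main : \int[mu]_x g x <= \int[mu]_x s x.
  apply: (Rintegral_le_of_cutoff ig (fun n => (mF n).1) ndF); first by rewrite -FT.
  move=> m; have [mFm Fm_lt] := mF m.
  pose chi : T -> R := \1_(F m).
  have chi01 x : 0 <= chi x <= 1.
    by rewrite /chi indicE; case: (_ \in _); rewrite ?lexx ?ler01.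
  have lchi : l2 chi.
    apply/l2P; split; first exact: measurable_indic.
    have -> : EFin \o (fun x => chi x ^+ 2) = EFin \o chi.
      apply/funext => x /=; congr EFin; rewrite /chi indicE.
      by case: (_ \in _); rewrite ?expr1n ?expr0n.
    apply/integrableP; split; first by apply/measurable_EFinP; exact: measurable_indic.
    apply: le_lt_trans Fm_lt.
    apply: (@le_trans _ _ (\int[mu]_x (\1_(F m) x)%:E)%E); last by rewrite integral_indic// setIT.
    rewrite le_eqVlt; apply/orP; left; apply/eqP; apply: eq_integral => x _ /=.
    by have /andP[c0 _] := chi01 x; rewrite ger0_norm.
  have [pc rpc] := res_ex HE k0 lchi.
  have pc01 := res_01 HE k0 lchi chi01 rpc.
  have lpc : l2 pc by apply: DL; case: rpc.
  apply: (@le_trans _ _ (ip chi ps)).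
    apply: ae_le_Rintegral; [exact: l2_integrable|exact: l2_integrable|].
    by apply: filterS g_ps => x gx; rewrite ler_wpM2l//; case/andP: (chi01 x).
  rewrite (res_sym HE k0 lchi ls rpc rps).
  apply: ae_le_Rintegral => //; first exact: l2_integrable.
  by apply: filterS pc01 => x /andP[_ h]; rewrite ler_piMl.
rewrite gI in main; rewrite sI aI bI in main.
have aE : \sum_i \int[mu]_x (a i x * pb i x) = \sum_i ip (pa i) (b i).
  by apply: eq_bigr => i _; exact: (res_sym HE k0 (la i) (lb i) (rpa i) (rpb i)).
have bE : \sum_i \int[mu]_x (b i x * pa i x) = \sum_i ip (pa i) (b i).
  by apply: eq_bigr => i _; rewrite (sip_sym HL (lpa i) (lb i)).
rewrite aE bE in main.
have -> : \sum_i ip (a i - pa i) (b i) =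
    \sum_i \int[mu]_x (a i x * b i x) - \sum_i ip (pa i) (b i).
  by rewrite -sumrB; apply: eq_bigr => i _; rewrite (sipBl HL).
lra.
Qed.

(** Positivity for the family enlarged by the pair [(- v, v)] compares the Yosida values of [v] with
    those of the pairs [(a i, b i)]. The latter stay bounded, so membership of [v] in [D] comes as a
    conclusion. *)
Theorem energy_contraction n (a b : 'I_n -> T -> R) (v : T -> R) (M : R) :
  (forall i, D (a i)) -> (forall i, D (b i)) ->
  (forall i x, `|a i x| <= M) -> (forall i x, `|b i x| <= M) ->
  l2 v -> (forall x, `|v x| <= M) ->
  (forall x y, (v x - v y) ^+ 2 <= \sum_i (a i x - a i y) * (b i x - b i y)) ->
  (forall x, v x ^+ 2 <= \sum_i a i x * b i x) ->
  D v /\ e v v <= \sum_i e (a i) (b i).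
Proof.
move=> Da Db aM bM lv vM pos s0.
have M0 : 0 <= M by apply: le_trans (vM point).
have la i := DL (Da i); have lb i := DL (Db i).
have ex f : l2 f -> {x : nat -> T -> R | forall m, is_resolvent m.+1%:R f (x m)}.
  move=> lf; apply/cid.
  have : forall m, exists x, is_resolvent (m.+1%:R : R) f x by move=> m; exact: (res_ex HE).
  by move/choice => [x hx]; exists x.
pose xa i := projT1 (ex _ (la i)); pose xb i := projT1 (ex _ (lb i)).
have rxa i m : is_resolvent m.+1%:R (a i) (xa i m) by exact: (projT2 (ex _ (la i))).
have rxb i m : is_resolvent m.+1%:R (b i) (xb i m) by exact: (projT2 (ex _ (lb i))).
have [xv rxv] := ex _ lv.
have lNv : l2 (- v) by exact: (sip_domN HL).
have rNv m : is_resolvent m.+1%:R (- v) (- xv m).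
  have := res_linear HE (-1) lv (sip_dom0 HL) (rxv m) (res_0 HE m.+1%:R).
  by rewrite !addr0 !scaleN1r.
have Dxv m : D (xv m) by case: (rxv m).
have Dxa i m : D (xa i m) by case: (rxa i m).
have key m : m.+1%:R * ip (v - xv m) v <= \sum_i m.+1%:R * ip (a i - xa i m) (b i).
  pose a' (i : 'I_n.+1) := if unlift ord0 i is Some j then a j else - v.
  pose b' (i : 'I_n.+1) := if unlift ord0 i is Some j then b j else v.
  pose xa' (i : 'I_n.+1) := if unlift ord0 i is Some j then xa j m else - xv m.
  pose xb' (i : 'I_n.+1) := if unlift ord0 i is Some j then xb j m else xv m.
  have : 0 <= \sum_i ip (a' i - xa' i) (b' i).
    apply: (@res_kernel m.+1%:R _ a' b' xa' xb' M) => //.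
    - by move=> i; rewrite /a'; case: unliftP => [j _|_].
    - by move=> i; rewrite /b'; case: unliftP => [j _|_].
    - move=> i x; rewrite /a'; case: unliftP => [j _|_] //.
      by rewrite [`|_|]normrN.
    - by move=> i x; rewrite /b'; case: unliftP => [j _|_].
    - by move=> i; rewrite /a' /xa'; case: unliftP => [j _|_].
    - by move=> i; rewrite /b' /xb'; case: unliftP => [j _|_].
    - move=> x y; rewrite big_ord_recl /a' /b' unlift_none.
      under eq_bigr do rewrite !liftK.
      have := pos x y.
      have -> : ((- v) x - (- v) y) * (v x - v y) = - (v x - v y) ^+ 2.
        by change ((- v x - - v y) * (v x - v y) = - (v x - v y) ^+ 2); ring.
      lra.
    - move=> x; rewrite big_ord_recl /a' /b' unlift_none.
      under eq_bigr do rewrite !liftK.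
      have := s0 x.
      have -> : (- v) x * v x = - v x ^+ 2.
        by change (- v x * v x = - v x ^+ 2); ring.
      lra.
  rewrite big_ord_recl /a' /b' /xa' unlift_none.
  under eq_bigr do rewrite !liftK.
  have lvx : l2 (v - xv m) by apply: (sip_domB HL) => //; exact: DL.
  have -> : ip (- v - - xv m) v = - ip (v - xv m) v.
    by rewrite -opprD (sipNl HL).
  rewrite -mulr_sumr => h; rewrite ler_wpM2l//; lra.
(* Cauchy-Schwarz for [e (xa i m) (b i)], where the energy of [xa i m] is at most that of [a i]. *)
have bnd i m : m.+1%:R * ip (a i - xa i m) (b i) <= nrm e (a i) * nrm e (b i).
  have [_ <-//] := rxa i m.
  apply: le_trans (ler_norm _) _; apply: le_trans (sip_CS HD (Dxa i m) (Db i)) _.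
  rewrite ler_wpM2r ?nrm_ge0//.
  have h1 := approx_le HL HD DL (la i) (rxa i) m (Da i).
  have h2 := approx_energy HL DL (la i) (rxa i) m.
  rewrite ler_sqrt ?(sip_ge0 HD)//; apply: le_trans h1; rewrite h2 lerDl.
  by rewrite mulr_ge0// (sip_ge0 HL)//; apply: (sip_domB HL) => //; exact: DL.
have [Dv ev _] : [/\ D v, ncvg e xv v & ncvg ip xv v].
  apply: (approx_dom HL HD DL (rd_closed HE) lv rxv) => m.
  by apply: le_trans (key m) _; apply: ler_sum => i _; exact: bnd.
split=> //.
have c1 : (fun m => e (xv m) v) @ \oo --> e v v by exact: (ncvg_cvg HD).
have c2 : (fun m => \sum_i e (xa i m) (b i)) @ \oo --> \sum_i e (a i) (b i).
  apply: (@cvg_sum_ord _ _ (fun i m => e (xa i m) (b i))) => i.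
  apply: (ncvg_cvg HD) => //.
  have [] : [/\ D (a i), ncvg e (xa i) (a i) & ncvg ip (xa i) (a i)].
    apply: (approx_dom HL HD DL (rd_closed HE) (la i) (rxa i)) => m.
    exact: (approx_le HL HD DL (la i) (rxa i) m (Da i)).
  by [].
apply: (ler_cvg_to c1 c2); apply: nearW => m.
have [_ h] := rxv m; rewrite h//.
by apply: le_trans (key m) _; apply: ler_sum => i _; have [_ ->] := rxa i m.
Qed.

End Kernel.

(** * Bounded elements of the form domain *)

Section ExpBounds.
Context (R : realType).
Implicit Types x y K M : R.

Lemma expR_lip x y M : `|x| <= M -> `|y| <= M ->
  `|expR x - expR y| <= expR M * `|x - y|.
Proof.
wlog yx : x y / y <= x => [h xM yM|xM yM].
  have [yx|/ltW xy] := leP y x; first exact: h.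
  by rewrite distrC [`|x - y|]distrC; exact: h.
rewrite !ger0_norm ?subr_ge0 ?ler_expR//.
have h := expR_ge1Dx (y - x).
have h2 : expR y = expR x * expR (y - x) by rewrite -expRD; congr expR; ring.
have h3 : expR x <= expR M by rewrite ler_expR; apply: le_trans xM; exact: ler_norm.
have h4 := expR_gt0 x.
apply: (@le_trans _ _ (expR x * (x - y))); last first.
  by rewrite ler_wpM2r// subr_ge0.
rewrite h2; nra.
Qed.

(** For [x >= 0] the left side is e^(-x) (e^x - 1)^2 <= x^2 e^x <= x^2 + K x^3 with [K = expR X].
    The cubic term is split into x^2 and x^4 by completing a square, because only even moments of
    the jumps can be expressed through the form. *)
Lemma cosh_bound x X a : `|x| <= X -> 0 < a ->
  expR x + expR (- x) - 2 <= (1 + a) * x ^+ 2 + expR X ^+ 2 / (4 * a) * x ^+ 4.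
Proof.
wlog x0 : x / 0 <= x => [h xX a0|].
  have [x0|/ltW x0] := leP 0 x; first exact: h.
  have := h (- x); rewrite normrN opprK oppr_ge0 => /(_ x0 xX a0).
  have -> : (- x) ^+ 4 = x ^+ 4 by ring.
  by rewrite sqrrN [expR (- x) + _]addrC.
rewrite ger0_norm// => xX a0.
set K := expR X; have K0 : 0 < K by exact: expR_gt0.
have eK : expR x <= K by rewrite ler_expR.
have e0 := expR_gt0 x.
have eN : expR x * expR (- x) = 1 by rewrite -expRD subrr expR0.
have e1 : expR x - 1 <= x * expR x.
  have := expR_ge1Dx (- x); nra.
have e2 := expR_ge1Dx x.
have h1 : expR x + expR (- x) - 2 = expR (- x) * (expR x - 1) ^+ 2.
  by rewrite sqrrB expr2 !mulrDr mulrN mulrA [expR (- x) * expR x]mulrC eN; lra.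
have h2 : expR x + expR (- x) - 2 <= x ^+ 2 * expR x.
  rewrite h1.
  have : (expR x - 1) ^+ 2 <= (x * expR x) ^+ 2.
    by rewrite ler_sqr ?nnegrE ?mulr_ge0 ?(ltW e0)//; lra.
  move=> h; apply: (@le_trans _ _ (expR (- x) * (x * expR x) ^+ 2)).
    by rewrite ler_wpM2l// expR_ge0.
  have -> : expR (- x) * (x * expR x) ^+ 2 = x ^+ 2 * expR x * (expR x * expR (- x)).
    by ring.
  by rewrite eN mulr1.
apply: le_trans h2 _.
have h3 : x ^+ 2 * expR x <= x ^+ 2 + K * x ^+ 3.
  have h : expR x <= 1 + x * K by nra.
  have := sqr_ge0 x; nra.
apply: le_trans h3 _.
have -> : (1 + a) * x ^+ 2 + K ^+ 2 / (4 * a) * x ^+ 4 =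
  x ^+ 2 + K * x ^+ 3 + (2 * a * x - K * x ^+ 2) ^+ 2 / (4 * a).
  by field; rewrite gt_eqF.
by rewrite lerDl divr_ge0 ?sqr_ge0//; lra.
Qed.

End ExpBounds.

Lemma funZE (T : Type) (R : realType) (c : R) (f : T -> R) x :
  (c *: f) x = c * f x.
Proof. by []. Qed.

Lemma funME (T : Type) (R : realType) (f g : T -> R) x : (f * g) x = f x * g x.
Proof. by []. Qed.

Definition bnd (T : Type) (R : realType) (f : T -> R) := exists M, forall x, `|f x| <= M.

Section Bnd.
Context (T : Type) (R : realType).
Implicit Types f g : T -> R.

Lemma bndD f g : bnd f -> bnd g -> bnd (f + g).
Proof.
move=> [M fM] [N gN]; exists (M + N) => x.
by apply: le_trans (ler_normD _ _) _; exact: lerD.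
Qed.

Lemma bndZ c f : bnd f -> bnd (c *: f).
Proof.
by move=> [M fM]; exists (`|c| * M) => x; rewrite [`|_|]normrM ler_wpM2l.
Qed.

Lemma bnd_all n (a : 'I_n -> T -> R) : (forall i, bnd (a i)) ->
  exists M, forall i x, `|a i x| <= M.
Proof.
move=> /choice[M hM]; exists (\sum_i `|M i|) => i x.
apply: le_trans (hM i x) _; apply: le_trans (ler_norm _) _.
by rewrite (bigD1 i)//= lerDl sumr_ge0.
Qed.

End Bnd.

Section BoundedDomain.
Context d (T : measurableType d) (R : realType).
Variable mu : {measure set T -> \bar R}.
Context (D : set (T -> R)) (e : (T -> R) -> (T -> R) -> R).
Hypothesis HE : real_dirichlet mu D e.
Hypothesis sfin : sigma_finite setT mu.
Local Notation ip := (ip mu).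
Local Notation l2 := (l2 mu).
Implicit Types u v w f psi : T -> R.

Let HD : sip D e := rd_sip HE.
Let HL : sip l2 ip := sip_l2 mu.
Let DL : D `<=` l2 := rd_l2 HE.

(** Bounded everywhere, not just almost everywhere: the positivity hypotheses are checked at all
    pairs of points. *)
Definition Db u := D u /\ bnd u.

Lemma Db_measurable u : Db u -> measurable_fun setT u.
Proof. by move=> [Du _]; exact: l2_measurable (DL Du). Qed.

Lemma DbP (c : R) u v : Db u -> Db v -> Db (c *: u + v).
Proof.
move=> [Du bu] [Dv bv]; split; first exact: (sip_domP HD).
by apply: bndD => //; exact: bndZ.
Qed.

Lemma Db0 : Db 0.
Proof. by split; [exact: (sip_dom0 HD)|exists 0 => x; rewrite normr0]. Qed.

Lemma DbZ (c : R) u : Db u -> Db (c *: u).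
Proof. by move=> Du; rewrite -[_ *: _]addr0; apply: DbP => //; exact: Db0. Qed.

Lemma Db_contraction n (a b : 'I_n -> T -> R) v :
  (forall i, Db (a i)) -> (forall i, Db (b i)) -> measurable_fun setT v ->
  (forall x y, (v x - v y) ^+ 2 <= \sum_i (a i x - a i y) * (b i x - b i y)) ->
  (forall x, v x ^+ 2 <= \sum_i a i x * b i x) ->
  Db v /\ e v v <= \sum_i e (a i) (b i).
Proof.
move=> Da Db_ mv pos s0.
have [M1 aM] := bnd_all (fun i => (Da i).2).
have [M2 bM] := bnd_all (fun i => (Db_ i).2).
have lv : l2 v.
  apply/l2P; split => //.
  have [iS _] := Rintegral_sum (fun i => l2_integrable (DL (Da i).1) (DL (Db_ i).1)).
  apply: le_integrable iS => //.
    by apply/measurable_EFinP; exact: measurable_funX.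
  move=> x _ /=; rewrite lee_fin ger0_norm ?sqr_ge0//.
  by apply: le_trans (s0 x) _; rewrite sum_funE ler_norm.
pose K := n%:R * (`|M1| * `|M2|) + 1.
have K1 : 1 <= K by rewrite /K lerDr mulr_ge0// mulr_ge0.
have vK x : `|v x| <= K.
  have : v x ^+ 2 <= K.
    apply: le_trans (s0 x) _; apply: (@le_trans _ _ (n%:R * (`|M1| * `|M2|))); last by rewrite lerDl.
    rewrite mulr_natl -[n in leRHS]card_ord -sumr_const; apply: ler_sum => i _.
    apply: le_trans (ler_norm _) _; rewrite normrM; apply: ler_pM => //.
    - by apply: le_trans (aM i x) _; exact: ler_norm.
    - by apply: le_trans (bM i x) _; exact: ler_norm.
  rewrite -(real_normK (num_real (v x))) => h.
  rewrite leNgt; apply/negP => h2; nra.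
pose M := `|M1| + `|M2| + K.
have [Dv ev] := @energy_contraction _ _ _ mu D e HE sfin n a b v M
  (fun i => (Da i).1) (fun i => (Db_ i).1)
  ltac:(by move=> i x; apply: le_trans (aM i x) _; have := ler_norm M1;
        have := normr_ge0 M2; rewrite /M; lra)
  ltac:(by move=> i x; apply: le_trans (bM i x) _; have := ler_norm M2;
        have := normr_ge0 M1; rewrite /M; lra)
  lv
  ltac:(by move=> x; apply: le_trans (vK x) _; have := normr_ge0 M2;
        have := normr_ge0 M1; rewrite /M; lra) pos s0.
by split=> //; split=> //; exists K.
Qed.

Lemma Db_nonneg n (a b : 'I_n -> T -> R) :
  (forall i, Db (a i)) -> (forall i, Db (b i)) ->
  (forall x y, 0 <= \sum_i (a i x - a i y) * (b i x - b i y)) ->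
  (forall x, 0 <= \sum_i a i x * b i x) ->
  0 <= \sum_i e (a i) (b i).
Proof.
move=> Da Db_ pos s0.
have [|x y|x|_] := @Db_contraction n a b 0 Da Db_.
- exact: measurable_cst.
- by rewrite subrr expr0n; exact: pos.
- by rewrite expr0n; exact: s0.
- by rewrite (sip0l HD)//; exact: (sip_dom0 HD).
Qed.

Lemma Db_contraction2 (C : R) u v w : 0 <= C -> Db u -> Db v ->
  measurable_fun setT w ->
  (forall x y, (w x - w y) ^+ 2 <= C * ((u x - u y) ^+ 2 + (v x - v y) ^+ 2)) ->
  (forall x, w x ^+ 2 <= C * (u x ^+ 2 + v x ^+ 2)) -> Db w.
Proof.
move=> C0 Du Dv mw h1 h2.
pose a (i : 'I_2) := nth 0 [:: C *: u; C *: v] i.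
pose b (i : 'I_2) := nth 0 [:: u; v] i.
suff [] : Db w /\ e w w <= \sum_i e (a i) (b i) by [].
apply: Db_contraction => //.
- by case=> -[|[|m]] // hm; exact: DbZ.
- by case=> -[|[|m]] // hm.
- move=> x y; rewrite !big_ord_recl big_ord0 addr0 /a /b /=.
  apply: le_trans (h1 x y) _.
  rewrite -[(C *: u) x]/(C * u x) -[(C *: v) x]/(C * v x).
  rewrite -[(C *: u) y]/(C * u y) -[(C *: v) y]/(C * v y).
  by lra.
- move=> x; rewrite !big_ord_recl big_ord0 addr0 /a /b /=.
  apply: le_trans (h2 x) _.
  rewrite -[(C *: u) x]/(C * u x) -[(C *: v) x]/(C * v x).
  by lra.
Qed.

(** From u(x) v(x) - u(y) v(y) = u(x) (v(x) - v(y)) + v(y) (u(x) - u(y)) and the bounds [M], [N],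
    which explain the factor [C]. *)
Lemma DbM u v : Db u -> Db v -> Db (u * v).
Proof.
move=> Du Dv; have [M uM] := Du.2; have [N vN] := Dv.2.
pose C := 2 * (M ^+ 2 + N ^+ 2).
have M2 := sqr_ge0 M; have N2 := sqr_ge0 N.
have sqM x : u x ^+ 2 <= M ^+ 2.
  by rewrite -(real_normK (num_real (u x))) ler_sqr ?nnegrE// (le_trans _ (uM x)).
have sqN x : v x ^+ 2 <= N ^+ 2.
  by rewrite -(real_normK (num_real (v x))) ler_sqr ?nnegrE// (le_trans _ (vN x)).
apply: (@Db_contraction2 C _ _ _ _ Du Dv).
- by rewrite mulr_ge0// addr_ge0.
- by apply: measurable_funM; exact: Db_measurable.
- move=> x y; rewrite -[(u * v) x]/(u x * v x) -[(u * v) y]/(u y * v y).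
  have h : (u x * v x - u y * v y) ^+ 2 <=
    2 * (u x ^+ 2 * (v x - v y) ^+ 2) + 2 * (v y ^+ 2 * (u x - u y) ^+ 2).
    have := sqr_ge0 (u x * (v x - v y) - v y * (u x - u y)); lra.
  have := sqr_ge0 (v x - v y); have := sqr_ge0 (u x - u y).
  have := sqM x; have := sqN y; rewrite /C; move: h.
  move: ((u x - u y) ^+ 2) ((v x - v y) ^+ 2) (u x ^+ 2) (v y ^+ 2) (M ^+ 2) (N ^+ 2) M2 N2.
  move=> a b c q m n m0 n0 h q_n c_m a0 b0.
  have : c * b <= m * b by rewrite ler_wpM2r.
  have : q * a <= n * a by rewrite ler_wpM2r.
  have : 0 <= m * a by rewrite mulr_ge0.
  have : 0 <= n * b by rewrite mulr_ge0.
  lra.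
- move=> x; rewrite -[(u * v) x]/(u x * v x) exprMn.
  have := sqM x; have := sqN x; rewrite /C; have := sqr_ge0 (v x); have := sqr_ge0 (u x).
  move: (v x ^+ 2) (u x ^+ 2) (M ^+ 2) (N ^+ 2) M2 N2 => a b m n; nra.
Qed.

Definition wexp (c : R) psi : T -> R := fun x => expR (c * psi x).

Lemma wexp_measurable c psi : measurable_fun setT psi ->
  measurable_fun setT (wexp c psi).
Proof.
move=> mpsi; apply: (measurableT_comp (@measurable_expR R)).
exact: measurable_funM.
Qed.

Lemma wexp_bnd c psi M x : (forall x, `|psi x| <= M) ->
  `|wexp c psi x| <= expR (`|c| * M).
Proof.
move=> pM; rewrite ger0_norm ?expR_ge0// ler_expR.
by apply: le_trans (ler_norm _) _; rewrite normrM ler_wpM2l.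
Qed.

Lemma wexp_lip c psi M x y : (forall x, `|psi x| <= M) ->
  (wexp c psi x - wexp c psi y) ^+ 2 <=
  (expR (`|c| * M) ^+ 2 * c ^+ 2) * (psi x - psi y) ^+ 2.
Proof.
move=> pM.
have h z : `|c * psi z| <= `|c| * M by rewrite normrM ler_wpM2l.
have := expR_lip (h x) (h y); rewrite -mulrBr => h2.
rewrite -mulrA -!exprMn -(real_normK (num_real (_ - _))).
rewrite -[leRHS]real_normK ?num_real// ler_sqr ?nnegrE//.
by apply: le_trans h2 _; rewrite [leRHS]normrM (ger0_norm (expR_ge0 _)).
Qed.

(** The weight alone need not be square integrable, so only its products with elements of the domain
    are considered. It is a Lipschitz function of the bounded [psi], so the product is controlled by
    [u] and [psi]. *)
Lemma DbWexp c psi u : Db psi -> Db u -> Db (wexp c psi * u).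
Proof.
move=> Dpsi Du; have [M pM] := Dpsi.2; have [N uN] := Du.2.
pose K := expR (`|c| * M); have K0 : 0 <= K ^+ 2 by exact: sqr_ge0.
pose C := 2 * K ^+ 2 * (1 + N ^+ 2 * c ^+ 2).
have N2 := sqr_ge0 N; have c2 := sqr_ge0 c.
have Nc : 0 <= N ^+ 2 * c ^+ 2 by rewrite mulr_ge0.
have K1 : 0 <= K ^+ 2 * (N ^+ 2 * c ^+ 2) by rewrite mulr_ge0.
have sqN x : u x ^+ 2 <= N ^+ 2.
  by rewrite -(real_normK (num_real (u x))) ler_sqr ?nnegrE// (le_trans _ (uN x)).
have sqW x : wexp c psi x ^+ 2 <= K ^+ 2.
  rewrite -(real_normK (num_real (wexp c psi x))) ler_sqr ?nnegrE ?expR_ge0//.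
  exact: wexp_bnd.
apply: (@Db_contraction2 C _ _ _ _ Du Dpsi).
- by rewrite /C; nra.
- apply: measurable_funM; last exact: Db_measurable.
  by apply: wexp_measurable; exact: Db_measurable.
- move=> x y; have := wexp_lip c x y pM; rewrite -/K.
  rewrite -[(wexp c psi * u) x]/(wexp c psi x * u x).
  rewrite -[(wexp c psi * u) y]/(wexp c psi y * u y).
  move: (sqW x) (sqN y); move: (wexp c psi x) (wexp c psi y) => w w' hw hu hww.
  have h : (w * u x - w' * u y) ^+ 2 <=
     2 * (w ^+ 2 * (u x - u y) ^+ 2) + 2 * (u y ^+ 2 * (w - w') ^+ 2).
    have := sqr_ge0 (w * (u x - u y) - u y * (w - w')); lra.
  apply: le_trans h _.
  have h1 : w ^+ 2 * (u x - u y) ^+ 2 <= K ^+ 2 * (u x - u y) ^+ 2.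
    by rewrite ler_wpM2r// sqr_ge0.
  have h2 : u y ^+ 2 * (w - w') ^+ 2 <= N ^+ 2 * ((K ^+ 2 * c ^+ 2) * (psi x - psi y) ^+ 2).
    by rewrite ler_pM// sqr_ge0.
  have h3 : 0 <= K ^+ 2 * (N ^+ 2 * c ^+ 2) * (u x - u y) ^+ 2.
    by rewrite mulr_ge0// sqr_ge0.
  have h4 : 0 <= K ^+ 2 * (psi x - psi y) ^+ 2.
    by rewrite mulr_ge0// sqr_ge0.
  by rewrite /C; lra.
- move=> x; rewrite -[(wexp c psi * u) x]/(wexp c psi x * u x) exprMn.
  have := sqW x; have := sqr_ge0 (u x); have := sqr_ge0 (psi x); rewrite /C.
  move: (wexp _ _ _ ^+ 2) (u x ^+ 2) (psi x ^+ 2) => w a p p0 a0 wK.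
  have h1 : w * a <= K ^+ 2 * a by rewrite ler_wpM2r.
  have h2 : 0 <= K ^+ 2 * (N ^+ 2 * c ^+ 2) * a by rewrite mulr_ge0.
  have h3 : 0 <= K ^+ 2 * (N ^+ 2 * c ^+ 2) * p by rewrite mulr_ge0.
  have h4 : 0 <= K ^+ 2 * a by rewrite mulr_ge0.
  have h5 : 0 <= K ^+ 2 * p by rewrite mulr_ge0.
  lra.
Qed.

(* The form [I_psi (f)] of the paper, for real functions. *)
Definition Iform psi f := e (psi * f) psi - 2^-1 * e (psi * psi) f.

(** The increments of the product split into those of [u], giving [e u u], and those of the weight.
    As the latter are Lipschitz in [psi], they are absorbed by [Iform psi (u * u)]. No energy of
    [psi] appears, so the bound does not see the extension chosen for [psi]. *)
Lemma energy_wexp c psi u M : Db psi -> Db u -> (forall x, `|psi x| <= M) ->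
  e (wexp c psi * u) (wexp c psi * u) <=
  2 * expR (`|c| * M) ^+ 2 * e u u +
  2 * (expR (`|c| * M) ^+ 2 * c ^+ 2) * Iform psi (u * u).
Proof.
move=> Dpsi Du pM; have Duu := DbM Du Du.
set K := expR _; have K0 : 0 <= K ^+ 2 by exact: sqr_ge0.
have c2 := sqr_ge0 c; have Kc : 0 <= K ^+ 2 * c ^+ 2 by rewrite mulr_ge0.
pose C := 2 * (K ^+ 2 * c ^+ 2).
have sqW x : wexp c psi x ^+ 2 <= K ^+ 2.
  rewrite -(real_normK (num_real (wexp c psi x))) ler_sqr ?nnegrE ?expR_ge0//.
  exact: wexp_bnd.
have Dpu := DbM Dpsi Duu; have Dpp := DbM Dpsi Dpsi.
pose a (i : 'I_3) := nth 0 [:: (2 * K ^+ 2) *: u; C *: (psi * (u * u));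
  (- (2^-1 * C)) *: (psi * psi)] i.
pose b (i : 'I_3) := nth 0 [:: u; psi; u * u] i.
have [] : Db (wexp c psi * u) /\
    e (wexp c psi * u) (wexp c psi * u) <= \sum_i e (a i) (b i).
  apply: Db_contraction.
  - by case=> -[|[|[|m]]] // hm; exact: DbZ.
  - by case=> -[|[|[|m]]] // hm.
  - exact: Db_measurable (DbWexp c Dpsi Du).
  - move=> x y; rewrite !big_ord_recl big_ord0 addr0 /a /b /=.
    rewrite !funZE !funME.
    have := wexp_lip c x y pM; rewrite -/K.
    move: (sqW x) (sqW y); rewrite /C.
    move: (wexp c psi x) (wexp c psi y) (u x) (u y) (psi x) (psi y).
    move=> w w' s t p q hw hw' hww.
    (* Symmetric Leibniz rule: [w * s - w' * t] is half the sum of [(w + w') * (s - t)] and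
       [(w - w') * (s + t)]. The factor [s ^+ 2 + t ^+ 2] is the one in the integrand of [Iform]. *)
    have h : (w * s - w' * t) ^+ 2 <=
      (w ^+ 2 + w' ^+ 2) * (s - t) ^+ 2 + (s ^+ 2 + t ^+ 2) * (w - w') ^+ 2.
      have E : (w * s - w' * t) ^+ 2 =
        2^-1 * ((w + w') * (s - t)) ^+ 2 + 2^-1 * ((w - w') * (s + t)) ^+ 2
        - (2^-1 * ((w + w') * (s - t)) - 2^-1 * ((w - w') * (s + t))) ^+ 2 by field.
      rewrite E !exprMn.
      have h1 := sqr_ge0 (2^-1 * ((w + w') * (s - t)) - 2^-1 * ((w - w') * (s + t))).
      have h2 : (w + w') ^+ 2 * (s - t) ^+ 2 <= 2 * (w ^+ 2 + w' ^+ 2) * (s - t) ^+ 2.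
        by rewrite ler_wpM2r ?sqr_ge0//; have := sqr_ge0 (w - w'); lra.
      have h3 : (s + t) ^+ 2 * (w - w') ^+ 2 <= 2 * (s ^+ 2 + t ^+ 2) * (w - w') ^+ 2.
        by rewrite ler_wpM2r ?sqr_ge0//; have := sqr_ge0 (s - t); lra.
      lra.
    have h1 : (w ^+ 2 + w' ^+ 2) * (s - t) ^+ 2 <= (2 * K ^+ 2) * (s - t) ^+ 2.
      by rewrite ler_wpM2r ?sqr_ge0//; lra.
    have h2 : (s ^+ 2 + t ^+ 2) * (w - w') ^+ 2 <=
        (s ^+ 2 + t ^+ 2) * ((K ^+ 2 * c ^+ 2) * (p - q) ^+ 2).
      by rewrite ler_wpM2l// addr_ge0// sqr_ge0.
    apply: le_trans h _; apply: le_trans (lerD h1 h2) _.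
    by rewrite le_eqVlt; apply/orP; left; apply/eqP; field.
  - move=> x; rewrite !big_ord_recl big_ord0 addr0 /a /b /=.
    rewrite !funZE !funME /C.
    move: (sqW x); move: (wexp c psi x) (u x) (psi x) => w s p hw.
    have h1 : w ^+ 2 * s ^+ 2 <= K ^+ 2 * s ^+ 2 by rewrite ler_wpM2r ?sqr_ge0.
    have h2 : 0 <= K ^+ 2 * s ^+ 2 by rewrite mulr_ge0 ?sqr_ge0.
    have h3 : 0 <= K ^+ 2 * c ^+ 2 * (p ^+ 2 * s ^+ 2).
      by apply: mulr_ge0 => //; apply: mulr_ge0; exact: sqr_ge0.
    rewrite exprMn; lra.
move=> _; rewrite !big_ord_recl big_ord0 addr0 /a /b /= !(sipZl HD).
- by rewrite /Iform /C => h; apply: le_trans h _; lra.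
all: by [case: Dpp|case: Duu|case: Dpu|case: Dpsi|case: Du].
Qed.

End BoundedDomain.

(** * Consequences of locality *)

Lemma split_lshift m n (i : 'I_m) : fintype.split (lshift n i) = inl i.
Proof. exact: (unsplitK (inl i)). Qed.

Lemma split_rshift m n (i : 'I_n) : fintype.split (rshift m i) = inr i.
Proof. exact: (unsplitK (inr i)). Qed.

Section Slices.
Context (R : realType) (M : R) (N : nat).
Implicit Types s t : R.

(** The [N + N] slices of height [M / N] cover [[- M, M]]. Their even number puts a level exactly at
    zero, so no slice contains zero in its interior. *)
Definition level (k : nat) : R := - M + k%:R * (M / N%:R).
Definition slice (k : nat) s : R := Num.min s (level k.+1) - Num.min s (level k).

Hypotheses (M0 : 0 < M) (N0 : (0 < N)%N).
Let eps : R := M / N%:R.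
Let eps0 : 0 < eps. Proof. by rewrite divr_gt0// ltr0n. Qed.

Lemma levelS k : level k.+1 = level k + M / N%:R.
Proof. by rewrite /level -[k.+1]addn1 natrD; ring. Qed.

Lemma level_le j k : (j <= k)%N -> level j <= level k.
Proof. by move=> jk; rewrite lerD2l ler_wpM2r ?ler_nat// ltW. Qed.

Lemma level_mid : level N = 0.
Proof. by rewrite /level mulrC divfK ?addNr// pnatr_eq0 -lt0n. Qed.

Lemma level_last : level (N + N) = M.
Proof.
rewrite /level natrD mulrDl mulrC divfK ?pnatr_eq0 -?lt0n//.
by rewrite addrA addNr add0r.
Qed.

Lemma slice_incr k s t : t <= s -> 0 <= slice k s - slice k t <= M / N%:R.
Proof.
rewrite /slice levelS; have := eps0; rewrite /eps; move: (M / N%:R) (level k) => a l a0 ts.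
rewrite /Num.min; do 4 case: ltP => ?; apply/andP; split; lra.
Qed.

Lemma slice_le k s t : t <= s -> slice k s - slice k t <= s - t.
Proof.
rewrite /slice levelS; have := eps0; rewrite /eps; move: (M / N%:R) (level k) => a l a0 ts.
rewrite /Num.min; do 4 case: ltP => ?; lra.
Qed.

Lemma slice_above k s : level k.+1 <= s -> slice k s = M / N%:R.
Proof.
rewrite /slice levelS; have := eps0; rewrite /eps; move: (M / N%:R) (level k) => a l a0 ls.
by rewrite /Num.min; do 2 case: ltP => ?; lra.
Qed.

Lemma slice_below k s : s <= level k -> slice k s = 0.
Proof.
rewrite /slice levelS; have := eps0; rewrite /eps; move: (M / N%:R) (level k) => a l a0 ls.
by rewrite /Num.min; do 2 case: ltP => ?; lra.
Qed.

Lemma slice_sum s : - M <= s <= M -> \sum_(k < N + N) slice k s = s + M.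
Proof.
move=> /andP[Ms sM].
rewrite -(big_mkord xpredT (fun k => slice k s)).
rewrite (telescope_sumr (fun k => Num.min s (level k)))//.
rewrite level_last min_l// min_r; first by rewrite /level mul0r addr0 opprK.
by rewrite /level mul0r addr0.
Qed.

(** Let x = |s - t| and let S be the sum of the squared slice increments. Then x^4 = x^2 (x^2 - S) +
    x^2 S, with x <= 2 M, S <= x^2 and S <= (M / N) x. By locality x^2 - S will contribute nothing
    to the energy, and the last term tends to zero with the mesh. *)
Lemma slice_quartic s t : - M <= s <= M -> - M <= t <= M ->
  (s - t) ^+ 4 <= 4 * M ^+ 2 * ((s - t) ^+ 2 -
      \sum_(k < N + N) (slice k s - slice k t) ^+ 2)
    + 2 * M * (M / N%:R) * (s - t) ^+ 2.
Proof.
wlog ts : s t / t <= s => [h sM tM|sM tM].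
  have [ts|/ltW st] := leP t s; first exact: h.
  have := h _ _ st tM sM.
  have -> : (t - s) ^+ 4 = (s - t) ^+ 4 by ring.
  rewrite -(sqrrN (t - s)) opprB.
  by under eq_bigr do rewrite -sqrrN opprB.
have sumE : \sum_(k < N + N) (slice k s - slice k t) = s - t.
  by rewrite sumrB !slice_sum//; ring.
set S := \sum_(k < _) (_ ^+ 2).
have S1 : S <= (M / N%:R) * (s - t).
  rewrite -sumE mulr_sumr; apply: ler_sum => k _.
  by have /andP[h1 h2] := slice_incr k ts; rewrite expr2 ler_wpM2r.
have S2 : S <= (s - t) ^+ 2.
  rewrite expr2 -[X in _ * X]sumE mulr_sumr; apply: ler_sum => k _.
  by have /andP[h1 h2] := slice_incr k ts; rewrite expr2 ler_wpM2r ?slice_le.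
move/andP: sM => [s1 s2]; move/andP: tM => [t1 t2].
have := eps0; rewrite /eps; move: (M / N%:R) S S1 S2 => a S S1 S2 a0.
have d0 : 0 <= s - t by rewrite subr_ge0.
have dM : s - t <= 2 * M by lra.
move: (s - t) d0 dM S1 S2 => x x0 xM S1 S2.
have x4 : x ^+ 2 <= 4 * M ^+ 2 by nra.
have h1 : x ^+ 2 * (x ^+ 2 - S) <= 4 * M ^+ 2 * (x ^+ 2 - S).
  by rewrite ler_wpM2r// subr_ge0.
have h2 : x ^+ 2 * S <= x ^+ 2 * (a * x) by rewrite ler_wpM2l ?sqr_ge0.
have h3 : (x ^+ 2 * a) * x <= (x ^+ 2 * a) * (2 * M).
  by rewrite ler_wpM2l// mulr_ge0 ?sqr_ge0// ltW.
have -> : x ^+ 4 = x ^+ 2 * (x ^+ 2 - S) + x ^+ 2 * S by ring.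
by apply: le_trans (lerD h1 h2) _; lra.
Qed.

End Slices.

Section Local.
Context d (T : measurableType d) (R : realType).
Variable mu : {measure set T -> \bar R}.
Context (D : set (T -> R)) (e : (T -> R) -> (T -> R) -> R).
Hypothesis HE : real_dirichlet mu D e.
Hypothesis sfin : sigma_finite setT mu.
Hypothesis loc : forall f g (a : R), D f -> D g ->
  {ae mu, forall x, (f x + a) * g x = 0} -> e g f = 0.
Local Notation Db := (Db D).
Local Notation Iform := (Iform e).
Implicit Types u v w f psi : T -> R.

Let HD : sip D e := rd_sip HE.

(** Each [p k] is a slice shifted to vanish where [psi] does, which keeps it in the domain. Of two
    slices, one is constant wherever the other is nonzero, so locality makes them orthogonal. *)
Lemma energy_slices psi (M : R) N : Db psi -> 0 < M -> (0 < N)%N ->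
  (forall x, `|psi x| <= M) ->
  let p (k : 'I_(N + N)) x := slice M N k (psi x) - slice M N k 0 in
  (forall k, Db (p k)) /\ e psi psi = \sum_k e (p k) (p k).
Proof.
move=> Dpsi M0 N0 pM p.
have Mp x : - M <= psi x <= M by rewrite -ler_norml.
have mp := Db_measurable HE Dpsi.
have Dp k : Db (p k).
  have := @Db_contraction2 _ _ _ mu D e HE sfin 1 psi psi (p k) ler01 Dpsi Dpsi; apply.
  - apply: measurable_funB => //.
    by apply: measurable_funB; apply: measurable_minr.
  - move=> x y; rewrite mul1r.
    have -> : p k x - p k y = slice M N k (psi x) - slice M N k (psi y).
      by rewrite /p; ring.
    have h0 := sqr_ge0 (psi x - psi y).
    have [yx|/ltW xy] := leP (psi y) (psi x).
      have /andP[h1 _] := slice_incr M0 N0 k yx.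
      have := slice_le M0 N0 k yx; nra.
    have /andP[h1 _] := slice_incr M0 N0 k xy.
    have := slice_le M0 N0 k xy; nra.
  - move=> x; rewrite mul1r /p; have h0 := sqr_ge0 (psi x).
    have [yx|/ltW xy] := leP 0 (psi x).
      have /andP[h1 _] := slice_incr M0 N0 k yx.
      have := slice_le M0 N0 k yx; nra.
    have /andP[h1 _] := slice_incr M0 N0 k xy.
    have := slice_le M0 N0 k xy; nra.
split=> //.
have orth (j k : 'I_(N + N)) : (j < k)%N -> e (p j) (p k) = 0.
  move=> jk; have [Nk|kN] := leqP N k.
    (* Slice above zero: where [p k] is nonzero, [psi] exceeds the whole slice [j] and [p j] is
       constant. *)
    rewrite (sip_sym HD (Dp j).1 (Dp k).1).
    apply: (loc (a := - (M / N%:R - slice M N j 0))); [exact: (Dp _).1|exact: (Dp _).1|].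
    apply: aeW => x.
    have l0 : 0 <= level M N k by rewrite -(level_mid M N0) level_le.
    have [h|h] := leP (psi x) (level M N k).
      by rewrite /p (slice_below M0 N0 h) (slice_below M0 N0 l0) subrr mulr0.
    have h2 : level M N j.+1 <= psi x by apply: le_trans (ltW h); exact: level_le.
    by rewrite /p (slice_above M0 N0 h2) subrr mul0r.
  (* Slice below zero: where [p j] is nonzero, [psi] lies below the slice [k] and [p k] is
     constant. *)
  apply: (loc (a := slice M N k 0)); [exact: (Dp _).1|exact: (Dp _).1|].
  apply: aeW => x.
  have l0 : level M N j.+1 <= 0.
    by rewrite -(level_mid M N0) level_le// (leq_trans jk)// ltnW.
  have [h|h] := leP (psi x) (level M N k).
    by rewrite /p (slice_below M0 N0 h) sub0r addNr mul0r.
  have h2 : level M N j.+1 <= psi x by apply: le_trans (ltW h); exact: level_le.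
  by rewrite /p (slice_above M0 N0 h2) (slice_above M0 N0 l0) subrr mulr0.
have psiE : psi = \sum_k p k.
  apply/funext => x; rewrite sum_funE sumrB !slice_sum//.
    by rewrite add0r addrK.
  by rewrite oppr_le0 ltW//= ltW.
rewrite {1 2}psiE (sip_suml HD); last 2 first.
- by move=> k; case: (Dp k).
- by apply: (sip_dom_sum HD) => k; case: (Dp k).
apply: eq_bigr => k _; have Dpk i := proj1 (Dp i).
rewrite (sip_sym HD)//; last exact: (sip_dom_sum HD).
rewrite (sip_suml HD)// (bigD1 k)//= big1 ?addr0// => j jk.
have [lt|lt|/val_inj E] := ltngtP j k; last by rewrite E eqxx in jk.
  exact: orth.
by rewrite (sip_sym HD)//; exact: orth.
Qed.

(** The coefficients come from 4 (s^3 - t^3) (s - t) - 3 (s^2 - t^2)^2 = (s - t)^4. *)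
Definition Qform psi := 4 * e (psi * psi * psi) psi - 3 * e (psi * psi) (psi * psi).

(* [Qform psi] is the fourth moment of the jumps of [psi]; slicing the range of
   [psi] into small pieces, whose energies add up by locality, kills it. *)
Lemma Qform_le0 psi : Db psi -> Qform psi <= 0.
Proof.
move=> Dpsi; have [M1 pM1] := Dpsi.2.
pose M := `|M1| + 1; have M0 : 0 < M by rewrite /M; have := normr_ge0 M1; lra.
have pM x : `|psi x| <= M.
  by apply: le_trans (pM1 x) _; have := ler_norm M1; rewrite /M; lra.
have Mp x : - M <= psi x <= M by rewrite -ler_norml.
have D2 := DbM HE sfin Dpsi Dpsi; have D3 := DbM HE sfin D2 Dpsi.
have main N : (0 < N)%N -> Qform psi <= 2 * M * (M / N%:R) * e psi psi.
  move=> N0.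
  pose p (k : 'I_(N + N)) x := slice M N k (psi x) - slice M N k 0.
  have [Dp eE] : (forall k, Db (p k)) /\ e psi psi = \sum_k e (p k) (p k).
    exact: energy_slices.
  (* The pairs realize the right side of [slice_quartic] minus its left side; by [energy_slices] the
     terms in [4 * M ^+ 2] cancel in the energy. *)
  pose a (i : 'I_(N + N + 3)) := match fintype.split i with
    | inl k => (- (4 * M ^+ 2)) *: p k
    | inr m => nth 0 [:: (4 * M ^+ 2 + 2 * M * (M / N%:R)) *: psi;
                  (- 4) *: (psi * psi * psi); 3 *: (psi * psi)] m end.
  pose b (i : 'I_(N + N + 3)) := match fintype.split i with
    | inl k => p k | inr m => nth 0 [:: psi; psi; psi * psi] m end.
  have : 0 <= \sum_i e (a i) (b i).
    have sumE (F : (T -> R) -> (T -> R) -> R) : \sum_i F (a i) (b i) =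
      \sum_k F ((- (4 * M ^+ 2)) *: p k) (p k) +
      (F ((4 * M ^+ 2 + 2 * M * (M / N%:R)) *: psi) psi +
      (F ((- 4) *: (psi * psi * psi)) psi + F (3 *: (psi * psi)) (psi * psi))).
      rewrite big_split_ord /=; congr (_ + _).
        by apply: eq_bigr => k _; rewrite /a /b split_lshift.
      by rewrite !big_ord_recl big_ord0 /= addr0 /a /b !split_rshift.
    apply: (Db_nonneg HE sfin).
    - move=> i; rewrite /a; case: fintype.split => [k|m]; first exact: (DbZ HE).
      by case: m => -[|[|[|m]]] // hm; exact: (DbZ HE).
    - move=> i; rewrite /b; case: fintype.split => [k|m]; first exact: Dp.
      by case: m => -[|[|[|m]]].
    - move=> x y; rewrite (sumE (fun f g => (f x - f y) * (g x - g y))).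
      have := slice_quartic M0 N0 (Mp x) (Mp y).
      rewrite !funZE !funME.
      have -> : \sum_(k < N + N) (((- (4 * M ^+ 2)) *: p k) x -
          ((- (4 * M ^+ 2)) *: p k) y) * (p k x - p k y) =
          - (4 * M ^+ 2) * \sum_(k < N + N)
            (slice M N k (psi x) - slice M N k (psi y)) ^+ 2.
        rewrite mulr_sumr; apply: eq_bigr => k _; rewrite !funZE /p; ring.
      set S := \sum_(k < _) _ => h.
      have -> : forall s t : R, - (4 * M ^+ 2) * S +
        (((4 * M ^+ 2 + 2 * M * (M / N%:R)) * s -
          (4 * M ^+ 2 + 2 * M * (M / N%:R)) * t) * (s - t) +
        ((- 4 * (s * s * s) - - 4 * (t * t * t)) * (s - t) +
         (3 * (s * s) - 3 * (t * t)) * (s * s - t * t))) =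
        4 * M ^+ 2 * ((s - t) ^+ 2 - S) + 2 * M * (M / N%:R) * (s - t) ^+ 2 -
          (s - t) ^+ 4.
        by move=> s t; move: (M / N%:R) => q; ring.
      by rewrite subr_ge0.
    - move=> x; rewrite (sumE (fun f g => f x * g x)).
      have M00 : - M <= 0 <= M by rewrite oppr_le0 ltW//= ltW.
      have := slice_quartic M0 N0 (Mp x) M00.
      rewrite !funZE !funME.
      have -> : \sum_(k < N + N) ((- (4 * M ^+ 2)) *: p k) x * p k x =
          - (4 * M ^+ 2) * \sum_(k < N + N)
            (slice M N k (psi x) - slice M N k 0) ^+ 2.
        rewrite mulr_sumr; apply: eq_bigr => k _; rewrite !funZE /p; ring.
      set S := \sum_(k < _) _ => h.
      have -> : forall s : R, - (4 * M ^+ 2) * S +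
        ((4 * M ^+ 2 + 2 * M * (M / N%:R)) * s * s +
        (- 4 * (s * s * s) * s + 3 * (s * s) * (s * s))) =
        4 * M ^+ 2 * ((s - 0) ^+ 2 - S) + 2 * M * (M / N%:R) * (s - 0) ^+ 2 -
          (s - 0) ^+ 4.
        by move=> s; move: (M / N%:R) => q; ring.
      by rewrite subr_ge0.
  rewrite big_split_ord /=.
  have -> : \sum_(k < N + N) e (a (lshift 3 k)) (b (lshift 3 k)) =
      - (4 * M ^+ 2) * e psi psi.
    rewrite eE mulr_sumr; apply: eq_bigr => k _; rewrite /a /b.
    by rewrite split_lshift; have [Dk _] := Dp k; rewrite (sipZl HD).
  rewrite !big_ord_recl big_ord0 /= addr0 /a /b !split_rshift /=.
  have [D1 _] := Dpsi; have [D2' _] := D2; have [D3' _] := D3.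
  rewrite !(sipZl HD)// /Qform; move: (M / N%:R) => q; lra.
apply/ler_addgt0Pr => ep ep0; rewrite add0r.
have e0 := sip_ge0 HD Dpsi.1.
have c0 : 0 < 2 * M ^+ 2 * e psi psi + 1.
  by rewrite ltr_wpDl// mulr_ge0// mulr_ge0// sqr_ge0.
have [N hN] := invS_small (divr_gt0 ep0 c0).
apply: le_trans (main N.+1 isT) _.
have := hN N (leqnn N); rewrite ltr_pdivlMr//.
have i0 : 0 < N.+1%:R^-1 :> R by rewrite invr_gt0.
move: (N.+1%:R^-1 : R) i0 => i i0; lra.
Qed.

(** [cosh_bound] leaves a quadratic term, which is the integrand of [Iform psi f], and a quartic one
    with weight [f]. Only the unweighted fourth moment is known to be nonpositive, so [f] is
    replaced there by its bound [B] before [Qform_le0] is used. *)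
Lemma energy_perturbation (r a : R) psi u : 0 < a -> Db psi -> Db u ->
  0 <= e u (wexp (2 * r) psi * u) +
    (1 + a) * r ^+ 2 * Iform psi (wexp (2 * r) psi * (u * u)).
Proof.
move=> a0 Dpsi Du; have [M pM] := Dpsi.2.
have Duu := DbM HE sfin Du Du.
set w2 := wexp (2 * r) psi.
have Dwu : Db (w2 * u) by exact: (DbWexp HE sfin).
set f := w2 * (u * u); have Df : Db f by exact: (DbWexp HE sfin).
have D2 := DbM HE sfin Dpsi Dpsi; have D3 := DbM HE sfin D2 Dpsi.
have Dpf := DbM HE sfin Dpsi Df.
have [B fB] := Df.2.
(* The constant of [cosh_bound], as [r * (psi x - psi y)] is at most [|r| * (2 * M)] in absolute
   value. *)
pose K := expR (`|r| * (2 * M)) ^+ 2 / (4 * a).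
have K0 : 0 <= K by rewrite divr_ge0 ?sqr_ge0//; lra.
have B0 : 0 <= B by apply: le_trans (fB point).
have r4 : 0 <= r ^+ 4 by rewrite exprn_even_ge0.
pose C := B * (K * r ^+ 4).
have C0 : 0 <= C by rewrite /C mulr_ge0// mulr_ge0.
pose k := (1 + a) * r ^+ 2.
have k0 : 0 <= k by rewrite /k mulr_ge0 ?sqr_ge0//; lra.
pose aa (i : 'I_5) := nth 0 [:: u; k *: (psi * f); (- (2^-1 * k)) *: (psi * psi);
  (4 * C) *: (psi * psi * psi); (- (3 * C)) *: (psi * psi)] i.
pose bb (i : 'I_5) := nth 0 [:: w2 * u; psi; f; psi; psi * psi] i.
have : 0 <= \sum_i e (aa i) (bb i).
  apply: (Db_nonneg HE sfin).
  - by case=> -[|[|[|[|[|m]]]]] // hm; exact: (DbZ HE).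
  - by case=> -[|[|[|[|[|m]]]]] //= hm.
  - move=> x y; rewrite !big_ord_recl big_ord0 addr0 /aa /bb /=.
    rewrite /f !funZE !funME.
    have fx : `|w2 x * (u x * u x)| <= B by exact: fB.
    have fy : `|w2 y * (u y * u y)| <= B by exact: fB.
    have w2E z : w2 z = expR (r * psi z) * expR (r * psi z).
      by rewrite -expRD; congr expR; ring.
    have wE : expR (r * psi x) = expR (r * psi y) * expR (r * (psi x - psi y)).
      by rewrite -expRD; congr expR; ring.
    have xM : `|r * (psi x - psi y)| <= `|r| * (2 * M).
      rewrite normrM ler_wpM2l//; apply: le_trans (ler_normB _ _) _.
      by have := pM x; have := pM y; lra.
    have := cosh_bound xM a0; rewrite -/K.
    have eN : expR (r * (psi x - psi y)) * expR (- (r * (psi x - psi y))) = 1.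
      by rewrite -expRD subrr expR0.
    move: fx fy; rewrite !w2E wE.
    have E0 := expR_gt0 (r * (psi x - psi y)).
    move: (expR (r * (psi x - psi y))) (expR (- (r * (psi x - psi y)))) E0 eN.
    move=> E F E0 EF; move: (expR (r * psi y)) => w.
    move: (u x) (u y) (psi x) (psi y) => s t p q.
    set V := w * E * s; set V' := w * t.
    move=> /(le_trans (ler_norm _)) fx /(le_trans (ler_norm _)) fy g.
    have g0 : 0 <= E + F - 2.
      have E2 : E * (E + F - 2) = (E - 1) ^+ 2.
        by rewrite mulrBr mulrDr EF; ring.
      by rewrite -(pmulr_rge0 _ E0) E2 sqr_ge0.
    (* [E] and [F] are the exponentials of plus and minus [r * (psi x - psi y)], so [E + F - 2] is
       the term 2 cosh - 2. *)
    have -> : (s - t) * (w * E * (w * E) * s - w * w * t) =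
        V ^+ 2 + V' ^+ 2 - V * V' * (E + F).
      have -> : V * V' * (E + F) = s * t * w * w * (E * E + E * F).
        by rewrite /V /V'; ring.
      by rewrite EF /V /V'; ring.
    have Vx : V ^+ 2 <= B by apply: le_trans fx; rewrite /V expr2; lra.
    have Vy : V' ^+ 2 <= B by apply: le_trans fy; rewrite /V' expr2; lra.
    have -> : w * E * (w * E) * (s * s) = V ^+ 2 by rewrite /V; ring.
    have -> : w * w * (t * t) = V' ^+ 2 by rewrite /V'; ring.
    clearbody V V'.
    have V20 := sqr_ge0 V; have V'20 := sqr_ge0 V'.
    have h1 : V * V' * (E + F - 2) <= 2^-1 * (V ^+ 2 + V' ^+ 2) * (E + F - 2).
      by rewrite ler_wpM2r//; have := sqr_ge0 (V - V'); lra.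
    have h2 : 2^-1 * (V ^+ 2 + V' ^+ 2) * (E + F - 2) <=
       2^-1 * (V ^+ 2 + V' ^+ 2) * ((1 + a) * (r * (p - q)) ^+ 2 + K * (r * (p - q)) ^+ 4).
      by rewrite ler_wpM2l//; lra.
    have h3 : 2^-1 * (V ^+ 2 + V' ^+ 2) * (K * (r * (p - q)) ^+ 4) <= C * (p - q) ^+ 4.
      have q0 : 0 <= K * (r ^+ 4 * (p - q) ^+ 4).
        by rewrite mulr_ge0// mulr_ge0// exprn_even_ge0.
      have -> : C * (p - q) ^+ 4 = B * (K * (r ^+ 4 * (p - q) ^+ 4)).
        by rewrite /C; ring.
      by rewrite exprMn ler_wpM2r//; lra.
    have h4 := sqr_ge0 (V - V').
    have -> : V ^+ 2 + V' ^+ 2 - V * V' * (E + F) +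
      ((k * (p * V ^+ 2) - k * (q * V' ^+ 2)) * (p - q) +
       ((- (2^-1 * k) * (p * p) - - (2^-1 * k) * (q * q)) * (V ^+ 2 - V' ^+ 2) +
        ((4 * C * (p * p * p) - 4 * C * (q * q * q)) * (p - q) +
         (- (3 * C) * (p * p) - - (3 * C) * (q * q)) * (p * p - q * q)))) =
      (V - V') ^+ 2 - V * V' * (E + F - 2) +
       2^-1 * (V ^+ 2 + V' ^+ 2) * ((1 + a) * (r * (p - q)) ^+ 2) + C * (p - q) ^+ 4.
      by rewrite /k; field.
    rewrite mulrDr in h2; lra.
  - move=> x; rewrite !big_ord_recl big_ord0 addr0 /aa /bb /=.
    rewrite /f !funZE !funME.
    have := expR_ge0 (2 * r * psi x); rewrite -[expR _]/(w2 x).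
    move: (w2 x) (u x) (psi x) => w s p w0.
    have h1 : 0 <= w * (s * s) by rewrite mulr_ge0// -expr2 sqr_ge0.
    have h2 : 0 <= k * (p * p * (w * (s * s))).
      by rewrite mulr_ge0// mulr_ge0// -expr2 sqr_ge0.
    have h3 : 0 <= C * (p * p * (p * p)).
      by rewrite mulr_ge0// mulr_ge0// -expr2 sqr_ge0.
    lra.
rewrite !big_ord_recl big_ord0 addr0 /aa /bb /=.
have [d1 _] := Dpf; have [d2 _] := D2; have [d3 _] := D3; have [d4 _] := Dpsi.
have [d5 _] := Df.
rewrite !(sipZl HD)// /Iform => h.
have := Qform_le0 Dpsi; rewrite /Qform => hQ.
have : C * (4 * e (psi * psi * psi) psi - 3 * e (psi * psi) (psi * psi)) <= 0.
  by rewrite mulr_ge0_le0.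
move: h; rewrite /k; lra.
Qed.

End Local.

(** * Complex-valued functions *)

Lemma ncvg_ge0 (R : realType) (V : lmodType R) (D : set V) b
    (x y : nat -> V) x0 y0 : sip D b -> (forall n, D (x n)) -> (forall n, D (y n)) ->
  D x0 -> D y0 -> ncvg b x x0 -> ncvg b y y0 -> (forall n, 0 <= b (x n) (y n)) ->
  0 <= b x0 y0.
Proof.
move=> H Dx Dy Dx0 Dy0 cx cy xy; apply/ler_addgt0Pr => e e0.
pose K := nrm b x0 + nrm b y0 + 2.
have n1 := nrm_ge0 b x0; have n2 := nrm_ge0 b y0.
have K0 : 0 < K by rewrite /K; lra.
pose a := Num.min 1 (e / K).
have a0 : 0 < a by rewrite lt_min ltr01 divr_gt0.
have a1 : a <= 1 by rewrite ge_min lexx.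
have a2 : a * K <= e by rewrite -ler_pdivlMr// ge_min lexx orbT.
have [N1 h1] := cx _ a0; have [N2 h2] := cy _ a0.
pose n := maxn N1 N2; have {}h1 := h1 n (leq_maxl _ _); have {}h2 := h2 n (leq_maxr _ _).
have Dxn := sip_domB H (Dx n) Dx0; have Dyn := sip_domB H (Dy n) Dy0.
have E : b (x n) (y n) = b x0 y0 + b (x n - x0) (y n) + b x0 (y n - y0).
  by rewrite (sipBl H)// (sipBr H)//; ring.
have c1 := sip_CS H Dxn (Dy n); have c2 := sip_CS H Dx0 Dyn.
have c3 := nrm_tri H (Dy n) (sip_dom0 H) Dy0; rewrite !subr0 in c3.
have c4 : nrm b (x n - x0) * nrm b (y n) <= a * (nrm b y0 + 1).
  by apply: ler_pM; rewrite ?nrm_ge0 ?(ltW h1)//; lra.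
have c5 : nrm b x0 * nrm b (y n - y0) <= nrm b x0 * a by rewrite ler_wpM2l// ltW.
have := xy n; rewrite E.
have := ler_norm (b (x n - x0) (y n)); have := ler_norm (b x0 (y n - y0)).
by move: a2; rewrite /K; lra.
Qed.

(** * Semi-inner products on pairs *)

Section Pairs.
Context (R : realType) (V : lmodType R) (D : set V) (b : V -> V -> R).
Hypothesis H : sip D b.

Definition dom2 : set (V * V) := [set p | D p.1 /\ D p.2].
Definition sip2 (p q : V * V) : R := b p.1 q.1 + b p.2 q.2.

Lemma sip_pair : sip dom2 sip2.
Proof.
split.
- by split; exact: (sip_dom0 H).
- by move=> c u v [u1 u2] [v1 v2]; split; exact: (sip_domP H).
- move=> c u v w [u1 u2] [v1 v2] [w1 w2]; rewrite /sip2 /=.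
  by rewrite !(sip_linl H)//; ring.
- by move=> u v [u1 u2] [v1 v2]; rewrite /sip2 (sip_sym H)// [b u.2 _](sip_sym H).
- by move=> u [u1 u2]; rewrite addr_ge0// (sip_ge0 H).
Qed.

Lemma nrm_fst p : dom2 p -> nrm b p.1 <= nrm sip2 p.
Proof.
move=> [h1 h2]; rewrite ler_sqrt ?addr_ge0 ?(sip_ge0 H)//.
by rewrite lerDl (sip_ge0 H).
Qed.

Lemma nrm_snd p : dom2 p -> nrm b p.2 <= nrm sip2 p.
Proof.
move=> [h1 h2]; rewrite ler_sqrt ?addr_ge0 ?(sip_ge0 H)//.
by rewrite lerDr (sip_ge0 H).
Qed.

Lemma nrm_pair p : dom2 p -> nrm sip2 p <= nrm b p.1 + nrm b p.2.
Proof.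
move=> [h1 h2]; rewrite -ler_sqr ?nnegrE ?addr_ge0 ?nrm_ge0//.
rewrite (nrm_sq sip_pair)// sqrrD !(nrm_sq H)// /sip2.
by have := nrm_ge0 b p.1; have := nrm_ge0 b p.2; nra.
Qed.

Lemma ncvg_pair (u : nat -> V * V) p : (forall n, dom2 (u n)) -> dom2 p ->
  ncvg b (fun n => (u n).1) p.1 -> ncvg b (fun n => (u n).2) p.2 -> ncvg sip2 u p.
Proof.
move=> Du Dp c1 c2 e e0; have e2 : 0 < e / 2 by lra.
have [N1 h1] := c1 _ e2; have [N2 h2] := c2 _ e2; exists (maxn N1 N2) => n.
rewrite geq_max => /andP[/h1 {}h1 /h2 {}h2].
by apply: le_lt_trans (nrm_pair (sip_domB sip_pair (Du n) Dp)) _; rewrite /=; lra.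
Qed.

Lemma ncauchy_fst (u : nat -> V * V) : (forall n, dom2 (u n)) -> ncauchy sip2 u ->
  ncauchy b (fun n => (u n).1).
Proof.
move=> Du cu e /cu[N hN]; exists N => m n Nm Nn; apply: le_lt_trans (hN _ _ Nm Nn).
exact: (nrm_fst (sip_domB sip_pair (Du m) (Du n))).
Qed.

Lemma ncauchy_snd (u : nat -> V * V) : (forall n, dom2 (u n)) -> ncauchy sip2 u ->
  ncauchy b (fun n => (u n).2).
Proof.
move=> Du cu e /cu[N hN]; exists N => m n Nm Nn; apply: le_lt_trans (hN _ _ Nm Nn).
exact: (nrm_snd (sip_domB sip_pair (Du m) (Du n))).
Qed.

Lemma ncvg_fst (u : nat -> V * V) p : (forall n, dom2 (u n)) -> dom2 p ->
  ncvg sip2 u p -> ncvg b (fun n => (u n).1) p.1.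
Proof.
move=> Du Dp cu e /cu[N hN]; exists N => n Nn; apply: le_lt_trans (hN _ Nn).
exact: (nrm_fst (sip_domB sip_pair (Du n) Dp)).
Qed.

Lemma ncvg_snd (u : nat -> V * V) p : (forall n, dom2 (u n)) -> dom2 p ->
  ncvg sip2 u p -> ncvg b (fun n => (u n).2) p.2.
Proof.
move=> Du Dp cu e /cu[N hN]; exists N => n Nn; apply: le_lt_trans (hN _ Nn).
exact: (nrm_snd (sip_domB sip_pair (Du n) Dp)).
Qed.

Lemma ncomplete_pair : ncomplete D b -> ncomplete dom2 sip2.
Proof.
move=> cD u Du cu.
have [x Dx cx] := cD _ (fun n => (Du n).1) (ncauchy_fst Du cu).
have [y Dy cy] := cD _ (fun n => (Du n).2) (ncauchy_snd Du cu).
by exists (x, y) => //; exact: ncvg_pair.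
Qed.

End Pairs.

(** * Complex square integrable functions as pairs of real ones *)

Section ComplexL2.
Context d (T : measurableType d) (R : realType).
Variable mu : {measure set T -> \bar R}.
Implicit Types (f g : T -> R[i]) (p q : (T -> R) * (T -> R)).
Local Notation ip := (ip mu).
Local Notation l2 := (l2 mu).
Local Notation ip2 := (sip2 ip).
Local Notation l22 := (dom2 l2).

(* Complex functions become pairs of real ones, which form an [lmodType R]. *)
Definition pairc p : T -> R[i] := fun x => (p.1 x +i* p.2 x)%C.
Definition cpair f : (T -> R) * (T -> R) := (Rpart f, Ipart f).

Lemma cpairK f : pairc (cpair f) = f.
Proof. by apply/funext => x; rewrite /pairc /cpair/= /Rpart /Ipart; case: (f x). Qed.

Lemma paircK p : cpair (pairc p) = p.
Proof. by case: p. Qed.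

Lemma L2_cpair f : L2 mu f <-> l22 (cpair f).
Proof. by []. Qed.

Lemma L2norm_sq f : L2 mu f -> L2norm mu f ^+ 2 = ip2 (cpair f) (cpair f).
Proof.
move=> [l1 l2_]; have := l2_integrable l1 l1; have := l2_integrable l2_ l2_ => i2 i1.
have iS := EFin_integrableD i1 i2.
have normE x : absf f x ^+ 2 = Rpart f x * Rpart f x + Ipart f x * Ipart f x.
  rewrite /absf /Rpart /Ipart; case: (f x) => a b /=.
  by rewrite sqr_sqrtr ?addr_ge0 ?sqr_ge0// -!expr2.
have E : ('N[mu]_2%:E[EFin \o absf f] `^ 2 =
          (ip2 (cpair f) (cpair f))%:E)%E.
  rewrite powR_Lnorm// /sip2 /ip -RintegralD// /Rintegral fineK; last first.
    exact: (integrable_fin_num measurableT iS).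
  apply: eq_integral => x _ /=; rewrite powR_mulrn// real_normK ?num_real//.
  by rewrite normE.
have fin : 'N[mu]_2%:E[EFin \o absf f]%E \is a fin_num.
  rewrite ge0_fin_numE ?Lnorm_ge0//; apply: (@lty_poweRy _ _ 2) => //.
  by rewrite E ltry.
move: E fin; rewrite /L2norm; case: ('N[mu]_2%:E[_])%E (Lnorm_ge0 mu 2%:E (EFin \o absf f)) => // r r0.
rewrite poweR_EFin => -[]; rewrite powR_mulrn//.
Qed.

Lemma L2norm_ge0 f : 0 <= L2norm mu f.
Proof. by rewrite /L2norm fine_ge0// Lnorm_ge0. Qed.

Lemma L2normE f : L2 mu f -> L2norm mu f = nrm ip2 (cpair f).
Proof. by move=> lf; rewrite /nrm -L2norm_sq// sqrtr_sqr ger0_norm// L2norm_ge0. Qed.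

Lemma innerE f g : L2 mu f -> L2 mu g -> inner mu f g =
  (ip2 (cpair f) (cpair g) +i* (ip (Ipart f) (Rpart g) - ip (Rpart f) (Ipart g)))%C.
Proof.
move=> [f1 f2] [g1 g2]; rewrite /inner /sip2 /ip /=; congr (_ +i* _)%C.
  rewrite -RintegralD//; try exact: l2_integrable.
  apply: eq_Rintegral => x _; rewrite /Rpart /Ipart.
  by case: (f x) (g x) => a b [c e] /=; ring.
rewrite -RintegralB//; try exact: l2_integrable.
apply: eq_Rintegral => x _; rewrite /Rpart /Ipart.
by case: (f x) (g x) => a b [c e] /=; ring.
Qed.

Lemma cpair_lin (c : R) f g : cpair (fun x => c%:C%C * f x + g x) = c *: cpair f + cpair g.
Proof.
have hR (z w : R[i]) : complex.Re (c%:C%C * z + w) = c * complex.Re z + complex.Re w.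
  by case: z w => a b [a' b'] /=; ring.
have hI (z w : R[i]) : complex.Im (c%:C%C * z + w) = c * complex.Im z + complex.Im w.
  by case: z w => a b [a' b'] /=; ring.
by congr (_, _); apply/funext => x; [exact: hR|exact: hI].
Qed.

End ComplexL2.

(** * The real form underlying a complex Dirichlet form *)

Section RealForm.
Context d (T : measurableType d) (R : realType).
Variable mu : {measure set T -> \bar R}.
Context (E : l2form T R).
Hypothesis HE : dirichlet_form mu E.
Local Notation ip := (ip mu).
Local Notation l2 := (l2 mu).
Implicit Types (f g : T -> R[i]) (u v w : T -> R).

Definition rdom : set (T -> R) := [set u | fdom E (cplx u)].
Definition renergy u v : R := complex.Re (E (cplx u) (cplx v)).

Lemma cplx_lin (c : R) u v : cplx (c *: u + v) = (fun x => c%:C%C * cplx u x + cplx v x).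
Proof.
apply/funext => x; rewrite /cplx -[(c *: u + v) x]/(c * u x + v x).
by rewrite rmorphD rmorphM.
Qed.

Lemma conjf_cplx u : conjf (cplx u) = cplx u.
Proof. by apply/funext => x; rewrite /conjf /cplx conjc_real. Qed.

(** Conjugation fixes both arguments, so the value is its own conjugate. *)
Lemma form_cplx u v : rdom u -> rdom v -> E (cplx u) (cplx v) = (renergy u v)%:C%C.
Proof.
move=> Du Dv; have := df_conj HE Du Dv; rewrite !conjf_cplx /renergy.
by case: (E _ _) => a b /= [] /eqP; rewrite -subr_eq0 opprK -mulr2n mulrn_eq0 => /= /eqP ->.
Qed.

Lemma rdom_l2 : rdom `<=` l2.
Proof. by move=> u /(df_L2 HE)[]. Qed.

Lemma L2_cplx u : l2 u -> L2 mu (cplx u).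
Proof. by move=> lu; split => //; exact: (sip_dom0 (sip_l2 mu)). Qed.

Lemma L2norm_cplx u : l2 u -> L2norm mu (cplx u) = nrm ip u.
Proof.
move=> lu; rewrite (L2normE (L2_cplx lu)) /nrm /sip2 /=.
by rewrite (_ : Ipart (cplx u) = 0)// (sip0l (sip_l2 mu)) ?addr0//; exact: l2_0.
Qed.

Lemma sip_renergy : sip rdom renergy.
Proof.
split.
- have -> : rdom 0 = fdom E (cplx 0) by []; rewrite (_ : cplx _ = cst 0)//.
  exact: (df_dom0 HE).
- by move=> c u v Du Dv; rewrite /rdom/= cplx_lin; exact: (df_domP HE).
- move=> c u v w Du Dv Dw; rewrite /renergy cplx_lin (df_linear HE)//.
  by rewrite !form_cplx//= mul0r subr0.
- move=> u v Du Dv; rewrite /renergy (df_hermitian HE Dv Du) form_cplx//.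
- move=> u Du; have := df_ge0 HE Du; rewrite form_cplx//.
  by rewrite lecE /= => /andP[].
Qed.

Lemma cplxB u v : cplx u \- cplx v = cplx (u - v).
Proof. by apply/funext => x; rewrite /cplx /= -rmorphB. Qed.

Lemma real_dirichlet_form : real_dirichlet mu rdom renergy.
Proof.
split.
- exact: sip_renergy.
- exact: rdom_l2.
- move=> u v Du lv uv; apply: (df_ae_dom HE Du (L2_cplx lv)).
  by apply: filterS uv => x; rewrite /cplx => ->.
- move=> u v w Du Dv Dw uv; rewrite /renergy (df_ae_val HE Du Dv Dw)//.
  by apply: filterS uv => x; rewrite /cplx => ->.
- move=> u v Du lv uv cu.
  have [||Dv c] := df_closed HE (u := fun n => cplx (u n)) Du (L2_cplx lv).
  + apply/cvgrPdist_lt => e e0; have [N hN] := uv _ e0; exists N => // n /hN.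
    rewrite cplxB L2norm_cplx; last by apply: (sip_domB (sip_l2 mu)) => //; exact: rdom_l2.
    by rewrite sub0r normrN ger0_norm ?nrm_ge0.
  + move=> e e0; have e1 : 0 < Num.sqrt e by rewrite sqrtr_gt0.
    have [N hN] := cu _ e1; exists N => m n Nm Nn.
    have := hN m n Nm Nn; rewrite /nrm ltr_sqrt// cplxB.
    by apply: le_lt_trans.
  split=> // e e0; have e2 : 0 < e ^+ 2 by rewrite exprn_gt0.
  move/cvgrPdist_lt : c => /(_ _ e2)[N _ hN]; exists N => n Nn.
  have := hN n Nn; rewrite sub0r normrN cplxB => h.
  rewrite /nrm -(ger0_norm (ltW e0)) -sqrtr_sqr ltr_sqrt//.
  by apply: le_lt_trans h; exact: ler_norm.
- exact: (df_markov HE).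
Qed.

Lemma fdom_pair f : fdom E f <-> dom2 rdom (cpair f).
Proof.
split=> [Df|[D1 D2]].
  have Dc := df_conj_dom HE Df.
  have D0 := df_dom0 HE.
  have half c : fdom E (fun x => c * (f x + conjf f x)).
    have D1 := df_domP HE 1 Df Dc.
    have := df_domP HE c D1 D0.
    by congr (fdom E); apply/funext => x; rewrite addr0 mul1r.
  have halfi c : fdom E (fun x => c * (f x - conjf f x)).
    have D1 := df_domP HE (-1) Dc Df.
    have := df_domP HE c D1 D0.
    by congr (fdom E); apply/funext => x; rewrite addr0 mulN1r addrC.
  split; rewrite /rdom /=.
  - have := half (2^-1)%:C%C; congr (fdom E); apply/funext => x.
    rewrite /cplx /Rpart /conjf; case: (f x) => a b /=.
    by simpc; congr (_ +i* _)%C; field.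
  - have := halfi (- ((2^-1)%:C * 'i))%C; congr (fdom E); apply/funext => x.
    rewrite /cplx /Ipart /conjf; case: (f x) => a b /=.
    by simpc; congr (_ +i* _)%C; field.
have := df_domP HE 'i%C D2 D1; congr (fdom E); apply/funext => x.
by rewrite /cplx /Rpart /Ipart [RHS]complexE addrC.
Qed.

Lemma form_pair f g : fdom E f -> fdom E g -> E f g =
  (sip2 renergy (cpair f) (cpair g) +i*
   (renergy (Ipart f) (Rpart g) - renergy (Rpart f) (Ipart g)))%C.
Proof.
move=> Df Dg; have [f1 f2] := (fdom_pair f).1 Df; have [g1 g2] := (fdom_pair g).1 Dg.
have split_ (h : T -> R[i]) : (fun x => 'i%C * cplx (Ipart h) x + cplx (Rpart h) x) = h.
  by apply/funext => x; rewrite /cplx /Rpart /Ipart [RHS]complexE addrC.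
have lin (k : T -> R) (h : T -> R[i]) : rdom k -> fdom E h -> E h (cplx k) =
    ('i * E (cplx (Ipart h)) (cplx k) + E (cplx (Rpart h)) (cplx k))%C.
  move=> Dk Dh; have [h1 h2] := (fdom_pair h).1 Dh.
  by rewrite -[in LHS](split_ h) (df_linear HE).
have Ef (k : T -> R) : rdom k -> E f (cplx k) =
    ('i * (renergy (Ipart f) k)%:C + (renergy (Rpart f) k)%:C)%C.
  by move=> Dk; rewrite lin// !form_cplx.
rewrite (df_hermitian HE Dg Df) -[g in E g _]split_ (df_linear HE)//.
rewrite rmorphD rmorphM /= -!(df_hermitian HE)// !Ef// /sip2 /=.
by simpc; congr (_ +i* _)%C; ring.
Qed.

End RealForm.

(** * The estimate on the core *)

Definition clamp (T : Type) (R : realType) (M : R) (u : T -> R) : T -> R :=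
  fun x => Num.max (- M) (Num.min (u x) M).

Section Clamp.
Context d (T : measurableType d) (R : realType).
Variable mu : {measure set T -> \bar R}.
Implicit Types (u : T -> R) (M : R).

Lemma clamp_le M u x : 0 <= M -> `|clamp M u x| <= M.
Proof.
move=> M0; rewrite ler_norml /clamp /Num.max /Num.min.
by case: (ltP (u x) M) => h1; case: ltP => h2; apply/andP; split; lra.
Qed.

Lemma clamp_id M u x : `|u x| <= M -> clamp M u x = u x.
Proof.
rewrite ler_norml /clamp /Num.max /Num.min => /andP[h1 h2].
by case: (ltP (u x) M) => h3; case: ltP => h4; lra.
Qed.

Lemma measurable_clamp M u : measurable_fun setT u -> measurable_fun setT (clamp M u).
Proof.
by move=> m; apply: measurable_maxr => //; exact: measurable_minr.
Qed.

Lemma linfP u : u \in Lfun mu +oo%E <->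
  measurable_fun setT u /\ exists M, {ae mu, forall x, `|u x| <= M}.
Proof.
split=> [|[m_u [M uM]]].
  rewrite inE => /andP[/[!inE]/= m_u]; rewrite /finite_norm unlock.
  case: ifPn => [mu0 h|mu0 _]; split=> //.
    have [M hM] := @ess_supr_bounded _ _ _ mu (fun x => `|u x|) h.
    by exists M.
  (* Here the whole space has measure zero and serves as the exceptional set. *)
  exists 0, setT; split => //.
  by apply/eqP; rewrite eq_le measure_ge0 andbT leNgt.
rewrite inE; apply/andP; split; rewrite inE//= /finite_norm unlock.
case: ifPn => // mu0; apply: le_lt_trans (ltry M).
by apply/ess_supP; apply: filterS uM => x h; rewrite /= lee_fin.
Qed.

Lemma linf_bnd u : measurable_fun setT u -> bnd u -> u \in Lfun mu +oo%E.
Proof. by move=> m_u [M uM]; apply/linfP; split=> //; exists M; exact: aeW. Qed.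

Context (D : set (T -> R)) (e : (T -> R) -> (T -> R) -> R).
Hypothesis HE : real_dirichlet mu D e.

(** Only the unit contraction is given; the truncation is [M] times the difference of the unit
    contractions of [u / M] and [- u / M]. *)
Lemma Db_clamp M u : 0 < M -> D u -> Db D (clamp M u).
Proof.
move=> M0 Du; have HD := rd_sip HE; split; last first.
  by exists M => x; apply: clamp_le; exact: ltW.
have [D1 _] := rd_markov HE (sip_domZ HD M^-1 Du).
have [D2 _] := rd_markov HE (sip_domZ HD (- M^-1) Du).
have := sip_domB HD (sip_domZ HD M D1) (sip_domZ HD M D2).
congr D; apply/funext => x.
set a := fun _ => _ in D1 *; set b := fun _ => _ in D2 *.
have -> : (M *: a - M *: b) x = M * a x - M * b x by [].
have -> : a x = Num.min (Num.max (M^-1 * u x) 0) 1 by [].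
have -> : b x = Num.min (Num.max (- M^-1 * u x) 0) 1 by [].
have E : M * (M^-1 * u x) = u x by rewrite mulrA divff ?mul1r// gt_eqF.
rewrite /clamp mulNr; move: E; move: (M^-1 * u x) => z <-.
have -> : Num.max (- M) (Num.min (M * z) M) = M * Num.max (-1) (Num.min z 1).
  by rewrite maxr_pMr ?(ltW M0)// minr_pMr ?(ltW M0)// mulrN1 mulr1.
rewrite -mulrBr; congr (M * _).
rewrite /Num.max /Num.min; case: (ltP z 0) => z0; case: (ltP (- z) 0) => z1;
  rewrite ?ltr01; case: (ltP z 1) => z2; try case: (ltP (- z) 1) => z3;
  case: ltP => z4; lra.
Qed.

End Clamp.

(** * Dependence of the support on the zero set *)

Section EssentialSupport.
Context (X : ptopologicalType) (R : realType).
Variable mu : {measure set (borel X) -> \bar R}.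
Implicit Types f g : borel X -> R[i].

Lemma ae_eq_on_zeros (U : set X) f g :
  {ae mu, forall x, f x = 0 <-> g x = 0} ->
  ae_eq_on mu U f (cst 0) -> ae_eq_on mu U g (cst 0).
Proof. by move=> fg; apply: filterS2 fg => x [h1 _] h2 Ux; apply: h1; exact: h2. Qed.

(** Lets the compact support of a core function pass to its squared modulus times a positive weight,
    which is the test function used for [hatI_norm]. *)
Lemma esupp_zeros f g : {ae mu, forall x, f x = 0 <-> g x = 0} ->
  esupp mu f = esupp mu g.
Proof.
move=> fg; rewrite /esupp; congr (~` _).
have gf : {ae mu, forall x, g x = 0 <-> f x = 0}.
  by apply: filterS fg => x [h1 h2]; split.
by apply/seteqP; split=> x [U [oU hU] Ux]; exists U => //; split => //;
  exact: ae_eq_on_zeros hU.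
Qed.

Lemma compact_supp_zeros f g : {ae mu, forall x, f x = 0 <-> g x = 0} ->
  compact_supp mu f -> compact_supp mu g.
Proof.
move=> fg [cf hf]; have E := esupp_zeros fg; split; rewrite -E//.
exact: ae_eq_on_zeros hf.
Qed.

End EssentialSupport.

Section CoreEstimate.
Context (X : ptopologicalType) (R : realType).
Variable mu : {measure set (borel X) -> \bar R}.
Context (E : l2form (borel X) R).
Hypotheses (sfin : sigma_finite setT mu) (HE : dirichlet_form mu E)
  (Hloc : local_form mu E).
Local Notation ip := (ip mu).
Local Notation l2 := (l2 mu).
Local Notation er := (renergy E).
Local Notation D := (rdom E).
Local Notation Db := (Db D).
Local Notation ip2 := (sip2 ip).
Local Notation er2 := (sip2 er).
Implicit Types (u v psi phi : borel X -> R) (g : borel X -> R[i]).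

Let HR := real_dirichlet_form HE.
Let HD : sip D er := rd_sip HR.
Let HL : sip l2 ip := sip_l2 mu.

Lemma rlocal u v (a : R) : D u -> D v ->
  {ae mu, forall x, (u x + a) * v x = 0} -> er v u = 0.
Proof.
move=> Du Dv h; rewrite /renergy (Hloc (a := a) Du Dv)//.
by apply: filterS h => x hx; rewrite /cplx -rmorphD -rmorphM hx.
Qed.

Lemma cdcE psi phi : Db psi -> Db phi -> cdc E psi phi = (Iform er psi phi)%:C%C.
Proof.
move=> Dpsi Dphi; have [D1 _] := DbM HR sfin Dpsi Dphi.
have [D2 _] := DbM HR sfin Dpsi Dpsi; have [D3 _] := Dpsi; have [D4 _] := Dphi.
rewrite /cdc /Iform (form_cplx HE D1 D3) (form_cplx HE D2 D4).
by rewrite rmorphB rmorphM fmorphV rmorph_nat.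
Qed.

Lemma Iform_linear (c : R) psi phi phi' : Db psi -> Db phi -> Db phi' ->
  Iform er psi (c *: phi + phi') = c * Iform er psi phi + Iform er psi phi'.
Proof.
move=> Dp D1 D2; have [d1 _] := DbM HR sfin Dp D1; have [d2 _] := DbM HR sfin Dp D2.
have [d3 _] := DbM HR sfin Dp Dp; have [d4 _] := Dp; have [d5 _] := D1; have [d6 _] := D2.
rewrite /Iform.
have -> : psi * (c *: phi + phi') = c *: (psi * phi) + psi * phi'.
  apply/funext => x.
  by change (psi x * (c * phi x + phi' x) = c * (psi x * phi x) + psi x * phi' x); ring.
rewrite (sip_linl HD)// (sip_sym HD d3 (sip_domP HD c d5 d6)) (sip_linl HD)//.
by rewrite (sip_sym HD d5 d3) (sip_sym HD d6 d3); ring.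
Qed.

(** The norm of [hatI] tests functions of integral at most one; [phi] is rescaled and [Iform] is
    linear in it. *)
Lemma Iform_bound psi psih phi : D0 mu E psi -> Db psih -> Db phi ->
  (forall x, 0 <= phi x) -> mu.-integrable setT (EFin \o phi) ->
  compact_supp mu (cplx phi) ->
  ae_eq_on mu (esupp mu (cplx phi)) (cplx psi) (cplx psih) ->
  Iform er psih phi <= \int[mu]_x phi x.
Proof.
move=> [_ _ hI] Dpsih Dphi phi0 iphi cs psiE.
apply/ler_addgt0Pr => ep ep0.
have I0 : 0 <= \int[mu]_x phi x by exact: Rintegral_ge0.
have s0 : 0 < \int[mu]_x phi x + ep by rewrite ltr_wpDl.
(* Adding [ep] covers an integral equal to zero. *)
pose c := (\int[mu]_x phi x + ep)^-1.
have c0 : 0 < c by rewrite invr_gt0.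
have Dc := DbZ HR c Dphi.
have z : {ae mu, forall x, cplx phi x = 0 <-> cplx (c *: phi) x = 0}.
  apply: aeW => x; rewrite /cplx funZE; split=> [[->]|[/eqP]]; first by rewrite mulr0.
  by rewrite mulf_eq0 (gt_eqF c0) => /= /eqP ->.
have : ((Normc.normc (cdc E psih (c *: phi)))%:E <= 1)%E.
  apply: le_trans hI; apply: ereal_sup_ubound.
  exists (c *: phi), (cdc E psih (c *: phi)); split => //.
  - split; first by case: Dc.
    split; last exact: compact_supp_zeros z cs.
    by apply: linf_bnd; [exact: Db_measurable HR _ Dc|case: Dc].
  - rewrite Lnorm1.
    have -> : (\int[mu]_x `|(EFin \o (c *: phi)) x| = (c * \int[mu]_x phi x)%:E)%E.
      rewrite EFinM /Rintegral fineK; last exact: (integrable_fin_num measurableT iphi).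
      rewrite -integralZl//; apply: eq_integral => x _ /=.
      by rewrite ger0_norm ?mulr_ge0// ?(ltW c0)// EFinM.
    by rewrite lee_fin /c mulrC ler_pdivrMr// mul1r lerDl ltW.
  - exists psih; split => //; first by case: Dpsih.
    + by apply: linf_bnd; [exact: Db_measurable HR _ Dpsih|case: Dpsih].
    + by rewrite -(esupp_zeros z).
rewrite cdcE// /= expr0n addr0 sqrtr_sqr lee_fin => h.
have := le_trans (ler_norm _) h.
have := Iform_linear c Dpsih Dphi (Db0 HR); rewrite addr0 => ->.
have -> : Iform er psih 0 = 0.
  have [d3 _] := DbM HR sfin Dpsih Dpsih; have [d4 _] := Dpsih.
  by rewrite /Iform mulr0 (sip0l HD)// (sip0r HD)// mulr0 subr0.
by rewrite addr0 /c mulrC ler_pdivrMr// mul1r.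
Qed.

Definition wpair (w : borel X -> R) (p : (borel X -> R) * (borel X -> R)) :=
  (w * p.1, w * p.2).

(* Real and imaginary parts are treated together: [compact_supp] for [g] need not
   imply it for [Rpart g].  The constant [M + 1] bounds the extension of [psi]. *)
Lemma core_estimate (r M : R) psi g : (forall x, `|psi x| <= M) ->
  D0 mu E psi -> fdom E g -> Linfc mu g ->
  let w := wexp (2 * r) psi in let p := cpair g in
  [/\ dom2 D (wpair w p),
    0 <= er2 p (wpair w p) + r ^+ 2 * ip2 p (wpair w p) &
    er2 (wpair w p) (wpair w p) <= 2 * expR (`|2 * r| * (M + 1)) ^+ 2 * er2 p p +
      2 * (expR (`|2 * r| * (M + 1)) ^+ 2 * (2 * r) ^+ 2) * ip2 p p].
Proof.
move=> psiM psi0 Dg [[lg1 lg2] csg] w p.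
have M0 : 0 <= M by apply: le_trans (psiM point).
have [p1 p2] := (fdom_pair HE g).1 Dg; rewrite -/p in p1 p2.
have [mg1 [M1 gM1]] := (linfP mu _).1 lg1; have [mg2 [M2 gM2]] := (linfP mu _).1 lg2.
pose B := `|M1| + `|M2| + 1.
have B0 : 0 < B by rewrite /B; have := normr_ge0 M1; have := normr_ge0 M2; lra.
(* Representatives that are bounded everywhere, as [Db] requires. *)
pose u := clamp B p.1; pose v := clamp B p.2.
have Du : Db u by exact: Db_clamp HR _ _ B0 p1.
have Dv : Db v by exact: Db_clamp HR _ _ B0 p2.
have uE : {ae mu, forall x, p.1 x = u x}.
  apply: filterS gM1 => x h; rewrite /u clamp_id//; apply: le_trans h _.
  by have := ler_norm M1; have := normr_ge0 M2; rewrite /B; lra.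
have vE : {ae mu, forall x, p.2 x = v x}.
  apply: filterS gM2 => x h; rewrite /v clamp_id//; apply: le_trans h _.
  by have := ler_norm M2; have := normr_ge0 M1; rewrite /B; lra.
have [[_ loc] _ _] := psi0.
have [h Dh hE] := loc _ csg.1.
have [h1 _] := (fdom_pair HE h).1 Dh.
(* An extension from the compact support of [g]. The level is [M + 1] because [M] may be zero. *)
pose psih := clamp (M + 1) (Rpart h).
have M10 : 0 < M + 1 by lra.
have Dpsih : Db psih by exact: Db_clamp HR _ _ M10 h1.
have psihE : ae_eq_on mu (esupp mu g) (cplx psi) (cplx psih).
  apply: filterS hE => x hx Ux; have := hx Ux; rewrite /cplx /psih => E1.
  have E2 : Rpart h x = psi x by rewrite /Rpart -E1.
  by rewrite clamp_id E2//; apply: le_trans (psiM x) _; lra.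
have psihM x : `|psih x| <= M + 1 by apply: clamp_le; lra.
have Duv := DbP HR 1 (DbM HR sfin Du Du) (DbM HR sfin Dv Dv).
(* [s] is almost everywhere the squared modulus of [g], hence has its zeros and its support. *)
rewrite scale1r in Duv; set s := u * u + v * v in Duv.
have sE x : s x = u x ^+ 2 + v x ^+ 2 by rewrite !expr2.
pose wh := wexp (2 * r) psih.
have Ds : Db (wh * s) by exact: DbWexp HR sfin _ _ _ Dpsih Duv.
have whp x : 0 < wh x by exact: expR_gt0.
have zs (k : borel X -> R) : (forall x, 0 < k x) ->
    {ae mu, forall x, g x = 0 <-> cplx (k * s) x = 0}.
  move=> k0; apply: filterS2 uE vE => x ux vx.
  have gE : g x = (u x +i* v x)%C by rewrite -ux -vx -[in LHS](cpairK g).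
  rewrite gE /cplx funME sE; split.
    by move=> [-> ->]; rewrite !expr0n /= addr0 mulr0.
  move=> [] /eqP; rewrite mulf_eq0 (gt_eqF (k0 x))/= paddr_eq0 ?sqr_ge0//.
  by rewrite !sqrf_eq0 => /andP[/eqP -> /eqP ->].
have s0 x : 0 <= s x by rewrite sE addr_ge0 ?sqr_ge0.
have lu := rd_l2 HR Du.1; have lv := rd_l2 HR Dv.1.
have is_ : mu.-integrable setT (EFin \o s).
  by apply: EFin_integrableD; exact: l2_integrable.
have psiE' (k : borel X -> R) : (forall x, 0 < k x) ->
    ae_eq_on mu (esupp mu (cplx (k * s))) (cplx psi) (cplx psih).
  by move=> k0; rewrite -(esupp_zeros (zs k k0)).
have cs' (k : borel X -> R) : (forall x, 0 < k x) -> compact_supp mu (cplx (k * s)).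
  by move=> k0; exact: compact_supp_zeros (zs k k0) csg.
have ONE : forall x : borel X, 0 < (1 : borel X -> R) x by move=> x; exact: ltr01.
have lwu := rd_l2 HR (DbWexp HR sfin (2 * r) Dpsih Du).1.
have lwv := rd_l2 HR (DbWexp HR sfin (2 * r) Dpsih Dv).1.
have iws : mu.-integrable setT (EFin \o (wh * s)).
  have -> : wh * s = (wh * u) * u + (wh * v) * v.
    apply/funext => x.
    by change (wh x * (u x * u x + v x * v x) = (wh x * u x) * u x + (wh x * v x) * v x); ring.
  by apply: EFin_integrableD; exact: l2_integrable.
have ws0 x : 0 <= (wh * s) x by rewrite funME mulr_ge0// ltW.
have bound1 : Iform er psih s <= ip u u + ip v v.
  have := Iform_bound psi0 Dpsih Duv s0 is_.
  have E1 : (1 : borel X -> R) * s = s by rewrite mul1r.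
  have := cs' 1 ONE; have := psiE' 1 ONE; rewrite E1 => h2 h3 /(_ h3 h2).
  by rewrite -RintegralD//; exact: l2_integrable.
have bound2 : Iform er psih (wh * s) <= ip u (wh * u) + ip v (wh * v).
  have := Iform_bound psi0 Dpsih Ds ws0 iws (cs' wh whp) (psiE' wh whp).
  congr (_ <= _); rewrite -RintegralD//; try exact: l2_integrable.
  apply: eq_Rintegral => x _.
  by change (wh x * (u x * u x + v x * v x) = u x * (wh x * u x) + v x * (wh x * v x)); ring.
have mpsi : measurable_fun setT psi by case: psi0 => _ /linfP[].
(* The two weights agree on the support of [g], and [g] vanishes almost everywhere off it by the
   second part of [compact_supp]. *)
have wE : {ae mu, forall x, w x * u x = wh x * u x /\ w x * v x = wh x * v x}.
  have uvE : {ae mu, forall x, p.1 x = u x /\ p.2 x = v x}.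
    by apply: filterS2 uE vE => x ux vx; split.
  apply: filterS3 psihE csg.2 uvE => x h1' h2' [ux vx].
  have [xs|xs] := pselect (esupp mu g x).
    have [E1] := h1' xs; by rewrite /w /wh /wexp E1.
  have g0 := h2' xs; have := cpairK g; move/(congr1 (fun f => f x)).
  rewrite g0 /pairc -/p ux vx /= => -[-> ->]; by rewrite !mulr0.
have wuE : {ae mu, forall x, (wh * u) x = (w * p.1) x}.
  by apply: filterS2 wE uE => x [hx _] ux; rewrite !funME ux.
have wvE : {ae mu, forall x, (wh * v) x = (w * p.2) x}.
  by apply: filterS2 wE vE => x [_ hx] vx; rewrite !funME vx.
have mw : measurable_fun setT w by exact: wexp_measurable.
have mwp1 : measurable_fun setT (w * p.1) by apply: measurable_funM.
have mwp2 : measurable_fun setT (w * p.2) by apply: measurable_funM.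
have lw1 : l2 (w * p.1) by exact: ae_l2 wuE mwp1 lwu.
have lw2 : l2 (w * p.2) by exact: ae_l2 wvE mwp2 lwv.
have Dwu := (DbWexp HR sfin (2 * r) Dpsih Du).1.
have Dwv := (DbWexp HR sfin (2 * r) Dpsih Dv).1.
have Dw1 : D (w * p.1) by exact: (rd_ae_dom HR Dwu lw1 wuE).
have Dw2 : D (w * p.2) by exact: (rd_ae_dom HR Dwv lw2 wvE).
have lp1 := rd_l2 HR p1; have lp2 := rd_l2 HR p2.
have ae_er a a' b b' : D a -> D a' -> D b -> D b' -> {ae mu, forall x, a x = a' x} ->
    {ae mu, forall x, b x = b' x} -> er a b = er a' b'.
  move=> Da Da' Db_ Db' aa bb.
  rewrite (rd_ae_val HR Da Da' Db_ aa) (sip_sym HD Da' Db_).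
  by rewrite (rd_ae_val HR Db_ Db' Da' bb) (sip_sym HD).
have ae_ip' a a' b b' : l2 a -> l2 a' -> l2 b -> l2 b' -> {ae mu, forall x, a x = a' x} ->
    {ae mu, forall x, b x = b' x} -> ip a b = ip a' b'.
  move=> Da Da' Db_ Db' aa bb.
  rewrite (ae_ip Da Da' Db_ aa) (sip_sym HL Da' Db_).
  by rewrite (ae_ip Db_ Db' Da' bb) (sip_sym HL).
have ae_sym a b : {ae mu, forall x, a x = b x} -> {ae mu, forall x, b x = a x :> R}.
  by apply: filterS => x ->.
have er_wu : er p.1 (w * p.1) = er u (wh * u).
  by apply: ae_er => //; [case: Du|exact: ae_sym].
have er_wv : er p.2 (w * p.2) = er v (wh * v).
  by apply: ae_er => //; [case: Dv|exact: ae_sym].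
have ip_wu : ip p.1 (w * p.1) = ip u (wh * u).
  by apply: ae_ip' => //; exact: ae_sym.
have ip_wv : ip p.2 (w * p.2) = ip v (wh * v).
  by apply: ae_ip' => //; exact: ae_sym.
have er_u : er p.1 p.1 = er u u by apply: ae_er => //; case: Du.
have er_v : er p.2 p.2 = er v v by apply: ae_er => //; case: Dv.
have ip_u : ip p.1 p.1 = ip u u by exact: ae_ip'.
have ip_v : ip p.2 p.2 = ip v v by exact: ae_ip'.
have er_wuwu : er (w * p.1) (w * p.1) = er (wh * u) (wh * u).
  by apply: ae_er => //; exact: ae_sym.
have er_wvwv : er (w * p.2) (w * p.2) = er (wh * v) (wh * v).
  by apply: ae_er => //; exact: ae_sym.
have Iadd k : Db (k * (u * u)) -> Db (k * (v * v)) ->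
    Iform er psih (k * (u * u)) + Iform er psih (k * (v * v)) = Iform er psih (k * s).
  move=> D1' D2'; have := Iform_linear 1 Dpsih D1' D2'; rewrite scale1r mul1r => <-.
  by rewrite /s mulrDr.
have Duu := DbM HR sfin Du Du; have Dvv := DbM HR sfin Dv Dv.
split => //.
- rewrite /sip2 /wpair /= er_wu er_wv ip_wu ip_wv.
  apply/ler_addgt0Pr => ep ep0.
  have I1 := Iadd wh (DbWexp HR sfin _ Dpsih Duu) (DbWexp HR sfin _ Dpsih Dvv).
  set J := ip u (wh * u) + ip v (wh * v) in bound2 *.
  have J0 : 0 <= J.
    rewrite /J addr_ge0//; apply: Rintegral_ge0 => x _; rewrite funME mulrCA -expr2;
      by rewrite mulr_ge0 ?sqr_ge0// ltW.
  have r20 := sqr_ge0 r.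
  (* Makes the excess [a * (r ^+ 2 * J)] of the factor [1 + a] at most [ep]. *)
  pose a := ep / (r ^+ 2 * J + 1).
  have d0 : 0 < r ^+ 2 * J + 1 by rewrite ltr_wpDl// mulr_ge0.
  have a0 : 0 < a by rewrite divr_gt0.
  have ha : a * (r ^+ 2 * J) <= ep.
    by rewrite /a -mulrA ger_pMr// mulrC ler_pdivrMr// mul1r lerDl.
  have e1 := energy_perturbation HR sfin rlocal r a0 Dpsih Du.
  have e2 := energy_perturbation HR sfin rlocal r a0 Dpsih Dv.
  rewrite -/wh in e1 e2.
  have h3 : (1 + a) * r ^+ 2 * Iform er psih (wh * s) <= (1 + a) * r ^+ 2 * J.
    by rewrite ler_wpM2l// mulr_ge0// addr_ge0// ltW.
  rewrite -I1 in h3; clear - h3 e1 e2 ha; lra.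
- rewrite /sip2 /wpair /= er_wuwu er_wvwv er_u er_v ip_u ip_v.
  have e1 := energy_wexp HR sfin (2 * r) Dpsih Du psihM.
  have e2 := energy_wexp HR sfin (2 * r) Dpsih Dv psihM.
  rewrite -/wh in e1 e2.
  set K := expR _ in e1 e2 *.
  have I1 : Iform er psih (u * u) + Iform er psih (v * v) = Iform er psih s.
    by have := Iadd 1; rewrite !mul1r; apply.
  have h3 : 2 * (K ^+ 2 * (2 * r) ^+ 2) * Iform er psih s <=
      2 * (K ^+ 2 * (2 * r) ^+ 2) * (ip u u + ip v v).
    by rewrite ler_wpM2l// mulr_ge0// mulr_ge0// sqr_ge0.
  rewrite -I1 in h3; clear - h3 e1 e2; lra.
Qed.

End CoreEstimate.

(** * The weighted form and the generator *)

Lemma ncvg_add (R : realType) (V : lmodType R) (D : set V) b1 b2 (k : R)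
    (x : nat -> V) y : sip D b1 -> sip D b2 -> 0 <= k ->
  (forall n, D (x n)) -> D y -> ncvg b1 x y -> ncvg b2 x y ->
  ncvg (fun u v => b1 u v + k * b2 u v) x y.
Proof.
move=> H1 H2 k0 Dx Dy c1 c2 e e0.
have K0 : 0 < k + 1 by lra.
pose a := Num.min (e / 2) (e / 2 / (k + 1)).
have a0 : 0 < a by rewrite lt_min !divr_gt0.
have [N1 h1] := c1 _ a0; have [N2 h2] := c2 _ a0; exists (maxn N1 N2) => n.
rewrite geq_max => /andP[/h1 {}h1 /h2 {}h2].
have Dxy := sip_domB H1 (Dx n) Dy.
rewrite -ltr_sqr ?nnegrE ?nrm_ge0 ?(ltW e0)//.
rewrite (nrm_sq (sip_add H1 H2 k0))// -(nrm_sq H1)// -(nrm_sq H2)//.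
have n1 := nrm_ge0 b1 (x n - y); have n2 := nrm_ge0 b2 (x n - y).
have a1 : a <= e / 2 by rewrite ge_min lexx.
have a2 : a * (k + 1) <= e / 2 by rewrite -ler_pdivlMr// ge_min lexx orbT.
move: h1 h2 n1 n2; move: (nrm b1 _) (nrm b2 _) => p q h1 h2 n1 n2.
have h3 : p ^+ 2 <= a ^+ 2 by rewrite ler_sqr ?nnegrE//; lra.
have h4 : q ^+ 2 <= a ^+ 2 by rewrite ler_sqr ?nnegrE//; lra.
have h5 : k * q ^+ 2 <= k * a ^+ 2 by rewrite ler_wpM2l.
have h6 : a * (a * (k + 1)) <= (e / 2) * (e / 2) by rewrite ler_pM// ?mulr_ge0//; lra.
have h7 : (e / 2) * (e / 2) < e ^+ 2 by rewrite expr2; nra.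
rewrite !expr2 in h3 h4 h5 *; lra.
Qed.

Lemma cpairB d (T' : measurableType d) (R : realType) (f g : T' -> R[i]) :
  cpair (f \- g) = cpair f - cpair g.
Proof.
rewrite /cpair; congr (_, _); apply/funext => x.
  by rewrite /Rpart /= -[RHS]/(complex.Re (f x) - complex.Re (g x)); case: (f x) (g x) => ? ? [].
by rewrite /Ipart /= -[RHS]/(complex.Im (f x) - complex.Im (g x)); case: (f x) (g x) => ? ? [].
Qed.

Section WeightedEnergy.
Context (X : ptopologicalType) (R : realType).
Variable mu : {measure set (borel X) -> \bar R}.
Context (E : l2form (borel X) R).
Hypotheses (sfin : sigma_finite setT mu) (HE : dirichlet_form mu E)
  (Hloc : local_form mu E) (Hcore : is_core mu E (fdom E `&` Linfc mu)).
Local Notation ip := (ip mu).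
Local Notation l2 := (l2 mu).
Local Notation er := (renergy E).
Local Notation D := (rdom E).
Local Notation ip2 := (sip2 ip).
Local Notation er2 := (sip2 er).
Local Notation l22 := (dom2 l2).
Local Notation D2 := (dom2 D).
Implicit Types (psi : borel X -> R) (p q : (borel X -> R) * (borel X -> R)).

Let HR := real_dirichlet_form HE.
Let HD : sip D er := rd_sip HR.
Let HL : sip l2 ip := sip_l2 mu.
Let HD2 : sip D2 er2 := sip_pair HD.
Let HL2 : sip l22 ip2 := sip_pair HL.

Lemma D2_l22 : D2 `<=` l22.
Proof. by move=> p [p1 p2]; split; exact: (rd_l2 HR). Qed.

Lemma sip_D2_ip2 : sip D2 ip2.
Proof.
apply: (sip_sub HL2 D2_l22); [exact: (sip_dom0 HD2)|exact: (sip_domP HD2)].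
Qed.

Lemma pair_closed (u : nat -> _) p : (forall n, D2 (u n)) -> l22 p ->
  ncvg ip2 u p -> ncauchy er2 u -> D2 p /\ ncvg er2 u p.
Proof.
move=> Du lp up cu.
have lu n := D2_l22 (Du n).
have [D1 c1] := rd_closed HR (fun n => (Du n).1) lp.1 (ncvg_fst HL lu lp up)
  (ncauchy_fst HD Du cu).
have [D2' c2] := rd_closed HR (fun n => (Du n).2) lp.2 (ncvg_snd HL lu lp up)
  (ncauchy_snd HD Du cu).
by split; [split|apply: (ncvg_pair HD)].
Qed.

Lemma wpair_lin (w : borel X -> R) (c : R) p q :
  wpair w (c *: p + q) = c *: wpair w p + wpair w q.
Proof.
rewrite /wpair; congr (_, _); apply/funext => x.
  by change (w x * (c * p.1 x + q.1 x) = c * (w x * p.1 x) + w x * q.1 x); ring.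
by change (w x * (c * p.2 x + q.2 x) = c * (w x * p.2 x) + w x * q.2 x); ring.
Qed.

Lemma wpairB (w : borel X -> R) p q : wpair w (p - q) = wpair w p - wpair w q.
Proof.
rewrite /wpair; congr (_, _); apply/funext => x.
  by change (w x * (p.1 x - q.1 x) = w x * p.1 x - w x * q.1 x); ring.
by change (w x * (p.2 x - q.2 x) = w x * p.2 x - w x * q.2 x); ring.
Qed.

Lemma wpair_l22 (w : borel X -> R) K p : measurable_fun setT w ->
  (forall x, `|w x| <= K) -> l22 p -> l22 (wpair w p).
Proof. by move=> mw wK [p1 p2]; split; exact: l2_bounded_mul wK _. Qed.

Lemma l2_nrm_mul (a u : borel X -> R) K : measurable_fun setT a ->
  (forall x, `|a x| <= K) -> l2 u -> ip (a * u) (a * u) <= K ^+ 2 * ip u u.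
Proof.
move=> ma aK lu; have lau := l2_bounded_mul ma aK lu.
rewrite /ip -RintegralZl//; last exact: l2_integrable.
apply: le_Rintegral => //.
- exact: l2_integrable.
- have := integrableZl measurableT (K ^+ 2) (l2_integrable lu lu).
  by apply: eq_integrable => // x _; rewrite /= EFinM.
- move=> x _; rewrite funME -!expr2 exprMn ler_wpM2r ?sqr_ge0//.
  by rewrite -(real_normK (num_real (a x))) ler_sqr ?nnegrE// (le_trans _ (aK x)).
Qed.

Lemma wpair_nrm (w : borel X -> R) K p : measurable_fun setT w ->
  (forall x, `|w x| <= K) -> l22 p -> nrm ip2 (wpair w p) <= K * nrm ip2 p.
Proof.
move=> mw wK lp; have K0 : 0 <= K by apply: le_trans (wK point).
have lw := wpair_l22 mw wK lp.
rewrite -ler_sqr ?nnegrE ?mulr_ge0 ?nrm_ge0// exprMn !(nrm_sq HL2)//.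
have [p1 p2] := lp; rewrite /sip2 mulrDr; apply: lerD; exact: l2_nrm_mul.
Qed.

(** Core functions approximate [p] in energy and in norm. Their weighted versions converge in norm,
    the weight being bounded, and are Cauchy in energy by the last bound of [core_estimate];
    closedness puts the limit in the domain, and the inequality passes to the limit. *)
Lemma weighted_energy (r M : R) psi p : (forall x, `|psi x| <= M) ->
  D0 mu E psi -> D2 p ->
  let w := wexp (2 * r) psi in
  D2 (wpair w p) /\ 0 <= er2 p (wpair w p) + r ^+ 2 * ip2 p (wpair w p).
Proof.
move=> psiM psi0 Dp w.
have mpsi : measurable_fun setT psi by case: psi0 => _ /linfP[].
have mw : measurable_fun setT w by exact: wexp_measurable.
have wK x : `|w x| <= expR (`|2 * r| * M) by exact: wexp_bnd.
have [_ C0 Clin Cdense] := Hcore.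
pose s2 p q := er2 p q + 1 * ip2 p q.
have Hs2 : sip D2 s2 by exact: (sip_add HD2 sip_D2_ip2 ler01).
have Dpc : fdom E (pairc p) by apply/(fdom_pair HE); rewrite paircK.
have ex (n : nat) : exists g, (fdom E `&` Linfc mu) g /\ nrm s2 (cpair g - p) < n.+1%:R^-1.
  have n0 : 0 < n.+1%:R^-1 :> R by rewrite invr_gt0.
  have [g Cg hg] := Cdense _ _ Dpc n0; exists g; split => //.
  have Dg : D2 (cpair g) by apply/(fdom_pair HE); case: Cg.
  apply: le_lt_trans hg; rewrite (nrmBC Hs2)//.
  have Eq : cpair (pairc p \- g) = p - cpair g.
    by rewrite cpairB paircK.
  have Dd : D2 (p - cpair g) by exact: (sip_domB HD2).
  have Dd' : fdom E (pairc p \- g) by apply/(fdom_pair HE); rewrite Eq.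
  have ld : L2 mu (pairc p \- g) by exact: (df_L2 HE).
  rewrite /nrm L2norm_sq// Eq /energy (form_pair HE)// Eq /= /s2 mul1r.
  exact: lexx.
have [g hg] := choice ex.
pose x n := cpair (g n).
have Dg n : fdom E (g n) by case: (hg n) => -[].
have Dx n : D2 (x n) by apply/(fdom_pair HE).
have xp : ncvg s2 x p.
  move=> e0 e0_gt0; have [N hN] := invS_small e0_gt0; exists N => n /hN h.
  by apply: lt_trans h; case: (hg n).
have er_s u : D2 u -> nrm er2 u <= nrm s2 u.
  move=> Du; rewrite ler_sqrt ?(sip_ge0 Hs2)// /s2 mul1r lerDl.
  exact: (sip_ge0 sip_D2_ip2).
have ip_s u : D2 u -> nrm ip2 u <= nrm s2 u.
  move=> Du; rewrite ler_sqrt ?(sip_ge0 Hs2)// /s2 mul1r lerDr.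
  exact: (sip_ge0 HD2).
have xp_er : ncvg er2 x p.
  move=> e0 /xp[N hN]; exists N => n /hN; apply: le_lt_trans.
  by apply: er_s; exact: (sip_domB HD2).
have xp_ip : ncvg ip2 x p.
  move=> e0 /xp[N hN]; exists N => n /hN; apply: le_lt_trans.
  by apply: ip_s; exact: (sip_domB HD2).
have CE n := core_estimate sfin HE Hloc r psiM psi0 (Dg n) (hg n).1.2.
have Dwx n : D2 (wpair w (x n)) by case: (CE n).
have lp := D2_l22 Dp.
have lwp : l22 (wpair w p) by exact: wpair_l22 wK lp.
have wx_ip : ncvg ip2 (fun n => wpair w (x n)) (wpair w p).
  move=> e0 e0_gt0.
  have K0 : 0 < expR (`|2 * r| * M) by exact: expR_gt0.
  have [N hN] := xp_ip _ (divr_gt0 e0_gt0 K0); exists N => n /hN.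
  rewrite ltr_pdivlMr// mulrC => h; rewrite -wpairB; apply: le_lt_trans h.
  by apply: wpair_nrm => //; apply: (sip_domB HL2) => //; exact: D2_l22.
pose K := expR (`|2 * r| * (M + 1)) ^+ 2.
pose C := 2 * K + 2 * (K * (2 * r) ^+ 2) + 1.
have K0 : 0 <= K by exact: sqr_ge0.
have K1 : 0 <= K * (2 * r) ^+ 2 by rewrite mulr_ge0 ?sqr_ge0.
have C1 : 0 < C by rewrite /C; lra.
have wx_er : ncauchy er2 (fun n => wpair w (x n)).
  move=> e0 e0_gt0; have e1 : 0 < e0 / (C + 1) by rewrite divr_gt0//; lra.
  have [N hN] := ncvg_cauchy Hs2 Dx Dp xp e1; exists N => m n Nm Nn.
  have := hN m n Nm Nn; rewrite ltr_pdivlMr; last by lra.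
  move=> h; apply: le_lt_trans h.
  (* The core is a subspace, so the energy bound applies to differences with the same constants. *)
  have Cmn : (fdom E `&` Linfc mu) (fun y => (-1)%:C%C * g n y + g m y).
    by rewrite rmorphN1; apply: Clin; [case: (hg n)|case: (hg m)].
  have [] := core_estimate sfin HE Hloc r psiM psi0 Cmn.1 Cmn.2.
  rewrite cpair_lin scaleN1r addrC -/(x m) -/(x n) -/w -/K wpairB => Dmn _ hmn.
  have Dd := sip_domB HD2 (Dx m) (Dx n).
  rewrite -ler_sqr ?nnegrE ?mulr_ge0 ?nrm_ge0//; last by lra.
  rewrite exprMn (nrm_sq HD2)// (nrm_sq Hs2)//.
  apply: le_trans hmn _; rewrite /s2 mul1r.
  have := sip_ge0 HD2 Dd; have := sip_ge0 sip_D2_ip2 Dd.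
  move: (er2 _ _) (ip2 _ _) => a b b0 a0.
  have h1 : 0 <= K * (2 * r) ^+ 2 * a by rewrite mulr_ge0.
  have h2 : 0 <= K * b by rewrite mulr_ge0.
  have h3 : C * (a + b) <= (a + b) * (C + 1) ^+ 2.
    rewrite mulrC ler_wpM2l//; [by lra|nra].
  by apply: le_trans h3; rewrite /C; lra.
have [Dwp wxE] := pair_closed Dwx lwp wx_ip wx_er.
split => //.
have r20 := sqr_ge0 r.
have Hs := sip_add HD2 sip_D2_ip2 r20.
apply: (ncvg_ge0 Hs Dx Dwx Dp Dwp).
- exact: (ncvg_add HD2 sip_D2_ip2).
- exact: (ncvg_add HD2 sip_D2_ip2).
- by move=> n; case: (CE n).
Qed.

End WeightedEnergy.

(** * The semigroup on pairs and its generator *)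

Section Generator.
Context (X : ptopologicalType) (R : realType).
Variable mu : {measure set (borel X) -> \bar R}.
Context (E : l2form (borel X) R) (S : R -> (borel X -> R[i]) -> (borel X -> R[i])).
Hypotheses (HE : dirichlet_form mu E)
  (HS : semigroup_generated_by mu (form_operator mu E) S).
Local Notation ip := (ip mu).
Local Notation l2 := (l2 mu).
Local Notation er := (renergy E).
Local Notation D := (rdom E).
Local Notation ip2 := (sip2 ip).
Local Notation er2 := (sip2 er).
Local Notation l22 := (dom2 l2).
Local Notation D2 := (dom2 D).
Implicit Types (p q : (borel X -> R) * (borel X -> R)) (f g : borel X -> R[i]).

Let HR := real_dirichlet_form HE.
Let HD : sip D er := rd_sip HR.
Let HL : sip l2 ip := sip_l2 mu.
Let HD2 : sip D2 er2 := sip_pair HD.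
Let HL2 : sip l22 ip2 := sip_pair HL.

Definition Spair (t : R) p := cpair (S t (pairc p)).

Lemma ae_nulleq f g : L2 mu f -> L2 mu g -> ae_eqc mu f g ->
  nulleq ip2 (cpair f) (cpair g).
Proof.
move=> lf lg fg; apply/eqP; rewrite eq_le nrm_ge0 andbT.
have lfg : l22 (cpair f - cpair g) by exact: (sip_domB HL2).
apply: le_trans (nrm_pair HL lfg) _.
rewrite [X in X + _](ae_nrm0 lf.1 lg.1) ?[X in _ + X](ae_nrm0 lf.2 lg.2) ?addr0//.
- by apply: filterS fg => x; rewrite /Ipart => ->.
- by apply: filterS fg => x; rewrite /Rpart => ->.
Qed.

Lemma pairc_lin (c : R) p q :
  pairc (c *: p + q) = (fun x => c%:C%C * pairc p x + pairc q x).
Proof. by rewrite -[RHS]cpairK cpair_lin !paircK. Qed.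

Lemma cvg_at_right0 (F : R -> R) : F t @[t --> 0^'+] --> 0 ->
  forall e : R, 0 < e -> exists2 d : R, 0 < d & forall t : R, 0 < t < d -> `|F t| < e.
Proof.
move=> /cvgrPdist_lt h e e0; have [d /= d0 hd] := h e e0.
exists d => // t /andP[t0 td]; have := hd t; rewrite /= !sub0r !normrN.
by apply => //; rewrite ger0_norm// ltW.
Qed.

Lemma at_right0_cvg (F : R -> R) :
  (forall e : R, 0 < e -> exists2 d : R, 0 < d & forall t : R, 0 < t < d -> `|F t| < e) ->
  F t @[t --> 0^'+] --> 0.
Proof.
move=> h; apply/cvgrPdist_lt => e e0; have [d d0 hd] := h e e0.
exists d => //= t /=; rewrite !sub0r !normrN => td t0.
by apply: hd; rewrite t0 (le_lt_trans (ler_norm _) td).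
Qed.

Lemma Spair_L2 (t : R) p : 0 <= t -> l22 p -> l22 (Spair t p).
Proof. by move=> t0 lp; apply: (sg_L2 HS.1). Qed.

Lemma Spair_lin (t c : R) p q : 0 <= t -> l22 p -> l22 q ->
  nulleq ip2 (Spair t (c *: p + q)) (c *: Spair t p + Spair t q).
Proof.
move=> t0 lp lq; rewrite /Spair -cpair_lin; apply: ae_nulleq.
- by apply: (sg_L2 HS.1) => //; exact: (sip_domP HL2).
- apply/L2_cpair; rewrite cpair_lin.
  by apply: (sip_domP HL2); exact: (sg_L2 HS.1).
- by rewrite pairc_lin; exact: (sg_linear HS.1).
Qed.

Lemma Spair_bounded (t : R) : 0 <= t -> exists M : R, forall p, l22 p ->
  nrm ip2 (Spair t p) <= M * nrm ip2 p.
Proof.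
move=> t0; have [M hM] := sg_bounded HS.1 t0; exists M => p lp.
have := hM (pairc p) lp; rewrite !L2normE ?paircK//; exact: (sg_L2 HS.1).
Qed.

Lemma Spair_0 p : l22 p -> nulleq ip2 (Spair 0 p) p.
Proof.
move=> lp; rewrite -[X in nulleq _ _ X]paircK; apply: ae_nulleq => //.
- by apply: (sg_L2 HS.1).
- exact: (sg_0 HS.1).
Qed.

Lemma Spair_D (s t : R) p : 0 <= s -> 0 <= t -> l22 p ->
  nulleq ip2 (Spair (s + t) p) (Spair s (Spair t p)).
Proof.
move=> s0 t0 lp; rewrite /Spair cpairK; apply: ae_nulleq.
- by apply: (sg_L2 HS.1) => //; exact: addr_ge0.
- by apply: (sg_L2 HS.1) => //; exact: (sg_L2 HS.1).
- exact: (sg_D HS.1).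
Qed.

Lemma Spair_cont p : l22 p -> forall e : R, 0 < e -> exists2 d : R, 0 < d &
  forall t : R, 0 < t < d -> nrm ip2 (Spair t p - p) < e.
Proof.
move=> lp e e0; have := sg_cont HS.1 (f := pairc p) lp.
move/cvg_at_right0 => /(_ e e0)[d d0 hd]; exists d => // t /andP[t0 td].
have := hd t; rewrite t0 td => /(_ isT); rewrite ger0_norm ?L2norm_ge0// L2normE.
  by rewrite cpairB paircK.
apply/L2_cpair; rewrite cpairB paircK; apply: (sip_domB HL2) => //.
by apply: Spair_L2 => //; exact: ltW.
Qed.

Lemma genP p q : generator l22 ip2 Spair p q <-> form_operator mu E (pairc p) (pairc q).
Proof.
have quot (t : R) : cpair (fun x => (t^-1)%:C%C * (pairc p x - S t (pairc p) x) - pairc q x)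
    = t^-1 *: (p - Spair t p) - q.
  have -> : (fun x => (t^-1)%:C%C * (pairc p x - S t (pairc p) x) - pairc q x) =
    (fun x => (t^-1)%:C%C * ((-1)%:C%C * S t (pairc p) x + pairc p x) +
      ((-1)%:C%C * pairc q x + pairc 0 x)).
    apply/funext => x; rewrite rmorphN1 !mulN1r [- _ + _]addrC; congr (_ + _).
    by rewrite -[LHS]addr0.
  rewrite (cpair_lin _ (fun x => (-1)%:C%C * S t (pairc p) x + pairc p x)
    (fun x => (-1)%:C%C * pairc q x + pairc 0 x)) !cpair_lin !paircK !scaleN1r.
  by rewrite addr0 [- _ + p]addrC.
have lq t : 0 < t -> l22 p -> l22 q -> L2 mu
    (fun x => (t^-1)%:C%C * (pairc p x - S t (pairc p) x) - pairc q x).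
  move=> t0 lp lq; apply/L2_cpair; rewrite quot; apply: (sip_domB HL2) => //.
  by apply: (sip_domZ HL2); apply: (sip_domB HL2) => //; apply: Spair_L2 => //; exact: ltW.
split.
- move=> [lp lq' h]; apply/(HS.2); split => //; apply: at_right0_cvg => e e0.
  have [d d0 hd] := h e e0; exists d => // t t0d; have /andP[t0 td] := t0d.
  rewrite ger0_norm ?L2norm_ge0// L2normE ?quot; first exact: hd.
  exact: lq.
- move/(HS.2) => [lp lq' /cvg_at_right0 h]; split => // e e0.
  have [d d0 hd] := h e e0; exists d => // t t0d; have /andP[t0 td] := t0d.
  have := hd t t0d; rewrite ger0_norm ?L2norm_ge0// L2normE ?quot//.
  exact: lq.
Qed.

(** After approximation by some [g] in the form domain, [v N] is k (k + H)^-1 g with k = N + 1. It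
    converges to [g] by [approx_dom], and H maps it to k (g - v N), the second component chosen
    below. *)
Lemma gen_dense p (a : R) : l22 p -> 0 < a ->
  exists p' q, generator l22 ip2 Spair p' q /\ nrm ip2 (p - p') < a.
Proof.
move=> lp a0; have a2 : 0 < a / 2 by lra.
have [g Dg hg] := df_dense HE (f := pairc p) lp a2.
have [g1 g2] := (fdom_pair HE g).1 Dg.
have lg1 := rd_l2 HR g1; have lg2 := rd_l2 HR g2.
have lg : l22 (cpair g) by [].
have ex (u : borel X -> R) : l2 u -> exists x : nat -> borel X -> R,
    forall m, is_resolvent mu D er m.+1%:R u (x m).
  move=> lu.
  have : forall m, exists x, is_resolvent mu D er (m.+1%:R : R) u x.
    by move=> m; exact: (res_ex HR).
  by move/choice => [x hx]; exists x.
have [x hx] := ex _ lg1; have [y hy] := ex _ lg2.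
have DL : D `<=` l2 := rd_l2 HR.
have [_ _ cx] := approx_dom HL HD DL (rd_closed HR) lg1 hx
  (fun m => approx_le HL HD DL lg1 hx m g1).
have [_ _ cy] := approx_dom HL HD DL (rd_closed HR) lg2 hy
  (fun m => approx_le HL HD DL lg2 hy m g2).
have Dx m : D (x m) by case: (hx m).
have Dy m : D (y m) by case: (hy m).
pose v m := (x m, y m).
have lv m : l22 (v m) by split; [exact: (DL _ (Dx m))|exact: (DL _ (Dy m))].
have cv : ncvg ip2 v (cpair g) by exact: (ncvg_pair HL).
have [N hN] := cv _ a2.
exists (v N), (N.+1%:R *: (cpair g - v N)); split.
- apply/genP; have lq : l22 (N.+1%:R *: (cpair g - v N)).
    by apply: (sip_domZ HL2); exact: (sip_domB HL2).
  have DvN : fdom E (pairc (v N)).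
    by apply/(fdom_pair HE); rewrite paircK; split; [exact: Dx|exact: Dy].
  split=> // h Dh; have [h1 h2] := (fdom_pair HE h).1 Dh.
  have lh := df_L2 HE Dh.
  rewrite (form_pair HE) ?innerE//.
  have ls := sip_domB HL lg1 (DL _ (Dx N)); have ls' := sip_domB HL lg2 (DL _ (Dy N)).
  have [_ ex1] := hx N; have [_ ey1] := hy N.
  rewrite !paircK /sip2 /=.
  rewrite -[Ipart (pairc (v N))]/(y N) -[Rpart (pairc (v N))]/(x N).
  rewrite -[Ipart (pairc _)]/(N.+1%:R *: (Ipart g - y N)).
  rewrite -[Rpart (pairc _)]/(N.+1%:R *: (Rpart g - x N)).
  rewrite !(sipZl HL)//; try exact: DL.
  by rewrite !ex1// !ey1//.
- have -> : p - v N = (p - cpair g) + (cpair g - v N) by rewrite addrA subrK.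
  apply: le_lt_trans (nrmD HL2 (sip_domB HL2 lp lg) (sip_domB HL2 lg (lv N))) _.
  rewrite (nrmBC HL2 lg (lv N)).
  have : nrm ip2 (p - cpair g) < a / 2.
    move: hg; rewrite L2normE ?cpairB ?paircK//.
    by apply/L2_cpair; rewrite cpairB paircK; exact: (sip_domB HL2).
  by have := hN N (leqnn N); lra.
Qed.

End Generator.

(** * The Davies-Gaffney bound *)

Section DaviesGaffney.
Context (X : ptopologicalType) (R : realType).
Variable mu : {measure set (borel X) -> \bar R}.
Context (E : l2form (borel X) R) (S : R -> (borel X -> R[i]) -> (borel X -> R[i])).
Hypotheses (sfin : sigma_finite setT mu) (HE : dirichlet_form mu E)
  (Hloc : local_form mu E) (Hcore : is_core mu E (fdom E `&` Linfc mu))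
  (HS : semigroup_generated_by mu (form_operator mu E) S).
Local Notation ip := (ip mu).
Local Notation l2 := (l2 mu).
Local Notation er := (renergy E).
Local Notation D := (rdom E).
Local Notation ip2 := (sip2 ip).
Local Notation er2 := (sip2 er).
Local Notation l22 := (dom2 l2).
Local Notation D2 := (dom2 D).
Implicit Types (p q : (borel X -> R) * (borel X -> R)) (f g : borel X -> R[i])
  (psi : borel X -> R).

Let HR := real_dirichlet_form HE.
Let HD : sip D er := rd_sip HR.
Let HL : sip l2 ip := sip_l2 mu.
Let HD2 : sip D2 er2 := sip_pair HD.
Let HL2 : sip l22 ip2 := sip_pair HL.

(** [Jp] represents -i times [p], orthogonal to [p] with the same norm. The vector [h] rotates [p]
    so that real Cauchy-Schwarz against [q] sees the full modulus of the complex inner product. *)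
Lemma normc_inner_le f g : L2 mu f -> L2 mu g ->
  Normc.normc (inner mu f g) <= L2norm mu f * L2norm mu g.
Proof.
move=> lf lg; rewrite innerE// !L2normE//.
set p := cpair f; set q := cpair g.
have lp : l22 p by []; have lq : l22 q by [].
pose Jp : (borel X -> R) * (borel X -> R) := (p.2, - p.1).
have lJ : l22 Jp by split; [exact: lp.2|exact: (sip_domN HL lp.1)].
set a := ip2 p q; set b := _ - _.
have bE : b = ip2 Jp q by rewrite /sip2 /= (sipNl HL)//; [exact: lp.1|exact: lq.2].
have J0 : ip2 p Jp = 0.
  rewrite /sip2 /= (sipNr HL) ?(sip_sym HL lp.2 lp.1) ?subrr//.
  - exact: lp.2.
  - exact: lp.1.
have JJ : ip2 Jp Jp = ip2 p p.
  rewrite /sip2 /= (sipNl HL lp.1 (sip_domN HL lp.1)) (sipNr HL lp.1 lp.1).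
  by rewrite opprK addrC.
pose h := a *: p + b *: Jp.
have lap := sip_domZ HL2 a lp; have lbJ := sip_domZ HL2 b lJ.
have lh : l22 h by exact: (sip_domD HL2).
have hq : ip2 h q = a ^+ 2 + b ^+ 2.
  by rewrite (sipDl HL2)// !(sipZl HL2)// -/a -bE !expr2.
have hh : ip2 h h = (a ^+ 2 + b ^+ 2) * ip2 p p.
  rewrite (sip_sqD HL2)// !(sipZl HL2)// !(sipZr HL2)// J0 JJ; ring.
have := sip_CS2 HL2 lh lq; rewrite hq hh.
have s0 : 0 <= a ^+ 2 + b ^+ 2 by rewrite addr_ge0 ?sqr_ge0.
move=> CS; rewrite /= -/a.
rewrite -ler_sqr ?nnegrE ?mulr_ge0 ?nrm_ge0 ?sqrtr_ge0// sqr_sqrtr//.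
rewrite exprMn !(nrm_sq HL2)//.
have pp := sip_ge0 HL2 lp; have qq := sip_ge0 HL2 lq.
move: s0 CS pp qq; move: (a ^+ 2 + b ^+ 2) (ip2 p p) (ip2 q q) => s x y s0 CS x0 y0.
rewrite leNgt; apply/negP => h1.
have s1 : 0 < s by apply: le_lt_trans h1; rewrite mulr_ge0.
by move: CS; rewrite expr2 -mulrA ler_pM2l// leNgt h1.
Qed.

(** For [g = H f], moving one weight across gives (w g, w f) = (g, w^2 f) = E(f, w^2 f), which
    [weighted_energy] bounds below by -r^2 times the squared norm of w f. *)
Lemma weighted_semigroup (r t M : R) psi p : (forall x, `|psi x| <= M) ->
  D0 mu E psi -> 0 <= t -> l22 p ->
  nrm ip2 (wpair (wexp r psi) (Spair S t p)) <=
  expR (r ^+ 2 * t) * nrm ip2 (wpair (wexp r psi) p).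
Proof.
move=> psiM psi0 t0 lp.
have mpsi : measurable_fun setT psi by case: psi0 => _ /linfP[].
have mw : measurable_fun setT (wexp r psi) by exact: wexp_measurable.
have wK x : `|wexp r psi x| <= expR (`|r| * M) by exact: wexp_bnd.
apply: (weighted_semigroup_bound HL2 (ncomplete_pair HL (@l2_complete _ _ _ mu))
  (S := Spair S) _ _ _ _ _ _ (W := wpair (wexp r psi)) (K := expR (`|r| * M))) => //.
- exact: (Spair_L2 HS).
- exact: (Spair_lin HS).
- exact: (Spair_bounded HS).
- exact: (Spair_0 HS).
- exact: (Spair_D HS).
- exact: (Spair_cont HS).
- by move=> f; exact: wpair_l22.
- by move=> a f g; exact: wpair_lin.
- by move=> f; exact: wpair_nrm.
- exact: sqr_ge0.
- move=> f g fg; have [lf lg _] := fg.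
  have /(genP HS)[Df _ fE] := fg.
  have Df2 : D2 f by have := (fdom_pair HE _).1 Df; rewrite paircK.
  have [Dw ew] := weighted_energy sfin HE Hloc Hcore r psiM psi0 Df2.
  set w2 := wexp (2 * r) psi in Dw ew.
  have ww x : wexp r psi x * wexp r psi x = w2 x.
    by rewrite /w2 /wexp -expRD; congr expR; ring.
  have sh u v : ip (wexp r psi * u) (wexp r psi * v) = ip u (w2 * v).
    rewrite ip_mulA; congr (ip _ _); apply/funext => x.
    by rewrite !funME mulrA ww.
  have -> : ip2 (wpair (wexp r psi) g) (wpair (wexp r psi) f) = ip2 g (wpair w2 f).
    by rewrite /sip2 /= !sh.
  have lwf : l22 (wpair (wexp r psi) f) by exact: wpair_l22 wK lf.
  rewrite (nrm_sq HL2)//.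
  have -> : ip2 (wpair (wexp r psi) f) (wpair (wexp r psi) f) = ip2 f (wpair w2 f).
    by rewrite /sip2 /= !sh.
  have Dpw : fdom E (pairc (wpair w2 f)) by apply/(fdom_pair HE); rewrite paircK.
  have := congr1 (@complex.Re R) (fE _ Dpw).
  rewrite (form_pair HE)// innerE ?paircK /=; last 2 first.
  - by apply/L2_cpair; rewrite paircK.
  - exact: (df_L2 HE).
  by move: ew; lra.
- exact: (gen_dense HE HS).
Qed.

(** Permits a representative of [psi] bounded everywhere, as needed for the weights. *)
Lemma D0_ae psi psi' : measurable_fun setT psi' ->
  {ae mu, forall x, psi x = psi' x} -> D0 mu E psi -> D0 mu E psi'.
Proof.
move=> mpsi' pp [[_ loc] /linfP[mpsi [M psiM]] hI].
split.
- split; first by split => //; exact: measurable_cst.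
  move=> K cK; have [g Dg gE] := loc K cK; exists g => //.
  by apply: filterS2 gE pp => x h1 h2 Kx; rewrite -h1// /cplx h2.
- apply/linfP; split=> //; exists M.
  by apply: filterS2 psiM pp => x h1 h2; rewrite -h2.
- apply: le_trans hI; apply: ereal_sup_le => _ [phi [v [h1 h2 [ph [q1 q2 q3 q4]] ->]]].
  exists phi, v; split => //.
  exists ph; split => //.
  by apply: filterS2 q3 pp => x k1 k2 Ux; rewrite -k1// /cplx k2.
Qed.

(** [hatI] admits any extension [ph] vanishing on the support of [phi], so its value at zero is not
    zero by definition: [ph * phi] vanishes almost everywhere, and locality kills the energy of
    [ph * ph] against [phi]. *)
Lemma D0_zero : D0 mu E (cst 0).
Proof.
split.
- split; first by split; exact: measurable_cst.
  move=> K _; exists (cst 0); first exact: (df_dom0 HE).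
  by apply: aeW => x _.
- by apply: linf_bnd => //; exists 0 => x; rewrite normr0.
- apply: ge_ereal_sup => _ [phi [v [[Dphi [lphi cs]] _ [ph [Dph lph phE ->]] ->]]].
  suff -> : cdc E ph phi = 0 by rewrite Normc.normc0 lee_fin ler01.
  have zero : {ae mu, forall x, ph x * phi x = 0}.
    apply: filterS2 phE cs.2 => x h1 h2.
    have [xs|xs] := pselect (esupp mu (cplx phi) x).
      by have [<-] := h1 xs; rewrite mul0r.
    by have [->] := h2 xs; rewrite mulr0.
  have mph : measurable_fun setT ph by exact: l2_measurable (rd_l2 HR Dph).
  have mphi : measurable_fun setT phi by exact: l2_measurable (rd_l2 HR Dphi).
  have D00 : D 0 by exact: (sip_dom0 HD).
  have sym0 : {ae mu, forall x, (0 : borel X -> R) x = (ph * phi) x}.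
    by apply: filterS zero => x h; rewrite funME h.
  have D1 : D (ph * phi).
    apply: (rd_ae_dom HR D00 _ sym0).
    by apply: ae_l2 sym0 _ (rd_l2 HR D00); exact: measurable_funM.
  have [M [phM]] : exists M, 0 < M /\ {ae mu, forall x, `|ph x| <= M}.
    have [_ [M hM]] := (linfP mu _).1 lph; exists (`|M| + 1); split.
      by have := normr_ge0 M; lra.
    by apply: filterS hM => x h; apply: le_trans h _; have := ler_norm M; lra.
  move=> hM; have Dc := Db_clamp HR phM Dph.
  have sq : {ae mu, forall x, (clamp M ph * clamp M ph) x = (ph * ph) x}.
    by apply: filterS hM => x h; rewrite !funME clamp_id.
  have [Dcc _] := DbM HR sfin Dc Dc.
  have D3 : D (ph * ph).
    apply: (rd_ae_dom HR Dcc _ sq).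
    by apply: ae_l2 sq _ (rd_l2 HR Dcc); exact: measurable_funM.
  rewrite /cdc (form_cplx HE D1 Dph) (form_cplx HE D3 Dphi).
  rewrite -(rd_ae_val HR D00 D1 Dph sym0) (sip0l HD)//.
  rewrite (rlocal Hloc (a := 0) Dphi D3) ?mulr0 ?subr0//.
  by apply: filterS zero => x h; rewrite addr0 funME mulrA [phi x * _]mulrC h mul0r.
Qed.

Lemma L2_on_weight (A : set (borel X)) (c s M : R) psi f : L2_on mu A f ->
  measurable_fun setT psi -> (forall x, `|psi x| <= M) ->
  {ae mu, forall x, A x -> c * psi x <= s} ->
  nrm ip2 (wpair (wexp c psi) (cpair f)) <= expR s * L2norm mu f.
Proof.
move=> [lf fA] mpsi psiM As; rewrite L2normE//.
have mw : measurable_fun setT (wexp c psi) by exact: wexp_measurable.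
have wK x : `|wexp c psi x| <= expR (`|c| * M) by exact: wexp_bnd.
pose w x := Num.min (wexp c psi x) (expR s).
have mw' : measurable_fun setT w by exact: measurable_minr.
have w0 x : 0 <= w x by rewrite /w le_min !expR_ge0.
have ws x : `|w x| <= expR s by rewrite ger0_norm// /w ge_min lexx orbT.
have lp : l22 (cpair f) by [].
have l1 := wpair_l22 mw wK lp; have l3 := wpair_l22 mw' ws lp.
have E1 : nrm ip2 (wpair (wexp c psi) (cpair f)) = nrm ip2 (wpair w (cpair f)).
  apply: (nulleq_nrm HL2) => //.
  rewrite -[X in nulleq _ X _]paircK -[X in nulleq _ _ X]paircK; apply: ae_nulleq => //.
  apply: filterS2 fA As => x h1 h2; rewrite /pairc /= !funME.
  have [Ax|nAx] := pselect (A x).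
    by rewrite /w min_l// /wexp ler_expR h2.
  by rewrite /Rpart /Ipart h1//= !mulr0.
by rewrite E1; exact: wpair_nrm.
Qed.

Lemma davies_bound (A B : set (borel X)) (r t al be : R) psi f g :
  D0 mu E psi -> 0 <= r -> 0 <= t -> L2_on mu A f -> L2_on mu B g ->
  {ae mu, forall x, A x -> al <= psi x} ->
  {ae mu, forall x, B x -> psi x <= be} ->
  Normc.normc (inner mu f (S t g)) <=
  expR (r ^+ 2 * t - r * (al - be)) * (L2norm mu f * L2norm mu g).
Proof.
move=> psi0 r0 t0 fA gB Aal Bbe.
have [_ /linfP[mpsi [M0 psiM0]] _] := psi0.
pose M := `|M0|; pose psi' := clamp M psi.
have pp : {ae mu, forall x, psi x = psi' x}.
  by apply: filterS psiM0 => x h; rewrite /psi' clamp_id//; apply: le_trans h (ler_norm _).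
have mpsi' : measurable_fun setT psi' by exact: measurable_clamp.
have psi0' := D0_ae mpsi' pp psi0.
have psiM x : `|psi' x| <= M by apply: clamp_le; exact: normr_ge0.
have [lf _] := fA; have [lg _] := gB.
have lSg : L2 mu (S t g) by exact: (sg_L2 HS.1).
have lSp : l22 (Spair S t (cpair g)) by rewrite /Spair cpairK.
have h1 := weighted_semigroup r psiM psi0' t0 (lg : l22 (cpair g)).
have h2 : nrm ip2 (wpair (wexp r psi') (cpair g)) <= expR (r * be) * L2norm mu g.
  apply: L2_on_weight gB mpsi' psiM _.
  by apply: filterS2 pp Bbe => x <- h Bx; rewrite ler_wpM2l// h.
have h3 : nrm ip2 (wpair (wexp (- r) psi') (cpair f)) <= expR (- r * al) * L2norm mu f.
  apply: L2_on_weight fA mpsi' psiM _.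
  by apply: filterS2 pp Aal => x <- h Ax; rewrite !mulNr lerN2 ler_wpM2l// h.
have wK c x : `|wexp c psi' x| <= expR (`|c| * M) by exact: wexp_bnd.
have mw c : measurable_fun setT (wexp c psi') by exact: wexp_measurable.
pose F := pairc (wpair (wexp (- r) psi') (cpair f)).
pose G := pairc (wpair (wexp r psi') (cpair (S t g))).
have lF : L2 mu F by exact: (wpair_l22 (mw (- r)) (wK (- r)) (lf : l22 (cpair f))).
have lG : L2 mu G by exact: (wpair_l22 (mw r) (wK r) (lSg : l22 (cpair (S t g)))).
have ww x : wexp (- r) psi' x * wexp r psi' x = 1.
  by rewrite /wexp -expRD mulNr addNr expR0.
have sh u v : ip (wexp (- r) psi' * u) (wexp r psi' * v) = ip u v.
  by apply: eq_Rintegral => x _; rewrite !funME mulrACA ww mul1r.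
have innE : inner mu f (S t g) = inner mu F G.
  rewrite !innerE// /sip2 !paircK /= !sh.
  by congr (_ +i* (_ - _))%C; rewrite sh.
rewrite innE; apply: le_trans (normc_inner_le lF lG) _.
rewrite !L2normE// !paircK -!L2normE//.
have h4 : nrm ip2 (wpair (wexp r psi') (cpair (S t g))) <=
    expR (r ^+ 2 * t) * (expR (r * be) * L2norm mu g).
  move: h1; rewrite /Spair cpairK => h1; apply: le_trans h1 _.
  by rewrite ler_wpM2l ?expR_ge0.
apply: le_trans (ler_pM _ _ h3 h4) _; rewrite ?nrm_ge0//.
have -> : r ^+ 2 * t - r * (al - be) = - r * al + (r ^+ 2 * t + r * be) by ring.
rewrite !expRD le_eqVlt; apply/orP; left; apply/eqP; ring.
Qed.

Lemma measurable_superlevel psi (m : R) : measurable_fun setT psi ->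
  measurable [set y | m < psi y].
Proof.
move=> mpsi; rewrite -[X in measurable X]setTI.
have -> : [set y | m < psi y] = psi @^-1` `]m, +oo[%classic.
  by apply/seteqP; split=> y /=; rewrite in_itv/= andbT.
exact: mpsi.
Qed.

Lemma ess_sup_on_mem (B : set (borel X)) psi (m : R) :
  mu (B `&` [set y | m < psi y]) = 0%E -> measurable B -> measurable_fun setT psi ->
  {ae mu, forall x, B x -> psi x <= m}.
Proof.
move=> h mB mpsi; exists (B `&` [set y | m < psi y]); split => //.
- apply: measurableI => //.
  exact: measurable_superlevel.
- by move=> x /= /not_implyP[Bx /negP]; rewrite -ltNge.
Qed.

(** The essential bounds are infinite on null sets, so real witnesses are found by contraposition.
    Essential boundedness of [psi] makes both sets of bounds nonempty. *)
Lemma dist_fun_gt (A B : set (borel X)) psi (dl : R) : measurable A -> measurable B ->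
  LinfR mu psi -> (dl%:E < dist_fun mu psi A B)%E -> exists al be,
  [/\ {ae mu, forall x, A x -> al <= psi x}, {ae mu, forall x, B x -> psi x <= be} &
   dl < al - be].
Proof.
move=> mA mB /linfP[mpsi [M psiM]].
pose LB := [set m : R | mu (B `&` [set y | m < psi y]) = 0%E].
pose LA := [set m : R | mu (A `&` [set y | m < - psi y]) = 0%E].
have mpsiN : measurable_fun setT (fun x => - psi x) by exact: measurableT_comp.
apply: contraPP => no; apply/negP; rewrite -leNgt.
have {}no m m' : LB m -> LA m' -> - m' - m <= dl.
  move=> hm hm'; rewrite leNgt; apply/negP => lt; apply: no.
  exists (- m'), m; split => //; last exact: ess_sup_on_mem hm mB mpsi.
  have := ess_sup_on_mem hm' mA mpsiN.
  by apply: filterS => x h Ax; rewrite lerNl h.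
have null (C : set (borel X)) (u : borel X -> R) : measurable_fun setT u ->
    measurable C -> {ae mu, forall x, u x <= M} -> mu (C `&` [set y | M < u y]) = 0%E.
  move=> mu_ mC uM.
  apply/negligibleP.
    by apply: measurableI => //; exact: measurable_superlevel.
  by apply: negligibleS uM => x [_ /= h1] h2; have := lt_le_trans h1 h2; rewrite ltxx.
have LBM : LB M.
  by apply: null => //; apply: filterS psiM => x; apply: le_trans; exact: ler_norm.
have LAM : LA M.
  apply: null => //; apply: filterS psiM => x; apply: le_trans.
  by rewrite -normrN; exact: ler_norm.
rewrite /dist_fun /ess_inf_on /ess_sup_on -/LB -/LA.
set sA := ereal_inf _; set sB := ereal_inf _.
have sB_le m : LB m -> (sB <= m%:E)%E by move=> h; apply: ereal_inf_lbound; exists m.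
have hB m' : LA m' -> ((- m' - dl)%:E <= sB)%E.
  move=> hm'; apply: le_ereal_inf_tmp => _ [m hm <-].
  by rewrite lee_fin; have := no m m' hm hm'; lra.
have hA s : sB = s%:E -> ((- s - dl)%:E <= sA)%E.
  move=> sE; apply: le_ereal_inf_tmp => _ [m' hm' <-]; rewrite lee_fin.
  by have := hB m' hm'; rewrite sE lee_fin; lra.
case: sB sB_le hB hA => [s| |] sB_le hB hA.
- move: (hA s erefl); case: sA {hA} => [a| |].
  + by rewrite !lee_fin => h; lra.
  + by move=> _; rewrite /= leNye.
  + by [].
- by have := sB_le M LBM.
- by have := hB M LAM.
Qed.

Lemma davies_gaffney (A B : set (borel X)) f g (t : R) : measurable A -> measurable B ->
  L2_on mu A f -> L2_on mu B g -> 0 < t ->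
  ((Normc.normc (inner mu f (S t g)))%:E
     <= expeR (- (dE mu E A B ^+ 2 * ((4 * t)^-1)%R%:E))
        * (L2norm mu f)%:E * (L2norm mu g)%:E)%E.
Proof.
move=> mA mB fA gB t0; have t0' := ltW t0.
set L := Normc.normc _; pose N := L2norm mu f * L2norm mu g.
have N0 : 0 <= N by rewrite mulr_ge0// L2norm_ge0.
(* The case [r = 0], needed when the distance is zero and [main] says nothing. *)
have LN : L <= N.
  have ae0 (C : set (borel X)) : {ae mu, forall x, C x -> (0 : R) <= cst 0 x} by apply: aeW.
  have ae0' (C : set (borel X)) : {ae mu, forall x, C x -> cst 0 x <= (0 : R)} by apply: aeW.
  have := davies_bound D0_zero (lexx 0) t0' fA gB (ae0 A) (ae0' B).
  by rewrite expr0n !mul0r subr0 expR0 mul1r.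
pose c : R := (4 * t)^-1; have c0 : 0 < c by rewrite invr_gt0 mulr_gt0.
have main (dl : R) : 0 <= dl -> (dl%:E < dE mu E A B)%E -> L <= expR (- (dl ^+ 2 * c)) * N.
  move=> dl0 /ereal_sup_gt[_ [psi psi0 <-] hd].
  have [_ lpsi _] := psi0.
  have [al [be [hA hB hdl]]] := dist_fun_gt mA mB lpsi hd.
  (* The minimizer of [r ^+ 2 * t - r * dl]. *)
  pose r := dl / (2 * t).
  have r0 : 0 <= r by rewrite divr_ge0// mulr_ge0.
  apply: le_trans (davies_bound psi0 r0 t0' fA gB hA hB) _.
  rewrite ler_wpM2r// ler_expR.
  have h : r * dl <= r * (al - be) by rewrite ler_wpM2l// ltW.
  have -> : - (dl ^+ 2 * c) = r ^+ 2 * t - r * dl.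
    by rewrite /r /c; field; rewrite gt_eqF.
  by rewrite lerD2l lerN2.
(* The distance is about to be squared; the zero function rules out negative values. *)
have dE0 : (0 <= dE mu E A B)%E.
  apply: (@le_trans _ _ (dist_fun mu (cst 0) A B)); last first.
    by apply: ereal_sup_ubound; exists (cst 0) => //; exact: D0_zero.
  have null (C : set (borel X)) (u : borel X -> R) : (forall x, u x = 0) ->
      (ess_sup_on mu C u <= 0)%E.
    move=> u0; apply: ereal_inf_lbound; exists 0 => //=.
    rewrite (_ : C `&` _ = set0) ?measure0//.
    by apply/seteqP; split => x // [_ /=]; rewrite u0 ltxx.
  by rewrite /dist_fun /ess_inf_on adde_ge0// oppe_ge0; apply: null => x; rewrite /= ?oppr0.
rewrite -muleA -EFinM -/N.
case: (dE mu E A B) dE0 main => [d0| |] //.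
- rewrite lee_fin => d00 main.
  have -> : (d0%:E ^+ 2 * c%:E = (d0 ^+ 2 * c)%:E)%E by rewrite -EFin_expe -EFinM.
  rewrite -EFinN /= -EFinM lee_fin.
  apply/ler_addgt0Pr => ep ep0.
  have [->|dn0] := eqVneq d0 0.
    by rewrite expr0n mul0r oppr0 expR0 mul1r; lra.
  have dp : 0 < d0 by rewrite lt0r dn0.
  (* The supremum need not be attained, so [main] is used at [d0 - h]; [K] is a Lipschitz constant
     in [h] for the resulting bound, plus one. *)
  pose K := expR (d0 ^+ 2 * c) * c * (2 * d0) * N + 1.
  have K0 : 0 < K.
    rewrite /K ltr_wpDl//; apply: mulr_ge0 => //; apply: mulr_ge0; last by lra.
    by apply: mulr_ge0; [exact: expR_ge0|exact: ltW].
  pose h := Num.min (d0 / 2) (ep / K).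
  have h0 : 0 < h by rewrite lt_min !divr_gt0.
  have h1 : h <= d0 / 2 by rewrite ge_min lexx.
  have h2 : h * K <= ep by rewrite -ler_pdivlMr// ge_min lexx orbT.
  have dl0 : 0 <= d0 - h by lra.
  have dld : ((d0 - h)%:E < d0%:E)%E by rewrite lte_fin; lra.
  apply: le_trans (main _ dl0 dld) _.
  have b1 : `|- ((d0 - h) ^+ 2 * c)| <= d0 ^+ 2 * c.
    rewrite normrN ger0_norm ?mulr_ge0 ?sqr_ge0 ?(ltW c0)//.
    by rewrite ler_wpM2r ?(ltW c0)// ler_sqr ?nnegrE//; lra.
  have b2 : `|- (d0 ^+ 2 * c)| <= d0 ^+ 2 * c.
    by rewrite normrN ger0_norm// mulr_ge0 ?sqr_ge0// ltW.
  have := expR_lip b1 b2.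
  have -> : - ((d0 - h) ^+ 2 * c) - - (d0 ^+ 2 * c) = c * (h * (2 * d0 - h)) by ring.
  rewrite [`|c * _|]ger0_norm; last first.
    by apply: mulr_ge0; [exact: ltW|apply: mulr_ge0; lra].
  set e1 := expR (- ((d0 - h) ^+ 2 * c)); set e2 := expR (- (d0 ^+ 2 * c)).
  move=> h3; have h4 := le_trans (ler_norm _) h3.
  have h5 : expR (d0 ^+ 2 * c) * (c * (h * (2 * d0 - h))) <=
            expR (d0 ^+ 2 * c) * (c * (h * (2 * d0))).
    by rewrite ler_wpM2l ?expR_ge0// ler_wpM2l ?(ltW c0)// ler_wpM2l ?(ltW h0)//; lra.
  have h6 : (e1 - e2) * N <= expR (d0 ^+ 2 * c) * (c * (h * (2 * d0))) * N.
    by rewrite ler_wpM2r//; lra.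
  move: h2; rewrite /K; lra.
- move=> _ main.
  suff -> : L = 0.
    by rewrite mule_ge0// ?expeR_ge0// lee_fin.
  have L0 : 0 <= L by rewrite /L; case: (inner _ _ _) => a b; exact: sqrtr_ge0.
  apply/eqP; rewrite eq_le L0 andbT leNgt; apply/negP => Lp.
  (* Then exp(dl^2 c) >= 1 + N / L, and [main] gives L + N <= N, against L > 0. *)
  pose dl := N / L / c + 1.
  have q0 : 0 <= N / L / c by rewrite !divr_ge0// ltW.
  have dl1 : 1 <= dl by rewrite /dl; lra.
  have := main dl (le_trans ler01 dl1) (ltry dl).
  have x0 : N / L <= dl ^+ 2 * c.
    rewrite -ler_pdivrMr//; have : N / L / c <= dl by rewrite /dl; lra.
    by move=> h; apply: le_trans h _; rewrite expr2 ler_peMl//; lra.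
  have e1 := expR_ge1Dx (dl ^+ 2 * c).
  have e2 : expR (dl ^+ 2 * c) * expR (- (dl ^+ 2 * c)) = 1 by rewrite -expRD subrr expR0.
  have e3 := expR_gt0 (dl ^+ 2 * c).
  rewrite -(ler_pM2l e3) mulrA e2 mul1r.
  have : L * (1 + N / L) <= L * expR (dl ^+ 2 * c) by rewrite ler_wpM2l//; lra.
  rewrite mulrDr mulr1 [L * (N / L)]mulrC divfK ?gt_eqF//; lra.
Qed.

End DaviesGaffney.

Theorem theorem1p2 (R : realType) (X : ptopologicalType)
    (mu : {measure set (borel X) -> \bar R})
    (E : l2form (borel X) R)
    (S : R -> (borel X -> R[i]) -> (borel X -> R[i])) :
  hausdorff_space X ->
  sigma_finite setT mu ->
  dirichlet_form mu E ->
  local_form mu E ->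
  dom_loc mu E (cst 1) ->
  is_core mu E (fdom E `&` Linfc mu) ->
  semigroup_generated_by mu (form_operator mu E) S ->
  forall A B : set (borel X), measurable A -> measurable B ->
  forall (phiA phiB : borel X -> R[i]) (t : R),
    L2_on mu A phiA -> L2_on mu B phiB -> 0 < t ->
    ((Normc.normc (inner mu phiA (S t phiB)))%:E
     <= expeR (- (dE mu E A B ^+ 2 * ((4 * t)^-1)%R%:E))
        * (L2norm mu phiA)%:E * (L2norm mu phiB)%:E)%E.
Proof.
move=> _ sfin HE Hloc _ Hcore HS A B mA mB phiA phiB t.
exact: (davies_gaffney sfin HE Hloc Hcore HS mA mB).
Qed.
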